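(* Assume the following. (A) There exist $\mathcal F'(\bar u)\in C^1(\omega_1)$ and a bounded bilinear form $\mathcal F''(\bar u)\colon C^1(\omega_1)^*\times C^1(\omega_1)^*\to\mathbb R$ such that $$\lim_{k\to\infty}\frac{\mathcal F(\bar u+t_kh_k)-\mathcal F(\bar u)-t_k\mathcal F'(\bar u)h_k-\tfrac12t_k^2\mathcal F''(\bar u)h_k^2}{t_k^2}=0$$ for all sequences $(t_k)\subset(0,\infty)$, $(h_k)\subset C^1(\omega_1)^*$ with $t_k\to0$, $h_k\stackrel{\star}{\rightharpoonup}h\in C^1(\omega_1)^*$ and $\bar u+t_kh_k\in\operatorname{dom}(\mathcal D)$; additionally $h\mapsto\mathcal F''(\bar u)h^2$ is sequentially weak-$\star$ continuous on $C^1(\omega_1)^*$. (B) $c$ is twice continuously differentiable on $\omega_0\times\omega_1$; $\operatorname{supp}(\bar u)\subset\operatorname{int}(\omega_1)$; $\bar\varphi:=-\frac2\alpha\mathcal F'(\bar u)\in C^1(\omega_1)$ is a Kantorovich potential for $\bar u$ which is twice continuously differentiable on $\operatorname{supp}(\bar u)+B_{\hat\varepsilon}(0)\subset\operatorname{int}(\omega_1)$ for some $\hat\varepsilon>0$; and there are a map $\bar T\colon\omega_0\to\omega_1$ and $\gamma>0$ with $c(x,\eta)-\bar\varphi(\eta)\ge c(x,\bar T(x))-\bar\varphi(\bar T(x))+\frac\gamma2|\eta-\bar T(x)|^2$ for all $x\in\omega_0$, $\eta\in\omega_1$. Then the following conditions are equivalent: (a) $\mathcal F''(\bar u)h^2+\frac\alpha2\mathcal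 D''(\bar u,\bar\varphi;h)>0$ for all $h\in C^1(\omega_1)^*\setminus\{0\}$; (b) $\mathcal F''(\bar u)[\![0,\nu]\!]^2+\frac\alpha2\mathcal D''(\bar u,\bar\varphi;[\![0,\nu]\!])>0$ for all $\nu\in\mathcal M(\omega_1;\mathbb R^d)\setminus\{0\}$; (c) $\mathcal F''(\bar u)[\![0,\tilde\nu]\!]^2+\alpha g^*(\tilde\nu)>0$ for all $\tilde\nu\in\mathcal M(\omega_1;\mathbb R^d)\setminus\{0\}$; (d) $\mathcal F''(\bar u)[\![0,\rho\bar u]\!]^2+\frac\alpha2\int_{\omega_1}\rho^\top H\rho\,d\bar u>0$ for all $\rho\in L^2(\bar u;\mathbb R^d)\setminus\{0\}$.
   Context: Standing assumptions: $d\in\mathbb N$; $\omega_0,\omega_1\subset\mathbb R^d$ are compact; $\omega_1$ is the closure of its interior and $\operatorname{int}\omega_1$ is uniformly locally quasiconvex (a set $A\subset\mathbb R^d$ is so if there are $r>0$, $C\ge1$ such that any $x,y\in A$ with $|x-y|\le r$ can be joined by a curve $\gamma\in C([0,1];A)$, $\gamma(0)=x,\gamma(1)=y$, with Lipschitz constant at most $C|x-y|$); $c\colon\omega_0\times\omega_1\to\mathbb R$ is continuous; $u_0\in\mathcal M(\omega_0)$, $u_0\ge0$, $u_0(\omega_0)>0$, $\operatorname{supp}(u_0)=\omega_0$; $\bar u\in\mathcal M(\omega_1)$ is fixed with $\bar u\ge0$, $\bar u(\omega_1)=u_0(\omega_0)$. $\mathcal M(\omega)=C(\omega)^*$ and $\mathcal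 M(\omega;\mathbb R^d)=C(\omega;\mathbb R^d)^*$ denote the (finite) scalar and vector-valued Borel measures. $B_r(x)$ is the closed ball. $\alpha>0$. Spaces: $C^1(\omega_1)$ is the Banach space of $\varphi\in C(\omega_1)$ continuously differentiable on $\operatorname{int}\omega_1$ with $\nabla\varphi$ extending continuously to $\omega_1$, normed by $\max\{\|\varphi\|_{C(\omega_1)},\|\nabla\varphi\|_{C(\omega_1;\mathbb R^d)}\}$; $C^1(\omega_1)^*$ is its dual. For $\mu\in\mathcal M(\omega_1)$, $\nu\in\mathcal M(\omega_1;\mathbb R^d)$, $[\![\mu,\nu]\!]\in C^1(\omega_1)^*$ is the functional $\varphi\mapsto\int\varphi\,d\mu+\int\nabla\varphi\cdot d\nu$; $\rho\bar u$ is the measure with density $\rho$ w.r.t. $\bar u$. $\Pi\mu:=[\![\mu,0]\!]$ is injective on $\mathcal M(\omega_1)$, and $\bar u$ is identified with $\Pi\bar u$. Functionals: $D(u)=\inf\{\int c\,d\pi:\pi\in\mathcal M(\omega_0\times\omega_1),\pi\ge0,P_0\#\pi=u_0,P_1\#\pi=u\}$ ($P_i$ projection onto $\omega_i$, $\#$ push-forward, $\inf\emptyset=+\infty$). $\mathcal D(\Pi u)=D(u)$ for $u\in\mathcal M(\omega_1)$, $\mathcal D=\infty$ on $C^1(\omega_1)^*\setminus\operatorname{ran}\Pi$, $\operatorname{dom}(\mathcal D)=\{\mathcal D<\infty\}$. $\mathcal F\colon C^1(\omega_1)^*\to\mathbb R$ is given; $\mathcal F''(\bar u)h^2:=\mathcal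 F''(\bar u)[h,h]$. Kantorovich potential for $u$: $\psi\in C(\omega_1)$ with $\int\psi\,du+\int\psi^{\bar c}\,du_0=D(u)$, where $\psi^{\bar c}(x)=\inf_{\eta\in\omega_1}c(x,\eta)-\psi(\eta)$. Weak-$\star$ second subderivative: $\mathcal D''(\bar u,\bar\varphi;h)=\inf\{\liminf_{k\to\infty}\frac{\mathcal D(\bar u+t_kh_k)-\mathcal D(\bar u)-t_k\langle\bar\varphi,h_k\rangle}{t_k^2/2}\}$, infimum over all $(t_k)\subset(0,\infty)$, $t_k\to0$ and $(h_k)\subset C^1(\omega_1)^*$, $h_k\stackrel{\star}{\rightharpoonup}h$. The matrix $H$: under (B), $\bar T(x)$ is the unique minimizer of $c(x,\cdot)-\bar\varphi$ on $\omega_1$, $\bar T$ is continuous and $\bar u=\bar T\#u_0$. By disintegration there is a family $\{\hat u_\eta\}_{\eta\in\omega_1}$ of probability measures on $\omega_0$ with $\eta\mapsto\hat u_\eta(B)$ Borel measurable for Borel $B\subset\omega_0$, $\hat u_\eta(\omega_0\setminus\bar T^{-1}(\{\eta\}))=0$ for $\bar u$-a.e. $\eta$, and $\int_{\omega_0}f\,du_0=\int_{\omega_1}\int_{\bar T^{-1}(\{\eta\})}f\,d\hat u_\eta\,d\bar u(\eta)$ for all Borel $f\colon\omega_0\to[0,\infty]$. For $\bar u$-a.e. $\eta$, $H(\eta):=\big(\int_{\bar T^{-1}(\{\eta\})}[\nabla^2_{\eta\eta}c(y,\eta)-\nabla^2\bar\varphi(\eta)]^{-1}d\hat u_\eta(y)\big)^{-1}$.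 $g^*(\nu):=\frac12\int_{\omega_1}\rho_\nu^\top H\rho_\nu\,d\bar u$ if $\nu\in\mathcal M(\omega_1;\mathbb R^d)$ is absolutely continuous w.r.t. $\bar u$ with Radon–Nikodým derivative $\rho_\nu$, and $g^*(\nu):=\infty$ otherwise.
   Formalization: In (b), ''ν ≠ 0'' is replaced by ''[[0,ν]] ≠ 0 in C^1(ω_1)^*'': for d ≥ 2 a nonzero divergence-free ν (tangential measure on a circle) gives [[0,ν]] = 0, so literal (b) always fails although (a), (c), (d) can hold. *)

(* Defs.v *)
From HB Require Import structures.
From mathcomp Require Import all_boot all_order all_algebra.
From mathcomp Require Import all_classical all_reals all_analysis.
From mathcomp Require Import measurable_realfun.
From mathcomp Require Import ring lra.

Set Implicit Arguments.
Unset Strict Implicit.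
Unset Printing Implicit Defensive.

Import Order.TTheory GRing.Theory Num.Theory.
Import numFieldNormedType.Exports.

Local Open Scope classical_set_scope.
Local Open Scope ring_scope.

(* The library norm on 'rV[R]_d is the sup norm (same topology); the Euclidean
   norm has to be introduced separately. *)
Section euclidean.
Context {R : realType} {d : nat}.
Implicit Types x y : 'rV[R]_d.

Definition dotv x y : R := \sum_i x 0 i * y 0 i.
Definition enorm x : R := Num.sqrt (dotv x x).

Lemma dotvv_ge0 x : 0 <= dotv x x.
Proof. by apply: sumr_ge0 => i _; rewrite -expr2 sqr_ge0. Qed.

Lemma enorm_ge0 x : 0 <= enorm x. Proof. exact: sqrtr_ge0. Qed.

Lemma sqr_enorm x : enorm x ^+ 2 = dotv x x.
Proof. by rewrite sqr_sqrtr ?dotvv_ge0. Qed.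

Lemma enorm_eq0 x : enorm x = 0 -> x = 0.
Proof.
move=> x0; have /eqP : dotv x x = 0 by rewrite -sqr_enorm x0 expr0n.
rewrite /dotv psumr_eq0; last by move=> j _; rewrite -expr2 sqr_ge0.
move=> /allP h; apply/rowP => i; rewrite mxE; apply/eqP.
by have := h i (mem_index_enum _); rewrite /= mulf_eq0 orbb.
Qed.

Lemma dotvDD x y (a b : R) : dotv (a *: x + b *: y) (a *: x + b *: y) =
  a ^+ 2 * dotv x x + (a * b) *+ 2 * dotv x y + b ^+ 2 * dotv y y.
Proof.
rewrite /dotv !mulr_sumr -!big_split/=; apply: eq_bigr => i _.
by rewrite !mxE; ring.
Qed.

Lemma dotv_le x y : dotv x y <= enorm x * enorm y.
Proof.
have [x0|x0] := eqVneq (enorm x) 0.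
  by rewrite x0 mul0r /dotv big1// => i _; rewrite (enorm_eq0 x0) mxE mul0r.
have [y0|y0] := eqVneq (enorm y) 0.
  by rewrite y0 mulr0 /dotv big1// => i _; rewrite (enorm_eq0 y0) mxE mulr0.
have xp : 0 < enorm x by rewrite lt_def x0 enorm_ge0.
have yp : 0 < enorm y by rewrite lt_def y0 enorm_ge0.
have := dotvv_ge0 (enorm y *: x + (- enorm x) *: y).
rewrite dotvDD -!sqr_enorm => h.
have : 0 <= (enorm x * enorm y) *+ 2 * (enorm x * enorm y - dotv x y).
  by apply: le_trans h _; rewrite le_eqVlt; apply/orP; left; apply/eqP; ring.
by rewrite pmulr_rge0 ?subr_ge0// pmulrn_lgt0// mulr_gt0.
Qed.

Lemma enormD x y : enorm (x + y) <= enorm x + enorm y.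
Proof.
rewrite -(@ler_pXn2r _ 2)// ?nnegrE ?addr_ge0 ?enorm_ge0//.
have -> : x + y = 1 *: x + 1 *: y by rewrite !scale1r.
rewrite sqr_enorm dotvDD -!sqr_enorm.
have := dotv_le x y; set a := enorm x; set b := enorm y => h.
by rewrite !expr1n !mul1r; nra.
Qed.

Lemma enormZ (a : R) x : enorm (a *: x) = `|a| * enorm x.
Proof.
rewrite /enorm -sqrtr_sqr -sqrtrM ?sqr_ge0//; congr Num.sqrt.
by rewrite /dotv mulr_sumr; apply: eq_bigr => i _; rewrite !mxE; ring.
Qed.

Lemma coord_le_enorm x i : `|x 0 i| <= enorm x.
Proof.
rewrite -sqrtr_sqr ler_wsqrtr// /dotv (bigD1 i)//= -expr2 lerDl.
by apply: sumr_ge0 => j _; rewrite -expr2 sqr_ge0.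
Qed.

Lemma enorm_le_sum x : enorm x <= \sum_i `|x 0 i|.
Proof.
rewrite -(@ler_pXn2r _ 2)// ?nnegrE ?enorm_ge0 ?sumr_ge0// sqr_enorm.
rewrite expr2 mulr_suml; apply: ler_sum => i _.
rewrite (le_trans (ler_norm _))// normrM ler_wpM2l//.
by rewrite (bigD1 i)//= lerDl sumr_ge0.
Qed.

End euclidean.

Section calculus.
Context {R : realType}.

Definition continuously_differentiable_on (V : normedModType R)
    (U : set V) (f : V -> R) : Prop :=
  (forall x, U x -> differentiable f x) /\
  (forall v x, U x -> {for x, continuous ('D_v f)}).

(* Twice continuously differentiable on an arbitrary set A: f is on A the
   restriction of a function that is C^2 on an open neighbourhood of A. *)
Definition twice_continuously_differentiable_on (V : normedModType R)
    (A : set V) (f : V -> R) : Prop :=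
  exists (U : set V) (g : V -> R),
    [/\ open U, A `<=` U, (forall x, A x -> g x = f x),
        continuously_differentiable_on U g &
        forall v, continuously_differentiable_on U ('D_v g)].

Context {d : nat}.

Definition gradient (f : 'rV[R]_d -> R) (x : 'rV[R]_d) : 'rV[R]_d :=
  \row_i 'D_(delta_mx 0 i) f x.

Definition hessian (f : 'rV[R]_d -> R) (x : 'rV[R]_d) : 'M[R]_d :=
  \matrix_(i, j) 'D_(delta_mx 0 i) ('D_(delta_mx 0 j) f) x.

Definition uniformly_locally_quasiconvex (A : set 'rV[R]_d) : Prop :=
  exists r C : R, [/\ 0 < r, 1 <= C & forall x y, A x -> A y ->
    enorm (x - y) <= r ->
    exists gamma : R -> 'rV[R]_d,
      [/\ {within `[0, 1], continuous gamma},
          (forall t, t \in `[0, 1] -> A (gamma t)),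
          gamma 0 = x, gamma 1 = y &
          forall s t, s \in `[0, 1] -> t \in `[0, 1] ->
            enorm (gamma s - gamma t) <= C * enorm (x - y) * `|s - t|]].

End calculus.

Notation borel V := (g_sigma_algebraType (@open V)).

Section borel_measures.
Context {R : realType} {V : normedModType R}.

Definition concentrated_on (K : set V) (mu : set (borel V) -> \bar R) : Prop :=
  forall A : set (borel V), measurable A -> A `&` K = set0 -> mu A = 0%E.

(* Measures on K are represented by measures on the ambient space that do not
   charge the complement of K; two of them are equal if they agree on Borel
   sets. *)
Record Mpos (K : set V) := MkMpos {
  Mpos_measure :> {finite_measure set (borel V) -> \bar R} ;
  Mpos_on : concentrated_on K Mpos_measure }.

Record M (K : set V) := MkM {
  M_charge :> {charge set (borel V) -> \bar R} ;
  M_on : concentrated_on K M_charge }.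

Lemma czero_on (K : set V) : concentrated_on K (@czero _ (borel V) R).
Proof. by []. Qed.

Definition M0 (K : set V) : M K := MkM (@czero_on K).

Lemma M_of_Mpos_on (K : set V) (mu : Mpos K) :
  concentrated_on K (charge_of_finite_measure mu).
Proof. exact: Mpos_on. Qed.

Definition M_of_Mpos (K : set V) (mu : Mpos K) : M K :=
  MkM (@M_of_Mpos_on K mu).

Definition msupport (mu : set (borel V) -> \bar R) : set V :=
  [set x | forall U : set V, open U -> U x -> (0 < mu U)%E].

Section charge_integral.
Variable nu : {charge set (borel V) -> \bar R}.

Definition hahn_pos : set (borel V) := sval (cid (Hahn_decomposition nu)).
Definition hahn_neg : set (borel V) :=
  sval (cid (svalP (cid (Hahn_decomposition nu)))).
Lemma hahn_pos_neg : hahn_decomposition nu hahn_pos hahn_neg.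
Proof. exact: svalP (cid (svalP (cid (Hahn_decomposition nu)))). Qed.

Definition charge_integral (K : set V) (f : V -> R) : R :=
  \int[jordan_pos hahn_pos_neg]_(x in K) f x -
  \int[jordan_neg hahn_pos_neg]_(x in K) f x.

End charge_integral.

Lemma compact_borel (K : set V) : compact K -> measurable (K : set (borel V)).
Proof.
move=> cK; rewrite -[K]setCK; apply: measurableC; apply: sub_sigma_algebra.
by apply: closed_openC; apply: compact_closed => //; exact: norm_hausdorff.
Qed.

Lemma within_continuous_measurable (K : set V) (f : V -> R) :
  compact K -> {within K, continuous f} ->
  measurable_fun (K : set (borel V)) (f : borel V -> R).
Proof.
move=> cK cf; apply: (measurability _ (RGenOpens.measurableE R)).
move=> _ [_ [a [b ->] <-]].
have /continuousP/(_ `]a, b[%classic (interval_open _ _)) := cf.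
move=> /(_ isT isT)/open_subspaceP[U oU UK]; rewrite setIC -UK; apply: measurableI; first exact: sub_sigma_algebra.
exact: compact_borel.
Qed.

Lemma within_continuous_bounded (W : normedModType R) (K : set V) (f : V -> W) :
  compact K -> {within K, continuous f} ->
  exists C : R, forall x, K x -> `|f x| <= C.
Proof.
move=> cK cf; have /compact_bounded[C [_ hC]] := continuous_compact cf cK.
exists (C + 1) => x Kx; apply: (hC (C + 1)); first by rewrite ltrDl.
by exists x.
Qed.

Lemma within_continuous_integrable (mu : {finite_measure set (borel V) -> \bar R})
    (K : set V) (f : V -> R) : compact K -> {within K, continuous f} ->
  mu.-integrable K (EFin \o f).
Proof.
move=> cK cf.
have mK := compact_borel cK.
apply: measurable_bounded_integrable => //.
- by rewrite ltey_eq fin_num_measure.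
- exact: within_continuous_measurable.
- have [C hC] := within_continuous_bounded cK cf.
  exists C; split; first exact: num_real.
  by move=> D CD x Kx /=; exact: le_trans (hC x Kx) (ltW CD).
Qed.

End borel_measures.

Record regular_compact (R : realType) (d : nat) := RegularCompact {
  rc_set :> set 'rV[R]_d ;
  rc_compact : compact rc_set ;
  rc_closure_interior : closure (interior rc_set) = rc_set }.

Section C1_space.
Context {R : realType} {d : nat} (D : regular_compact R d).
Local Notation K := (rc_set D).
Local Notation V := 'rV[R]_d.

(* Elements of C^1(K) are represented by functions on the whole space vanishing
   off K, so that Leibniz equality is equality on K. *)
Definition C1_pred : {pred (V -> R)} := mem [set f : V -> R |
  [/\ forall x, ~ K x -> f x = 0,
      {within K, continuous f},
      forall x, (interior K) x -> differentiable f x &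
      exists G : V -> V, {within K, continuous G} /\
        forall x, (interior K) x -> G x = gradient f x]].

(* The continuous extension of the gradient from the interior to K. *)
Definition grad (f : V -> R) (x : V) : V :=
  lim (gradient f y @[y --> within (interior K) (nbhs x)]).

Lemma grad_unique (f : V -> R) (G : V -> V) : {within K, continuous G} ->
  (forall x, (interior K) x -> G x = gradient f x) ->
  forall x, K x -> grad f x = G x.
Proof.
move=> cG Gf x Kx.
have PF : ProperFilter (within (interior K) (nbhs x)).
  by apply: within_nbhs_proper; rewrite /infer rc_closure_interior.
have /subspace_continuousP/(_ x Kx) cGx := cG.
apply: cvg_lim; first exact: norm_hausdorff.
have : G y @[y --> within (interior K) (nbhs x)] --> G x.
  move=> B /cGx; rewrite /= !nbhs_simpl /within/=; apply: filterS => y h yK.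
  by apply: h; exact: interior_subset.
move=> GG; apply: cvg_trans GG; apply: near_eq_cvg.
by rewrite near_withinE; apply: nearW => y /Gf.
Qed.

Lemma gradient_lin (a : R) (f g : V -> R) x :
  differentiable f x -> differentiable g x ->
  gradient (a *: f + g) x = a *: gradient f x + gradient g x.
Proof.
move=> df dg; apply/rowP => i; rewrite !mxE.
have df' := @diff_derivable _ _ _ _ _ (delta_mx 0 i) df.
have dg' := @diff_derivable _ _ _ _ _ (delta_mx 0 i) dg.
by rewrite deriveD ?deriveZ//; exact: derivableZ.
Qed.

Lemma C1_submod_closed : submod_closed C1_pred.
Proof.
split.
  rewrite inE; split.
  - by [].
  - by move=> x; exact: cvg_cst.
  - by move=> x _; exact: differentiable_cst.
  - exists (fun=> 0); split; first by move=> x; exact: cvg_cst.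
    by move=> x _; apply/rowP => i; rewrite !mxE derive_cst.
move=> a f g; rewrite !inE => -[f0 cf df [F [cF fF]]] [g0 cg dg [G [cG gG]]].
split.
- by move=> x Kx; rewrite !fctE f0// g0// addr0; exact: mulr0.
- by move=> x; apply: cvgD; [apply: cvgZr; exact: cf|exact: cg].
- move=> x Kx; apply: differentiableD; last exact: dg.
  by apply: differentiableZ; exact: df.
- exists (fun x => a *: F x + G x); split.
    by move=> x; apply: cvgD; [apply: cvgZr; exact: cF|exact: cG].
  by move=> x Kx; rewrite gradient_lin ?fF ?gG//; [exact: df|exact: dg].
Qed.

HB.instance Definition _ := GRing.isSubmodClosed.Build _ _ C1_pred
  C1_submod_closed.

Record C1 := MkC1 { C1_fun :> V -> R ; C1_funP : C1_fun \in C1_pred }.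

HB.instance Definition _ := [isSub for C1_fun].
HB.instance Definition _ := [Choice of C1 by <:].
HB.instance Definition _ := [SubChoice_isSubLmodule of C1 by <:].

Lemma C1_within_continuous (f : C1) : {within K, continuous f}.
Proof. by have := C1_funP f; rewrite inE => -[]. Qed.

Lemma grad_within_continuous (f : C1) : {within K, continuous (grad f)}.
Proof.
have := C1_funP f; rewrite inE => -[_ _ _ [G [cG Gf]]].
apply: (subspace_eq_continuous _ cG) => x /set_mem Kx.
by rewrite /from_subspace (grad_unique cG Gf).
Qed.

Lemma grad_lin (a : R) (f g : C1) x : K x ->
  grad (a *: f + g : C1) x = a *: grad f x + grad g x.
Proof.
move=> Kx.
have := C1_funP f; rewrite inE => -[_ _ df [F [cF fF]]].
have := C1_funP g; rewrite inE => -[_ _ dg [G [cG gG]]].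
rewrite (grad_unique cF fF)// (grad_unique cG gG)//.
apply: (@grad_unique _ (fun x => a *: F x + G x)) => //.
  by move=> y; apply: cvgD; [apply: cvgZr; exact: cF|exact: cG].
move=> y Ky; rewrite fF// gG// -gradient_lin//; [exact: df|exact: dg].
Qed.

Lemma coord_within_continuous (G : V -> V) i :
  {within K, continuous G} -> {within K, continuous (fun x => G x 0 i)}.
Proof.
move=> cG x; apply: (@continuous_comp _ _ _ (G : subspace K -> V)
  (fun v : V => v 0 i)); first exact: cG.
exact: coord_continuous.
Qed.

Definition supK (g : V -> R) : R := sup [set g x | x in K].

Lemma supK_ge (g : V -> R) (C : R) x :
  (forall y, K y -> g y <= C) -> K x -> g x <= supK g.
Proof.
move=> gC Kx; apply: ub_le_sup; last by exists x.
by exists C => _ [y Ky <-]; exact: gC.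
Qed.

Lemma supK_le (g : V -> R) (C : R) : 0 <= C ->
  (forall y, K y -> g y <= C) -> supK g <= C.
Proof.
move=> C0 gC; have [K0|/set0P[x Kx]] := eqVneq (K : set _) set0.
  by rewrite /supK K0 image_set0 sup0.
by apply: ge_sup; [exists (g x); exists x|move=> _ [y Ky <-]; exact: gC].
Qed.

Definition C1_norm (f : C1) : R :=
  Num.max (supK (fun x => `|f x|)) (supK (fun x => enorm (grad f x))).

Lemma C1_bounded (f : C1) : exists C : R,
  forall x, K x -> `|f x| <= C /\ enorm (grad f x) <= C.
Proof.
have [a h1] := within_continuous_bounded (@rc_compact _ _ D) (@C1_within_continuous f).
have [b h2] := within_continuous_bounded (@rc_compact _ _ D) (@grad_within_continuous f).
exists (Num.max a (\sum_(i < d) b)) => x Kx; split.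
  by rewrite le_max h1.
rewrite le_max; apply/orP; right; apply: le_trans (enorm_le_sum _) _.
apply: ler_sum => i _; apply: le_trans (h2 x Kx).
rewrite [leRHS]mx_normE -[leLHS]nngE num_le.
exact: (le_bigmax _ _ (0, i)).
Qed.

Lemma C1_norm_ge (f : C1) x : K x ->
  `|f x| <= C1_norm f /\ enorm (grad f x) <= C1_norm f.
Proof.
move=> Kx; have [C hC] := C1_bounded f.
rewrite !le_max; split; apply/orP; [left|right].
  by apply: (supK_ge (C := C)) => // y /hC[].
by apply: (@supK_ge (fun x => enorm (grad f x)) C) => // y /hC[].
Qed.

Lemma C1_norm_le (f : C1) (C : R) : 0 <= C ->
  (forall x, K x -> `|f x| <= C /\ enorm (grad f x) <= C) -> C1_norm f <= C.
Proof.
move=> C0 h; rewrite ge_max; apply/andP; split.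
  by apply: supK_le => // y /h[].
by apply: supK_le => // y /h[].
Qed.

Lemma C1_norm_ge0 (f : C1) : 0 <= C1_norm f.
Proof.
have [K0|/set0P[x Kx]] := eqVneq (K : set _) set0.
  by rewrite /C1_norm /supK K0 !image_set0 sup0 maxxx.
by have [h _] := C1_norm_ge f Kx; apply: le_trans h.
Qed.

Lemma grad0 x : K x -> grad (0 : C1) x = 0.
Proof.
move=> Kx; have := grad_lin 1 (0 : C1) 0 Kx.
by rewrite !scale1r addr0 => /eqP; rewrite -subr_eq0 opprD addNKr oppr_eq0 => /eqP.
Qed.

Lemma C1_normD (f g : C1) : C1_norm (f + g) <= C1_norm f + C1_norm g.
Proof.
apply: C1_norm_le => [|x Kx]; first by rewrite addr_ge0 ?C1_norm_ge0.
have [f1 f2] := C1_norm_ge f Kx; have [g1 g2] := C1_norm_ge g Kx; split.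
  by apply: le_trans (lerD f1 g1); exact: ler_normD.
rewrite -[f]scale1r grad_lin// !scale1r.
by apply: le_trans (lerD f2 g2); exact: enormD.
Qed.

Lemma C1_normZ_le (a : R) (f : C1) : C1_norm (a *: f) <= `|a| * C1_norm f.
Proof.
apply: C1_norm_le => [|x Kx]; first by rewrite mulr_ge0 ?C1_norm_ge0.
have [f1 f2] := C1_norm_ge f Kx; split.
  by rewrite [X in X <= _]normrM ler_wpM2l.
rewrite -[a *: f]addr0 grad_lin// grad0// addr0 enormZ.
by rewrite ler_wpM2l.
Qed.

Lemma C1_normZ (a : R) (f : C1) : C1_norm (a *: f) = `|a| * C1_norm f.
Proof.
apply/eqP; rewrite eq_le C1_normZ_le/=.
have [->|a0] := eqVneq a 0; first by rewrite normr0 mul0r C1_norm_ge0.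
rewrite -ler_pdivlMl ?normr_gt0// -normfV.
by rewrite -[in leLHS](scalerK a0 f) C1_normZ_le.
Qed.

Lemma C1_norm0_eq0 (f : C1) : C1_norm f = 0 -> f = 0.
Proof.
move=> f0; apply: val_inj; apply/funext => x /=.
have [Kx|nKx] := pselect (K x).
  have [] := C1_norm_ge f Kx.
  by rewrite f0 normr_le0 => /eqP fx _.
by have := C1_funP f; rewrite inE => -[->].
Qed.

HB.instance Definition _ := @Lmodule_isNormed.Build R C1 C1_norm
  C1_normD C1_normZ C1_norm0_eq0.

Definition C1dual_pred : {pred (C1 -> R)} := mem [set h : C1 -> R |
  linear (h : C1 -> R^o) /\ continuous h].

Lemma C1dual_submod_closed : submod_closed C1dual_pred.
Proof.
split.
  rewrite inE; split; last exact: (@cst_continuous C1 R 0).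
  by move=> a u v; change (0 = a * 0 + 0 :> R); ring.
move=> a f g; rewrite !inE => -[lf cf] [lg cg]; split.
  move=> b u v; have fE : f (b *: u + v) = b * f u + f v := lf b u v.
  have gE : g (b *: u + v) = b * g u + g v := lg b u v.
  change (a * f (b *: u + v) + g (b *: u + v) =
          b * (a * f u + g u) + (a * f v + g v)).
  by rewrite fE gE; ring.
by move=> x; apply: continuousD; [apply: continuousZr; exact: cf|exact: cg].
Qed.

HB.instance Definition _ := GRing.isSubmodClosed.Build _ _ C1dual_pred
  C1dual_submod_closed.

Record C1dual := MkC1dual {
  C1dual_fun :> C1 -> R ; C1dual_funP : C1dual_fun \in C1dual_pred }.

HB.instance Definition _ := [isSub for C1dual_fun].
HB.instance Definition _ := [Choice of C1dual by <:].
HB.instance Definition _ := [SubChoice_isSubLmodule of C1dual by <:].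

Definition dual_norm (h : C1dual) : R :=
  sup [set `|h f| | f in [set f : C1 | `|f| <= 1]].

Definition weak_star_cvg (h_ : nat -> C1dual) (h : C1dual) : Prop :=
  forall f : C1, h_ k f @[k --> \oo] --> h f.

Definition bracket_fun (mu : M K) (nu : 'I_d -> M K) (f : C1) : R :=
  charge_integral mu K f +
  \sum_(i < d) charge_integral (nu i) K (fun x => grad f x 0 i).

Lemma charge_integral_lin (mu : M K) (a : R) (f g : V -> R) :
  {within K, continuous f} -> {within K, continuous g} ->
  charge_integral mu K (fun x => a * f x + g x) =
  a * charge_integral mu K f + charge_integral mu K g.
Proof.
move=> cf cg; rewrite /charge_integral.
have cK := @rc_compact _ _ D.
have caf : {within K, continuous (fun x => a * f x)}.
  by move=> x; apply: cvgMr; exact: cf.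
have mK := compact_borel cK.
by rewrite !RintegralD//; try exact: within_continuous_integrable;
  rewrite !RintegralZl//; try exact: within_continuous_integrable; ring.
Qed.

Lemma eq_charge_integral (mu : M K) (f g : V -> R) :
  (forall x, K x -> f x = g x) ->
  charge_integral mu K f = charge_integral mu K g.
Proof.
by move=> fg; rewrite /charge_integral; congr (_ - _);
  apply: eq_Rintegral => x /set_mem /fg.
Qed.

Lemma charge_integral_bound (mu : M K) : exists2 C : R, 0 <= C &
  forall (f : V -> R) (B : R), {within K, continuous f} -> 0 <= B ->
    (forall x, K x -> `|f x| <= B) -> `|charge_integral mu K f| <= C * B.
Proof.
have cK := @rc_compact _ _ D; have mK := compact_borel cK.
have main (m : {finite_measure set (borel V) -> \bar R}) (f : V -> R) (B : R) :
    {within K, continuous f} -> 0 <= B -> (forall x, K x -> `|f x| <= B) ->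
    `|\int[m]_(x in K) f x| <= fine (m K) * B.
  move=> cf B0 fB; have intf := within_continuous_integrable m cK cf.
  apply: le_trans (le_normr_Rintegral _ _) _ => //.
  have -> : fine (m K) * B = \int[m]_(x in K) B.
    by rewrite Rintegral_cst// mulrC.
  apply: le_Rintegral => //.
  - by apply: integrable_norm.
  - by apply: within_continuous_integrable => // x; exact: cvg_cst.
pose p := jordan_pos (hahn_pos_neg mu); pose n := jordan_neg (hahn_pos_neg mu).
exists (fine (p K) + fine (n K)); first by rewrite addr_ge0 ?fine_ge0.
move=> f B cf B0 fB; rewrite /charge_integral mulrDl.
apply: le_trans (ler_normB _ _) _; apply: lerD; exact: main.
Qed.

Lemma bracket_proof (mu : M K) (nu : 'I_d -> M K) :
  bracket_fun mu nu \in C1dual_pred.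
Proof.
rewrite inE.
have lin : linear (bracket_fun mu nu : C1 -> R^o).
  move=> a f g; rewrite /bracket_fun.
  have -> : charge_integral mu K (a *: f + g : C1) =
      a * charge_integral mu K f + charge_integral mu K g.
    by rewrite -charge_integral_lin//; exact: C1_within_continuous.
  set F := charge_integral mu K f; set G := charge_integral mu K g.
  pose I (e : C1) i := charge_integral (nu i) K (fun x => grad e x 0 i).
  change (a * F + G + \sum_(i < d) I (a *: f + g) i =
    a * (F + \sum_(i < d) I f i) + (G + \sum_(i < d) I g i)).
  have step (F' G' S T U : R) : U = a * S + T ->
    a * F' + G' + U = a * (F' + S) + (G' + T) by move=> ->; ring.
  apply: step; rewrite mulr_sumr -big_split/=; apply: eq_bigr => i _; rewrite /I.
  rewrite -charge_integral_lin; try exact/coord_within_continuous/grad_within_continuous.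
  by apply: eq_charge_integral => x Kx; rewrite grad_lin// !mxE.
split=> //.
pose L := GRing.isLinear.Build _ _ _ _ (bracket_fun mu nu : C1 -> R^o) lin.
pose l : {linear C1 -> R^o} := HB.pack (bracket_fun mu nu : C1 -> R^o) L.
apply: (@bounded_linear_continuous _ _ _ l); apply/linear_boundedP.
have [C C0 hC] := charge_integral_bound mu.
have /choice[c hc] : forall i, exists c : R, 0 <= c /\
  forall (f : V -> R) (B : R), {within K, continuous f} -> 0 <= B ->
    (forall x, K x -> `|f x| <= B) -> `|charge_integral (nu i) K f| <= c * B.
  by move=> i; have [c c0 h] := charge_integral_bound (nu i); exists c.
exists (C + \sum_i c i); split; first exact: num_real.
move=> r rC f; apply: (@le_trans _ _ ((C + \sum_i c i) * `|f|)); last first.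
  by rewrite ler_wpM2r// ltW.
rewrite mulrDl mulr_suml; apply: le_trans (ler_normD _ _) _; apply: lerD.
  apply: hC => //; first exact: C1_within_continuous.
  by move=> x /(C1_norm_ge f)[].
apply: le_trans (ler_norm_sum _ _ _) _; apply: ler_sum => i _.
apply: (hc i).2 => //.
  exact/coord_within_continuous/grad_within_continuous.
move=> x /(C1_norm_ge f)[_]; apply: le_trans; exact: coord_le_enorm.
Qed.

(* The functional f |-> \int f dmu + \int (grad f) . dnu. *)
Definition bracket (mu : M K) (nu : 'I_d -> M K) : C1dual :=
  MkC1dual (bracket_proof mu nu).

End C1_space.

Section transport.
Context {R : realType} {d : nat}.
Local Notation V := 'rV[R]_d.
Variables (w0 : set V) (w1 : regular_compact R d) (c : V -> V -> R).
Variable u0 : Mpos w0.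

Definition couplings (u : M w1) : set (Mpos (w0 `*` w1)) :=
  [set pi : Mpos (w0 `*` w1) |
    (forall A : set (borel V), measurable A ->
      pushforward pi (fst : borel (V * V)%type -> borel V) A = u0 A) /\
    (forall A : set (borel V), measurable A ->
      pushforward pi (snd : borel (V * V)%type -> borel V) A = u A)].

Definition ot_cost (u : M w1) : \bar R :=
  ereal_inf [set (\int[pi]_(z in w0 `*` w1) (c z.1 z.2)%:E)%E
            | pi in couplings u].

(* The embedding of M(w1) into C^1(w1)^*. *)
Definition Pi (u : M w1) : C1dual w1 := bracket u (fun=> M0 w1).

(* By injectivity of Pi, the infimum runs over at most one measure. *)
Definition ot_dual (h : C1dual w1) : \bar R :=
  ereal_inf [set ot_cost u | u in [set u : M w1 | Pi u = h]].

Definition c_transform (psi : V -> R) (x : V) : R :=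
  inf [set c x eta - psi eta | eta in (w1 : set V)].

Definition kantorovich_potential (u : M w1) (psi : V -> R) : Prop :=
  {within w1, continuous psi} /\
  (charge_integral u w1 psi + \int[u0]_(x in w0) c_transform psi x)%:E =
    ot_cost u.

Definition second_subderivative (ub : C1dual w1) (phi : C1 w1)
    (h : C1dual w1) : \bar R :=
  ereal_inf [set limn_einf (fun k : nat =>
      ((ot_dual (ub + th.1 k *: th.2 k)%R - ot_dual ub
        - (th.1 k * th.2 k phi)%:E) * ((th.1 k ^+ 2 / 2)^-1)%:E)%E)
    | th in [set th : (nat -> R) * (nat -> C1dual w1) |
        [/\ forall k, 0 < th.1 k, th.1 k @[k --> \oo] --> (0 : R) &
            weak_star_cvg th.2 h]]].

Definition second_order_expansion (F : C1dual w1 -> R) (ub : C1dual w1)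
    (F1 : C1 w1) (F2 : C1dual w1 -> C1dual w1 -> R) : Prop :=
  forall (t : nat -> R) (h_ : nat -> C1dual w1) (h : C1dual w1),
    (forall k, 0 < t k) -> t k @[k --> \oo] --> (0 : R) ->
    weak_star_cvg h_ h ->
    (forall k, (ot_dual (ub + t k *: h_ k)%R < +oo)%E) ->
    (F (ub + t k *: h_ k) - F ub - t k * h_ k F1
      - 2^-1 * t k ^+ 2 * F2 (h_ k) (h_ k)) / t k ^+ 2 @[k --> \oo] --> (0 : R).

Definition bounded_bilinear (F2 : C1dual w1 -> C1dual w1 -> R) : Prop :=
  exists C : R, forall g h, `|F2 g h| <= C * dual_norm g * dual_norm h.

Definition weak_star_seq_continuous (q : C1dual w1 -> R) : Prop :=
  forall (h_ : nat -> C1dual w1) (h : C1dual w1), weak_star_cvg h_ h ->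
    q (h_ k) @[k --> \oo] --> q h.

Section disintegration.
Variables (ubar : Mpos w1) (T : V -> V) (uhat : R.-pker (borel V) ~> (borel V)).

(* T^-1({eta}) for T seen as a map defined on w0. *)
Definition fiber (eta : V) : set (borel V) := w0 `&` T @^-1` [set eta].

(* Only the measures uhat eta with eta in w1 matter. *)
Definition is_disintegration : Prop :=
  [/\ forall eta, (w1 : set V) eta -> concentrated_on w0 (uhat eta),
      {ae ubar, forall eta, (w1 : set V) eta ->
         uhat eta ((w0 : set (borel V)) `\` fiber eta) = 0%E} &
      forall f : borel V -> \bar R, measurable_fun (w0 : set (borel V)) f ->
        (forall x, w0 x -> (0 <= f x)%E) ->
        (\int[u0]_(x in w0) f x =
         \int[ubar]_(eta in w1) \int[uhat eta]_(x in fiber eta) f x)%E].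

Definition Hmatrix (phi : V -> R) (eta : V) : 'M[R]_d :=
  invmx (\matrix_(i, j) \int[uhat eta]_(y in fiber eta)
    (invmx (hessian (c y) eta - hessian phi eta)) i j).

End disintegration.

End transport.

Section quadratic_forms.
Context {R : realType} {d : nat} (K : set 'rV[R]_d) (mu : Mpos K).
Local Notation V := 'rV[R]_d.

Definition quad (A : 'M[R]_d) (v : V) : R := (v *m A *m v^T) 0 0.

Definition quad_integral (H : V -> 'M[R]_d) (rho : V -> V) : \bar R :=
  (\int[mu]_(x in K) (quad (H x) (rho x))%:E)%E.

Definition vector_density (nu : 'I_d -> M K) (x : V) : V :=
  \row_i fine (Radon_Nikodym (nu i) mu x).

Definition gstar (H : V -> 'M[R]_d) (nu : 'I_d -> M K) : \bar R :=
  if `[< forall i, nu i `<< mu >]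
  then ((2^-1)%:E * quad_integral H (vector_density nu))%E else +oo%E.

Definition nonzero_measure (nu : 'I_d -> M K) : Prop :=
  ~ (forall i (A : set (borel V)), measurable A -> nu i A = 0%E).

Record L2vec := MkL2vec {
  L2_fun :> V -> V ;
  L2_funP : forall i, (fun x : borel V => L2_fun x 0 i) \in Lfun mu 2%:E }.

Definition nonzero_L2 (rho : L2vec) : Prop := ~ {ae mu, forall x, rho x = 0}.

Lemma L2vec_integrable (rho : L2vec) i :
  mu.-integrable setT (EFin \o (fun x : borel V => rho x 0 i)).
Proof.
apply/Lfun1_integrable; apply: Lfun_subset12; last exact: L2_funP.
exact: fin_num_measure.
Qed.

Lemma L2vec_charge_on (rho : L2vec) i :
  concentrated_on K (induced_charge (L2vec_integrable rho i)).
Proof.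
move=> A mA AK; rewrite /induced_charge null_set_integral//.
- by apply: measurable_funTS; have /integrableP[] := L2vec_integrable rho i.
- exact: Mpos_on.
Qed.

Definition density_measure (rho : L2vec) (i : 'I_d) : M K :=
  MkM (L2vec_charge_on rho i).

End quadratic_forms.

(* Main.v *)
Require Import Defs.
From HB Require Import structures.
From mathcomp Require Import all_boot all_order all_algebra.
From mathcomp Require Import all_classical all_reals all_analysis.
From mathcomp Require Import measurable_realfun.
From mathcomp Require Import ring lra.

Set Implicit Arguments.
Unset Strict Implicit.
Unset Printing Implicit Defensive.

Import Order.TTheory GRing.Theory Num.Theory.
Import numFieldNormedType.Exports.

Local Open Scope classical_set_scope.
Local Open Scope ring_scope.

(** From (a) to (d) the set of directions shrinks and the second subderivative
    D2 of the transport cost gives way to an explicit integral. The implication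
    (a) -> (b) is a restriction; the others rest on two bounds for D2.

    Let E(x, eta) be the excess c x eta - phi eta - (c x (T x) - phi (T x)). It
    is nonnegative, vanishes on the graph of T and grows quadratically away from
    it, so T x is an interior critical point and
      E(x, T x + z) = 1/2 z A(x) z^T + o(|z|^2)
    uniformly in x, where A(x) is a symmetric coercive matrix depending
    continuously on x [excess_taylor]. Write B(eta) for the mean of A^-1 over
    the fibre of T at eta; then H = B^-1 [HmatrixE]. The disintegration turns
    integrals of A^-1 against u0 into integrals of B against ubar
    [integral_quad_fiber_mean].

    Lower bound [second_subderivative_ge]: in the Kantorovich dual problem at
    ubar + t h use the potential phi + t psi. Its c-transform costs at most
    t^2 times half the conjugate quadratic form of A(x) at grad psi (T x), up to
    o(t^2), and therefore
      2 h(psi) - int (grad psi) B (grad psi)^T dubar <= D2 h  for every psi.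

    Upper bound [second_subderivative_le]: given a density rho with
    int rho H rho^T dubar finite, the field v(x) = rho(T x) H(T x) A(x)^-1 has
    fibre means rho and its energy int v A v^T du0 equals that integral.
    Transporting u0 along T + t v, with v truncated, gives competitors whose
    difference quotients are bounded by quantities that tend to the energy; so
    D2 of the functional induced by rho is at most int rho H rho^T dubar.

    Representation [gradient_riesz_ae]: if D2 h is finite, the lower bound says
    that h is bounded for the energy seminorm of B on gradients. Minimising
    energy / 2 - h gives gradients that converge almost everywhere along a fast
    minimising sequence to a field G. Then rho = G B represents h and
    int rho H rho^T dubar <= D2 h. Hence (d) implies (a).

    For (b) -> (c), the upper bound applies to the density of nu whenever gstar
    is finite; if nu induces the zero functional, then positivity comes from the
    definiteness of H. For (c) -> (d), the density of the measure rho ubar is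
    rho almost everywhere. *)

(** * Quadratic forms and their inverses *)

Section linear_algebra.
Context {R : realType} {d : nat}.
Implicit Types (u v w z p : 'rV[R]_d) (A : 'M[R]_d) (g m : R).

Lemma dotvE u v : dotv u v = (u *m v^T) 0 0.
Proof. by rewrite mxE; apply: eq_bigr => i _; rewrite mxE. Qed.

Lemma dotvC u v : dotv u v = dotv v u.
Proof. by apply: eq_bigr => i _; rewrite mulrC. Qed.

Lemma dotvDl u v w : dotv (u + v) w = dotv u w + dotv v w.
Proof. by rewrite -big_split; apply: eq_bigr => i _; rewrite mxE mulrDl. Qed.

Lemma dotvZl (a : R) u v : dotv (a *: u) v = a * dotv u v.
Proof. by rewrite mulr_sumr; apply: eq_bigr => i _; rewrite mxE mulrA. Qed.

Lemma dotvDr u v w : dotv w (u + v) = dotv w u + dotv w v.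
Proof. by rewrite dotvC dotvDl !(dotvC w). Qed.

Lemma dotvZr (a : R) u v : dotv v (a *: u) = a * dotv v u.
Proof. by rewrite dotvC dotvZl dotvC. Qed.

Lemma dot0v u : dotv 0 u = 0.
Proof. by rewrite -(scale0r u) dotvZl mul0r. Qed.

Lemma enorm0 : enorm (0 : 'rV[R]_d) = 0.
Proof. by rewrite /enorm dot0v sqrtr0. Qed.

Lemma sumr_ord_const (a : R) : \sum_(i < d) a = d%:R * a.
Proof. by rewrite sumr_const card_ord mulr_natl. Qed.

Lemma normv_le_enorm u : `|u| <= enorm u.
Proof.
rewrite [leLHS]mx_normE.
have -> : enorm u = (NngNum (enorm_ge0 u))%:num by [].
rewrite num_le; apply/bigmax_leP; split; first by rewrite -num_le/= enorm_ge0.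
by move=> [i j] _; rewrite -num_le/= ord1; exact: coord_le_enorm.
Qed.

Lemma coord_le_normv u i : `|u 0 i| <= `|u|.
Proof.
rewrite [leRHS]mx_normE -[leLHS]nngE num_le.
exact: (le_bigmax _ _ (0, i)).
Qed.

Lemma enorm_le_normv u : enorm u <= d%:R * `|u|.
Proof.
apply: le_trans (enorm_le_sum _) _; rewrite -sumr_ord_const.
by apply: ler_sum => i _; exact: coord_le_normv.
Qed.

Lemma abs_dotv_le u v : `|dotv u v| <= enorm u * enorm v.
Proof.
rewrite ler_norml dotv_le andbT lerNl.
have -> : - dotv u v = dotv (- u) v by rewrite -(scaleN1r u) dotvZl mulN1r.
apply: le_trans (dotv_le _ _) _.
by rewrite -(scaleN1r u) enormZ normrN1 mul1r.
Qed.

Lemma dotv_mulmx u v A : dotv (u *m A) v = dotv u (v *m A^T).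
Proof. by rewrite !dotvE trmx_mul trmxK mulmxA. Qed.

Lemma quadE A v : quad A v = dotv (v *m A) v.
Proof. by rewrite dotvE. Qed.

Lemma quadZ A (a : R) v : quad A (a *: v) = a ^+ 2 * quad A v.
Proof. by rewrite !quadE -scalemxAl dotvZl dotvZr; ring. Qed.

(** Coercivity of an inverse needs an upper bound on the matrix itself, which
    [mxbounded] provides. *)
Definition coercive g A := forall v, g * dotv v v <= quad A v.

Definition mxbounded m A := forall v, enorm (v *m A) <= m * enorm v.

Lemma entries_mxbounded m A : 0 <= m -> (forall i j, `|A i j| <= m) ->
  mxbounded ((d ^ 2)%:R * m) A.
Proof.
move=> m0 Am v; apply: le_trans (enorm_le_sum _) _.
have bnd j : `|(v *m A) 0 j| <= d%:R * (m * enorm v).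
  rewrite mxE; apply: le_trans (ler_norm_sum _ _ _) _.
  rewrite -sumr_ord_const; apply: ler_sum => i _; rewrite normrM mulrC.
  by rewrite ler_pM// coord_le_enorm.
apply: le_trans (ler_sum _ (fun j _ => bnd j)) _.
by rewrite sumr_ord_const natrX expr2 !mulrA.
Qed.

Lemma abs_quad_le m A v : (forall i j, `|A i j| <= m) ->
  `|quad A v| <= (d ^ 2)%:R * m * dotv v v.
Proof.
move=> Am; have [d0|d0] := posnP d.
  rewrite quadE /dotv !big1 ?normr0 ?mulr0// => i _;
    by have := ltn_ord i; rewrite {2}d0.
have m0 : 0 <= m by apply: le_trans (Am (Ordinal d0) (Ordinal d0)).
rewrite quadE; apply: le_trans (abs_dotv_le _ _) _.
rewrite -sqr_enorm expr2 mulrA; apply: ler_wpM2r; first exact: enorm_ge0.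
exact: entries_mxbounded.
Qed.

Lemma coercive_unitmx g A : 0 < g -> coercive g A -> A \in unitmx.
Proof.
move=> g0 cA; rewrite -row_free_unit; apply: inj_row_free => v vA.
have := cA v; rewrite quadE vA dot0v => h; apply: enorm_eq0; apply/eqP.
have : dotv v v == 0 by rewrite eq_le dotvv_ge0 andbT -(ler_pM2l g0) mulr0.
by rewrite -sqr_enorm sqrf_eq0.
Qed.

Lemma quad_invmx A p : A^T = A -> A \in unitmx ->
  quad (invmx A) p = quad A (p *m invmx A).
Proof. by move=> sA uA; rewrite !quadE mulmxKV// dotvC. Qed.

Lemma trmx_invmx A : A^T = A -> (invmx A)^T = invmx A.
Proof. by move=> sA; rewrite trmx_inv sA. Qed.

Lemma invmx_mxbounded g A : 0 < g -> A^T = A -> coercive g A ->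
  mxbounded g^-1 (invmx A).
Proof.
move=> g0 sA cA p; have uA := coercive_unitmx g0 cA.
set w := p *m invmx A.
have h : g * dotv w w <= enorm p * enorm w.
  by apply: le_trans (cA w) _; rewrite quadE /w mulmxKV//; exact: dotv_le.
have [w0|w0] := eqVneq (enorm w) 0.
  by rewrite w0 mulr_ge0 ?invr_ge0 ?enorm_ge0// ltW.
have wp : 0 < enorm w by rewrite lt_def w0 enorm_ge0.
move: h; rewrite -sqr_enorm expr2 mulrA ler_pM2r// => h.
by rewrite ler_pdivlMl.
Qed.

Lemma invmx_coercive g m A : 0 < g -> 0 < m -> A^T = A -> coercive g A ->
  mxbounded m A -> coercive (g / m ^+ 2) (invmx A).
Proof.
move=> g0 m0 sA cA bA p; have uA := coercive_unitmx g0 cA.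
rewrite quad_invmx//; apply: le_trans (cA _); rewrite -mulrA ler_pM2l//.
rewrite ler_pdivrMl ?exprn_gt0// -!sqr_enorm -exprMn.
rewrite ler_pXn2r// ?nnegrE ?mulr_ge0 ?enorm_ge0 ?(ltW m0)//.
by have := bA (p *m invmx A); rewrite mulmxKV.
Qed.

(** Completing the square at the minimiser [p *m invmx A] of the right-hand
    side. *)
Lemma quad_dual A p z : A^T = A -> A \in unitmx -> (forall v, 0 <= quad A v) ->
  - (2^-1 * quad (invmx A) p) <= 2^-1 * quad A z - dotv p z.
Proof.
move=> sA uA A0; set w := p *m invmx A; have := A0 (z + (-1) *: w).
have wA : w *m A = p by rewrite /w mulmxKV.
have -> : quad A (z + (-1) *: w) = quad A z - 2 * dotv p z + quad (invmx A) p.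
  rewrite !quadE !mulmxDl -!scalemxAl !dotvDl !dotvDr !dotvZl !dotvZr wA.
  rewrite (dotv_mulmx z w) sA wA (dotvC z) (dotvC p w); rewrite -/w; ring.
lra.
Qed.

Lemma coercive_quad_ge0 g A v : 0 <= g -> coercive g A -> 0 <= quad A v.
Proof. by move=> g0 cA; apply: le_trans (cA v); rewrite mulr_ge0// dotvv_ge0. Qed.

Lemma quad_sum A u v : A^T = A ->
  quad A (u + v) = quad A u + 2 * dotv (u *m A) v + quad A v.
Proof.
move=> sA; rewrite !quadE mulmxDl !dotvDl !dotvDr (dotv_mulmx v u) sA.
rewrite (dotvC v); ring.
Qed.

End linear_algebra.

(** * Taylor expansions and symmetry of second derivatives *)

Section one_dimensional_restrictions.
Context {R : realType} {V : normedModType R}.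
Implicit Types (f g : V -> R) (x y z a b : V) (U : set V).

Lemma line_is_derive f y z (s : R) : derivable f (y + s *: z) z ->
  is_derive s 1 (fun s => f (y + s *: z)) ('D_z f (y + s *: z)).
Proof.
have e : (fun h : R => h^-1 *: (f (y + (h *: 1 + s) *: z) - f (y + s *: z))) =
   (fun h : R => h^-1 *: (f (h *: z + (y + s *: z)) - f (y + s *: z))).
  apply/funext => h; congr (_ *: (f _ - _)).
  by rewrite scalerDl /GRing.scale/= mulr1 addrCA addrA.
by move=> df; apply: DeriveDef; rewrite ?/derivable ?/derive/= e.
Qed.

Lemma mvt_cc (F F' : R -> R) (l r : R) : l <= r ->
  (forall s, l <= s <= r -> is_derive s 1 F (F' s)) ->
  exists2 s, l <= s <= r & F r - F l = F' s * (r - l).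
Proof.
move=> lr dF; have [||s] := @MVT_segment R F F' l r lr.
- by move=> s; rewrite in_itv/= => /andP[ls sr]; apply: dF; rewrite !ltW.
- apply: derivable_within_continuous => s; rewrite in_itv/= => ls.
  by have [] := dF s ls.
- by rewrite in_itv/= => ls E; exists s.
Qed.

Lemma mvt_line f y z : (forall s : R, 0 <= s <= 1 -> derivable f (y + s *: z) z) ->
  exists2 s : R, 0 <= s <= 1 & f (y + z) - f y = 'D_z f (y + s *: z).
Proof.
move=> df; have [s s01] := mvt_cc ler01 (fun s s01 => line_is_derive (df s s01)).
by rewrite scale1r scale0r addr0 subr0 mulr1 => E; exists s.
Qed.

Lemma taylor1 f y z (M e : R) :
  (forall s : R, 0 <= s <= 1 -> derivable f (y + s *: z) z) ->
  (forall s : R, 0 <= s <= 1 -> `|'D_z f (y + s *: z) - M| <= e) ->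
  `|f (y + z) - f y - M| <= e.
Proof. by move=> /mvt_line[s s01 ->] h; exact: h. Qed.

(** Two applications of the mean value theorem. They give the error [e] where
    an integral remainder would give [e / 2]. *)
Lemma taylor2 f y z (M e : R) :
  (forall s : R, 0 <= s <= 1 -> derivable f (y + s *: z) z) ->
  (forall s : R, 0 <= s <= 1 -> derivable ('D_z f) (y + s *: z) z) ->
  (forall s : R, 0 <= s <= 1 -> `|'D_z ('D_z f) (y + s *: z) - M| <= e) ->
  `|f (y + z) - f y - 'D_z f y - 2^-1 * M| <= e.
Proof.
move=> d1 d2 h.
have e0 : 0 <= e by apply: le_trans (h 0 _); rewrite ?lexx ?ler01.
pose G s := f (y + s *: z) - s * 'D_z f y - s ^+ 2 * (2^-1 * M).
pose G' s := 'D_z f (y + s *: z) - 'D_z f y - s * M.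
have dG (s : R) : 0 <= s <= 1 -> is_derive s 1 G (G' s).
  move=> s01; have D1 := line_is_derive (d1 _ s01).
  rewrite /G /G'; apply: is_derive_eq.
  rewrite /GRing.scale/=; lra.
have [s s01] := mvt_cc ler01 dG.
rewrite /G /G' !scale1r !scale0r addr0 => E.
have -> : f (y + z) - f y - 'D_z f y - 2^-1 * M =
    'D_z f (y + s *: z) - 'D_z f y - s * M by lra.
move: s01 => /andP[s0 s1] {E}.
pose F r := 'D_z f (y + r *: z) - r * M.
pose F' r := 'D_z ('D_z f) (y + r *: z) - M.
have dF (r : R) : 0 <= r <= 1 -> is_derive r 1 F (F' r).
  move=> r01; have D1 := line_is_derive (d2 _ r01).
  rewrite /F /F'; apply: is_derive_eq.
  rewrite /GRing.scale/=; lra.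
have H (r : R) : 0 <= r <= s -> 0 <= r <= 1.
  by move=> /andP[-> rs]/=; exact: le_trans rs s1.
have [r rs] := mvt_cc s0 (fun r rs => dF r (H r rs)).
rewrite /F /F' scale0r addr0 subr0 mul0r subr0 => E.
have -> : 'D_z f (y + s *: z) - 'D_z f y - s * M =
  ('D_z ('D_z f) (y + r *: z) - M) * s by lra.
rewrite normrM (ger0_norm s0) -[leRHS]mulr1.
by apply: ler_pM => //; exact/h/H.
Qed.

Lemma derive_sumZ f x n (c_ : 'I_n -> R) (e : 'I_n -> V) : differentiable f x ->
  'D_(\sum_i c_ i *: e i) f x = \sum_i c_ i * 'D_(e i) f x.
Proof.
move=> df; rewrite deriveE// linear_sum; apply: eq_bigr => i _.
by rewrite linearZ/= deriveE.
Qed.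

Definition C2on U f := continuously_differentiable_on U f /\
  forall v, continuously_differentiable_on U ('D_v f).

Lemma C2on_derivable U f x v : C2on U f -> U x -> derivable f x v.
Proof. by move=> [[df _] _] /df; exact: diff_derivable. Qed.

Lemma C2on_derivable2 U f x v w : C2on U f -> U x -> derivable ('D_w f) x v.
Proof. by move=> [_ /(_ w)[df _]] /df; exact: diff_derivable. Qed.

(** The second difference is symmetric in [a] and [b], and it is a value of
    either iterated derivative: the key to their equality. *)
Lemma second_difference U f x a b : C2on U f ->
  (forall s t : R, 0 <= s <= 1 -> 0 <= t <= 1 -> U (x + s *: a + t *: b)) ->
  exists s t : R, [/\ 0 <= s <= 1, 0 <= t <= 1 &
    f (x + a + b) - f (x + a) - f (x + b) + f x
    = 'D_a ('D_b f) (x + s *: a + t *: b)].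
Proof.
move=> C2 Uab; pose g y := f (a + y) - f y.
have h01 : 0 <= (1 : R) <= 1 by rewrite ler01 lexx.
have h00 : 0 <= (0 : R) <= 1 by rewrite ler01 lexx.
have dsh (t : R) : 0 <= t <= 1 -> is_derive (x + t *: b) b (fun y => f (a + y))
    ('D_b f (a + (x + t *: b))).
  move=> t01; have := Uab 1 t h01 t01; rewrite scale1r => U1.
  have : derivable f (a + (x + t *: b)) b.
    by rewrite addrA (addrC a); exact: C2on_derivable U1.
  have e : (fun h : R => h^-1 *: (f (a + (h *: b + (x + t *: b))) - f (a + (x + t *: b)))) =
   (fun h : R => h^-1 *: (f (h *: b + (a + (x + t *: b))) - f (a + (x + t *: b)))).
    by apply/funext => h; congr (_ *: (f _ - _)); rewrite addrCA.
  by move=> df; apply: DeriveDef; rewrite ?/derivable ?/derive/= e.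
have dg (t : R) : 0 <= t <= 1 -> is_derive (x + t *: b) b g
    ('D_b f (a + (x + t *: b)) - 'D_b f (x + t *: b)).
  move=> t01; have D1 := dsh t t01.
  have D2 : is_derive (x + t *: b) b f ('D_b f (x + t *: b)).
    apply/derivableP; apply: C2on_derivable C2 _.
    by have := Uab 0 t h00 t01; rewrite scale0r addr0.
  by rewrite /g; exact: is_deriveB.
have [t t01 E] : exists2 t : R, 0 <= t <= 1 & g (x + b) - g x = 'D_b g (x + t *: b).
  by apply: mvt_line => t t01; have [] := dg t t01.
have [s s01 E2] : exists2 s : R, 0 <= s <= 1 &
    'D_b f (x + t *: b + a) - 'D_b f (x + t *: b) =
    'D_a ('D_b f) (x + t *: b + s *: a).
  apply: mvt_line => s s01; apply: C2on_derivable2 C2 _.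
  by rewrite addrAC; exact: Uab.
exists s, t; split => //; rewrite (addrAC x (s *: a)) -E2 (addrC (x + t *: b) a).
have -> : 'D_b f (a + (x + t *: b)) - 'D_b f (x + t *: b) = 'D_b g (x + t *: b).
  by have [_ ->] := dg t t01.
rewrite -E /g addrA (addrC a x); lra.
Qed.

Lemma derive_scale_dir f x v (c : R) : differentiable f x ->
  'D_(c *: v) f x = c * 'D_v f x.
Proof. by move=> df; rewrite !deriveE// linearZ. Qed.

End one_dimensional_restrictions.

Section second_derivatives.
Context {R : realType} {V : normedModType R}.
Implicit Types (f g : V -> R) (x y z a b : V) (U : set V).

Lemma derive2_sum U f y n m (c_ : 'I_n -> R) (e : 'I_n -> V)
    (c'_ : 'I_m -> R) (e' : 'I_m -> V) : open U -> C2on U f -> U y ->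
  'D_(\sum_i c_ i *: e i) ('D_(\sum_j c'_ j *: e' j) f) y =
  \sum_i \sum_j c_ i * c'_ j * 'D_(e i) ('D_(e' j) f) y.
Proof.
move=> oU C2 Uy; rewrite derive_sumZ; last by apply: (C2.2 _).1.
apply: eq_bigr => i _.
have -> : 'D_(e i) ('D_(\sum_j c'_ j *: e' j) f) y =
          'D_(e i) (\sum_(j < m) (c'_ j *: 'D_(e' j) f)) y.
  apply: near_eq_derive; near=> u.
  rewrite derive_sumZ; last first.
    by apply: C2.1.1; near: u; exact: open_nbhs_nbhs.
  by rewrite fct_sumE.
rewrite derive_sum; last first.
  by move=> j; apply: derivableZ; exact: C2on_derivable2 C2 Uy.
rewrite mulr_sumr; apply: eq_bigr => j _.
by rewrite deriveZ ?mulrA//; exact: C2on_derivable2 C2 Uy.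
Unshelve. all: end_near. Qed.

Lemma derive2_scale U f y a b (k : R) : open U -> C2on U f -> U y ->
  'D_(k *: a) ('D_(k *: b) f) y = k ^+ 2 * 'D_a ('D_b f) y.
Proof.
move=> oU C2 Uy.
have := derive2_sum (fun _ : 'I_1 => k) (fun=> a) (fun _ : 'I_1 => k) (fun=> b) oU C2 Uy.
by rewrite !big_ord1 expr2.
Qed.

Lemma ler_dist_half (p q u e : R) :
  `|p - u| <= e / 2 -> `|q - u| <= e / 2 -> `|p - q| <= e.
Proof. by rewrite !ler_norml => /andP[? ?] /andP[? ?]; apply/andP; split; lra. Qed.

(** Both iterated derivatives are limits of the same second difference
    quotients. *)
Lemma schwarz U f x a b : open U -> C2on U f -> U x ->
  'D_a ('D_b f) x = 'D_b ('D_a f) x.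
Proof.
move=> oU C2 Ux; apply/eqP; rewrite -subr_eq0 -normr_le0; apply/ler_addgt0Pl => e e0.
rewrite addr0.
have e2 : 0 < e / 2 by rewrite divr_gt0.
have c1 := (C2.2 b).2 a x Ux; have c2 := (C2.2 a).2 b x Ux.
move/cvgrPdist_le : c1 => /(_ _ e2) n1; move/cvgrPdist_le : c2 => /(_ _ e2) n2.
have nU : nbhs x U by exact: open_nbhs_nbhs.
have : nbhs x [set y | (U y /\ `|'D_a ('D_b f) x - 'D_a ('D_b f) y| <= e / 2)
    /\ `|'D_b ('D_a f) x - 'D_b ('D_a f) y| <= e / 2].
  exact: (filterI (filterI nU n1) n2).
move=> /nbhs_ballP[r /= r0 hr].
(* Scaling the directions by k keeps the parallelogram inside the ball. *)
pose k := r / (2 * (`|a| + `|b| + 1)).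
have n0 : 0 < `|a| + `|b| + 1 by rewrite ltr_wpDl ?addr_ge0.
have k0 : 0 < k by rewrite divr_gt0 ?mulr_gt0.
have kr : k * (`|a| + `|b|) < r.
  by rewrite /k -mulrA gtr_pMr// ltr_pdivrMl ?mulr_gt0//; lra.
clearbody k.
have inb (s t : R) : 0 <= s <= 1 -> 0 <= t <= 1 ->
    ball x r (x + s *: (k *: a) + t *: (k *: b)).
  move=> /andP[s0 s1] /andP[t0 t1]; rewrite -ball_normE/= -addrA opprD addNKr normrN.
  apply: le_lt_trans (ler_normD _ _) _; rewrite !normrZ (ger0_norm s0) (ger0_norm t0).
  rewrite (ger0_norm (ltW k0)); apply: le_lt_trans kr.
  have := mulr_ge0 (ltW k0) (normr_ge0 a).
  have := mulr_ge0 (ltW k0) (normr_ge0 b); nra.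
have [|s [t [s01 t01 E1]]] := @second_difference _ _ U f x (k *: a) (k *: b) C2.
  by move=> s t s01 t01; have [[]] := hr _ (inb s t s01 t01).
have [|s' [t' [s01' t01' E2]]] := @second_difference _ _ U f x (k *: b) (k *: a) C2.
  by move=> s' t' s01' t01'; rewrite addrAC; have [[]] := hr _ (inb t' s' t01' s01').
rewrite (addrAC x (s' *: _)) in E2.
have [[U1 h1] _] := hr _ (inb s t s01 t01).
have [[U2 _] h2] := hr _ (inb t' s' t01' s01').
rewrite (derive2_scale _ _ _ oU C2 U1) in E1.
rewrite (derive2_scale _ _ _ oU C2 U2) (addrAC x (k *: b)) in E2.
have aux (p q m n u v : R) : p - q - m + n = k ^+ 2 * u ->
    p - m - q + n = k ^+ 2 * v -> u = v.
  move=> H1 H2; apply: (@mulfI _ (k ^+ 2)); first by rewrite expf_neq0// gt_eqF.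
  by rewrite -H1 -H2 (addrAC p).
move: h1; rewrite (aux _ _ _ _ _ _ E1 E2) => h1; exact: ler_dist_half h1 h2.
Qed.

End second_derivatives.

(** * Uniform expansions along a graph over a compact set *)

Section compact_uniformity.
Context {R : realType} {V : normedModType R} {d : nat}.
Local Notation W := 'rV[R]_d.
Variables (w0 : set V) (T : V -> W).
Hypotheses (cw0 : compact w0) (cT : {within w0, continuous T}).

Lemma subr_mxE (A B : 'M[R]_d) i j : (A - B) i j = A i j - B i j.
Proof. by rewrite !mxE. Qed.

Lemma quadB (A B : 'M[R]_d) (z : W) : quad (A - B) z = quad A z - quad B z.
Proof. by rewrite /quad mulmxBr mulmxBl !mxE. Qed.

(** Compactness of the base makes the radius of a local property around the
    graph uniform. *)
Lemma compact_uniform_near (Q : W -> V -> Prop) :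
  (forall x, w0 x -> \forall x' \near x & z \near (0 : W), w0 x' -> Q z x') ->
  exists2 r : R, 0 < r & forall x z, w0 x -> enorm z <= r -> Q z x.
Proof.
move=> h; have nc := (near_covering_withinP w0).2 ((compact_near_coveringP w0).1 cw0).
have : nbhs (0 : W) [set z | w0 `<=` Q z] by exact: (nc _ (nbhs (0 : W)) Q _ h).
move=> /nbhs_ballP[r /= r0 hr].
exists (r / 2); first by rewrite divr_gt0.
move=> x z w0x zr; apply: hr => //; rewrite -ball_normE/= sub0r normrN.
apply: le_lt_trans (normv_le_enorm _) _; apply: le_lt_trans zr _.
by rewrite ltr_pdivrMr// ltr_pMr// ltr1n.
Qed.

Lemma near_graph (P : set (V * W)) x : w0 x -> nbhs (x, T x) P ->
  \forall x' \near x & z \near (0 : W), w0 x' -> P (x', T x' + z).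
Proof.
move=> w0x [[A B]] /= [nA /nbhs_ballP[e /= e0 hB]] AB.
have /subspace_continuousP/(_ x w0x) := cT.
have e2 : 0 < e / 2 by rewrite divr_gt0.
move=> /cvgrPdist_lt/(_ _ e2) nT.
exists ([set x' | A x' /\ (w0 x' -> `|T x - T x'| < e / 2)], ball 0 (e / 2)).
  split => /=; last by apply: nbhsx_ballx; rewrite divr_gt0.
  by apply: filterI => //; move: nT; rewrite near_withinE.
move=> [x' z] /= [[Ax' Tx']]; rewrite -ball_normE/= sub0r normrN => ze w0x'.
apply: AB; split => //=; apply: hB; rewrite -ball_normE/= opprD addrA.
by apply: le_lt_trans (ler_normB _ _) _; have := Tx' w0x'; lra.
Qed.

Lemma graph_tube (O : set (V * W)) : open O -> (forall x, w0 x -> O (x, T x)) ->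
  exists2 r : R, 0 < r & forall x z, w0 x -> enorm z <= r -> O (x, T x + z).
Proof.
move=> oO hO; apply: (compact_uniform_near (Q := fun z x => O (x, T x + z))) => x w0x.
by apply: near_graph => //; apply: open_nbhs_nbhs; split => //; exact: hO.
Qed.

Lemma graph_uniform_continuous (f : V * W -> R) (e : R) : 0 < e ->
  (forall x, w0 x -> {for (x, T x), continuous f}) ->
  exists2 r : R, 0 < r & forall x z, w0 x -> enorm z <= r ->
    `|f (x, T x + z) - f (x, T x)| <= e.
Proof.
move=> e0 cf.
apply: (compact_uniform_near (Q := fun z x => `|f (x, T x + z) - f (x, T x)| <= e)).
move=> x w0x.
have e2 : 0 < e / 2 by rewrite divr_gt0.
have : nbhs (x, T x) [set u | `|f (x, T x) - f u| <= e / 2].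
  by have /cvgrPdist_le := cf x w0x; exact.
move=> /(near_graph w0x) [[A B] /= [nA nB] AB].
exists (A, B); first by [].
move=> [x' z] /= [Ax' Bz] w0x'.
have := AB (x', z) (conj Ax' Bz) w0x'.
have := AB (x', 0) (conj Ax' (nbhs_singleton nB)) w0x'.
rewrite /= addr0 !ler_norml => /andP[? ?] /andP[? ?]; apply/andP; split; lra.
Qed.

Let e_ (i : 'I_d) : V * W := (0, delta_mx 0 i).

(** The Hessian in the second variable alone, in terms of directions
    [(0, z)] of the product space. *)
Definition fiber_hessian (g : V * W -> R) (p : V * W) : 'M[R]_d :=
  \matrix_(i, j) 'D_(0, delta_mx 0 i) ('D_(0, delta_mx 0 j) g) p.

Lemma fiber_hessianE g p i j : fiber_hessian g p i j =
  'D_(0, delta_mx 0 i) ('D_(0, delta_mx 0 j) g) p.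
Proof. by rewrite mxE. Qed.

Lemma fiber_hessian_continuous (O : set (V * W)) g p i j : C2on O g -> O p ->
  {for p, continuous (fun p => fiber_hessian g p i j)}.
Proof.
move=> C2 Op; rewrite (_ : (fun p => _) =
    'D_(0, delta_mx 0 i) ('D_(0, delta_mx 0 j) g)); first exact: (C2.2 _).2.
by apply/funext => q; rewrite fiber_hessianE.
Qed.

Lemma fiber_dirE (z : W) : ((0 : V), z) = \sum_i z 0 i *: e_ i.
Proof.
have e1 n (f : 'I_n -> V * W) : (\sum_i f i).1 = \sum_i (f i).1.
  by elim/big_ind2 : _ => // a b a' b' <- <-.
have e2 n (f : 'I_n -> V * W) : (\sum_i f i).2 = \sum_i (f i).2.
  by elim/big_ind2 : _ => // a b a' b' <- <-.
rewrite [RHS]surjective_pairing e1 e2; congr pair.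
  by rewrite big1// => i _; rewrite /= scaler0.
by rewrite [LHS]row_sum_delta.
Qed.

Lemma quad_fiber_hessian (O : set (V * W)) g p (z : W) : open O -> C2on O g ->
  O p -> 'D_(0, z) ('D_(0, z) g) p = quad (fiber_hessian g p) z.
Proof.
move=> oO C2 Op; rewrite fiber_dirE (derive2_sum _ _ _ _ oO C2 Op).
rewrite quadE /dotv exchange_big; apply: eq_bigr => j _.
rewrite mxE mulr_suml; apply: eq_bigr => i _; rewrite mxE /e_; ring.
Qed.

Lemma tr_fiber_hessian (O : set (V * W)) g p : open O -> C2on O g ->
  O p -> (fiber_hessian g p)^T = fiber_hessian g p.
Proof. by move=> oO C2 Op; apply/matrixP => i j; rewrite !mxE; exact: schwarz oO C2 Op. Qed.

(** The error is governed by the modulus of continuity of the Hessian along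
    the graph, which is uniform over the compact base. *)
Lemma graph_taylor2 (O : set (V * W)) g (e : R) : open O -> C2on O g ->
  (forall x, w0 x -> O (x, T x)) -> 0 < e ->
  exists2 r : R, 0 < r & forall x z, w0 x -> enorm z <= r ->
    `|g (x, T x + z) - g (x, T x) - 'D_(0, z) g (x, T x)
      - 2^-1 * quad (fiber_hessian g (x, T x)) z| <= e * dotv z z.
Proof.
move=> oO C2 hO e0; have [r1 r10 hr1] := graph_tube oO hO.
pose e' := e / ((d ^ 2)%:R + 1).
have e'0 : 0 < e' by rewrite divr_gt0// ltr_wpDl.
have /choice[r_ hr_] : forall ij : 'I_d * 'I_d, exists r : R, 0 < r /\ forall x z,
    w0 x -> enorm z <= r ->
    `|fiber_hessian g (x, T x + z) ij.1 ij.2 - fiber_hessian g (x, T x) ij.1 ij.2| <= e'.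
  move=> [i j].
  have [|r r0 hr] := @graph_uniform_continuous
      (fun p => fiber_hessian g p i j) e' e'0.
    by move=> x w0x; apply: fiber_hessian_continuous C2 _; exact: hO.
  by exists r.
pose r := \big[Num.min/r1]_ij r_ ij.
exists r.
  by apply: lt_bigmin => // ij _; have [] := hr_ ij.
move=> x z w0x zr.
have zs (s : R) : 0 <= s <= 1 -> enorm (s *: z) <= r.
  move=> /andP[s0 s1]; rewrite enormZ ger0_norm//; apply: le_trans zr.
  by rewrite ler_piMl// enorm_ge0.
have Os (s : R) : 0 <= s <= 1 -> O (x, T x + s *: z).
  move=> s01; apply: hr1 => //; apply: le_trans (zs s s01) _.
  by rewrite /r; apply: bigmin_le_id.
have ptE (s : R) : (x, T x) + s *: (0, z) = (x, T x + s *: z).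
  by change ((x + s *: 0, T x + s *: z) = (x, T x + s *: z)); rewrite scaler0 addr0.
have -> : (x, T x + z) = (x, T x) + (0, z).
  by change ((x, T x + z) = (x + 0, T x + z)); rewrite addr0.
apply: taylor2.
- by move=> s s01; rewrite ptE; apply: C2on_derivable C2 _; exact: Os.
- by move=> s s01; rewrite ptE; apply: C2on_derivable2 C2 _; exact: Os.
- move=> s s01; rewrite ptE (quad_fiber_hessian _ oO C2); last exact: Os.
  have -> : quad (fiber_hessian g (x, T x + s *: z)) z - quad (fiber_hessian g (x, T x)) z =
     quad (fiber_hessian g (x, T x + s *: z) - fiber_hessian g (x, T x)) z.
    by rewrite quadB.
  apply: le_trans (abs_quad_le (m := e') _ _) _.
    move=> i j; rewrite subr_mxE; have [_ /= hij] := hr_ (i, j).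
    apply: hij => //; apply: le_trans (zs s s01) _.
    exact: bigmin_le_cond.
  rewrite ler_wpM2r ?dotvv_ge0// /e' mulrA ler_pdivrMr ?ltr_wpDl//.
  by rewrite mulrC ler_pM2l// lerDl.
Qed.

End compact_uniformity.

(** * Second-order expansion of the excess *)

Lemma enormB {R : realType} {d : nat} (u v : 'rV[R]_d) :
  enorm (u - v) = enorm (v - u).
Proof. by rewrite -opprB -scaleN1r enormZ normrN1 mul1r. Qed.

Section composition_with_snd.
Context {R : realType} {V W : normedModType R}.
Implicit Types (f : W -> R).

Lemma derive_comp_snd f (v : V * W) : 'D_v (f \o snd) = 'D_(v.2) f \o snd.
Proof. by apply/funext. Qed.

Lemma continuously_differentiable_comp_snd (O : set W) f :
  continuously_differentiable_on O f ->
  continuously_differentiable_on ((@snd V W) @^-1` O) (f \o snd).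
Proof.
move=> [df cf]; split => [x Ox|v x Ox].
  apply: differentiable_comp; last exact: df.
  apply: (@linear_differentiable _ _ _ snd) => y; exact: cvg_snd.
rewrite derive_comp_snd; apply: continuous_comp; first exact: cvg_snd.
exact: cf.
Qed.

Lemma C2on_comp_snd (O : set W) f : C2on O f ->
  C2on ((@snd V W) @^-1` O) (f \o snd).
Proof.
move=> [c1 c2]; split; first exact: continuously_differentiable_comp_snd.
by move=> v; rewrite derive_comp_snd; exact: continuously_differentiable_comp_snd.
Qed.

End composition_with_snd.

Lemma ler_dist_sub {R : realType} (cz c0 l1 q1 pz p0 l2 q2 e n : R) :
  `|cz - c0 - l1 - 2^-1 * q1| <= e / 2 * n ->
  `|pz - p0 - l2 - 2^-1 * q2| <= e / 2 * n ->
  `|cz - pz - (c0 - p0) - (l1 - l2) - 2^-1 * (q1 - q2)| <= e * n.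
Proof. by rewrite !ler_norml => /andP[? ?] /andP[? ?]; apply/andP; split; lra. Qed.

(** For a nonnegative [E] with linear part [s * l]: dividing by [s] and letting
    [s] tend to 0 leaves [0 <= l]. *)
Lemma first_order_bound {R : realType} (s l q n E : R) : 0 <= E ->
  E - s * l - 2^-1 * (s ^+ 2 * q) <= s * (s * n) ->
  s * - l <= s * (s * (`|2^-1 * q| + n)).
Proof.
move=> E0 h; have := ler_wpM2l (sqr_ge0 s) (ler_norm (2^-1 * q)); lra.
Qed.

(** Quadratic growth of [E] passes to its second-order part [q] at scale [s]. *)
Lemma second_order_bound {R : realType} (s q n E g e e' : R) : 0 < s ->
  g / 2 * (s * (s * n)) <= E -> E - 2^-1 * (s ^+ 2 * q) <= e' * (s * (s * n)) ->
  2 * (e' * n) <= e -> g * n <= e + q.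
Proof.
move=> s0 h1 h2 ee; have s2 : 0 < s ^+ 2 by rewrite exprn_gt0.
rewrite -(ler_pM2l s2); rewrite -(ler_pM2l s2) in ee; lra.
Qed.

Lemma hessianE {R : realType} {d : nat} (f : 'rV[R]_d -> R) x i j :
  hessian f x i j = 'D_(delta_mx 0 i) ('D_(delta_mx 0 j) f) x.
Proof. by rewrite mxE. Qed.

Section transport_map_continuity.
Context {R : realType} {d : nat}.
Local Notation V := 'rV[R]_d.
Variables (w0 : set V) (w1 : regular_compact R d) (c : V -> V -> R) (phi : C1 w1).
Variables (T : V -> V) (gamma : R).

(** The slack of the dual constraint for the potential [phi], normalised to
    vanish on the graph of [T]. *)
Definition excess (x eta : V) : R := c x eta - phi eta - (c x (T x) - phi (T x)).

Variables (Uc : set (V * V)) (gc : V * V -> R).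
Hypotheses (Ucw : w0 `*` w1 `<=` Uc)
  (gcE : forall z, (w0 `*` w1) z -> gc z = c z.1 z.2) (gcC2 : C2on Uc gc)
  (Tw1 : forall x, w0 x -> rc_set w1 (T x)) (gamma0 : 0 < gamma)
  (growth : forall x eta, w0 x -> rc_set w1 eta ->
    gamma / 2 * enorm (eta - T x) ^+ 2 <= excess x eta).

(** Swapping the targets of two nearby points bounds the distance of these
    targets by the modulus of continuity of the cost. *)
Lemma transport_map_continuous : {within w0, continuous T}.
Proof.
apply/subspace_continuousP => x0 w0x0; apply/cvgrPdist_le => e e0.
(* The two growth inequalities add up to gamma |T x - T x0|^2 <= 2 e'. *)
pose e' := gamma * e ^+ 2 / 2.
have e'0 : 0 < e' by rewrite divr_gt0// mulr_gt0// exprn_gt0.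
have nc := (near_covering_withinP w1).2
  ((compact_near_coveringP w1).1 (@rc_compact _ _ w1)).
have : \forall x \near x0, forall eta, rc_set w1 eta -> w0 x ->
    `|c x eta - c x0 eta| <= e'.
  apply: (nc _ (nbhs x0) (fun x eta => w0 x -> `|c x eta - c x0 eta| <= e') _) => eta w1eta.
  have e2 : 0 < e' / 2 by rewrite divr_gt0.
  have : {for (x0, eta), continuous gc}.
    by apply: differentiable_continuous; apply: gcC2.1.1; exact: Ucw.
  move=> /cvgrPdist_le/(_ _ e2)[[A B] /= [nA nB] AB].
  exists (B, A); first by [].
  move=> [eta' x] /= [Beta' Ax] w1eta' w0x.
  have h1 := AB (x, eta') (conj Ax Beta').
  have h2 := AB (x0, eta') (conj (nbhs_singleton nA) Beta').
  rewrite /= !gcE// in h1 h2; rewrite distrC in h1; rewrite distrC in h2.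
  exact: ler_dist_half h1 h2.
rewrite near_withinE; apply: filterS => x h w0x.
apply: le_trans (normv_le_enorm _) _.
rewrite -(@ler_pXn2r _ 2)// ?nnegrE ?enorm_ge0 ?(ltW e0)// -(ler_pM2l gamma0).
have := growth w0x0 (Tw1 w0x); have := growth w0x (Tw1 w0x0).
have := h _ (Tw1 w0x) w0x; have := h _ (Tw1 w0x0) w0x.
rewrite /excess (enormB (T x)) !ler_norml /e'.
move=> /andP[? ?] /andP[? ?] ? ?; lra.
Qed.

End transport_map_continuity.

Section cost_expansion.
Context {R : realType} {d : nat}.
Local Notation V := 'rV[R]_d.
Variables (w0 : set V) (w1 : regular_compact R d) (c : V -> V -> R) (phi : C1 w1).
Variables (T : V -> V) (gamma : R).

Local Notation excess := (excess c phi T).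

Definition excess_hessian (x : V) : 'M[R]_d := hessian (c x) (T x) - hessian phi (T x).

Hypothesis cw0 : compact w0.
Variables (Uc : set (V * V)) (gc : V * V -> R).
Hypotheses (oUc : open Uc) (Ucw : w0 `*` w1 `<=` Uc)
  (gcE : forall z, (w0 `*` w1) z -> gc z = c z.1 z.2) (gcC2 : C2on Uc gc).
Variables (Up : set V) (gp : V -> R).
Hypotheses (oUp : open Up) (TUp : forall x, w0 x -> Up (T x))
  (gpC2 : C2on Up gp)
  (gpE : forall x, w0 x -> \forall eta \near T x, gp eta = phi eta).
Hypotheses (Tint : forall x, w0 x -> interior (rc_set w1) (T x))
  (gamma0 : 0 < gamma)
  (growth : forall x eta, w0 x -> rc_set w1 eta ->
    gamma / 2 * enorm (eta - T x) ^+ 2 <= excess x eta).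

Let Tw1 x (w0x : w0 x) : rc_set w1 (T x) := interior_subset (Tint w0x).

Let cT := transport_map_continuous Ucw gcE gcC2 Tw1 gamma0 growth.

Let hess_c x : w0 x -> hessian (c x) (T x) = fiber_hessian gc (x, T x).
Proof.
move=> w0x; apply/matrixP => i j; rewrite [RHS]fiber_hessianE [LHS]hessianE.
have -> : 'D_(0, delta_mx 0 i) ('D_(0, delta_mx 0 j) gc) (x, T x) =
          'D_(delta_mx 0 i) ('D_(delta_mx 0 j) (fun eta => gc (x, eta))) (T x).
  have par (v eta : V) (f : V * V -> R) :
      'D_(0, v) f (x, eta) = 'D_v (fun eta => f (x, eta)) eta.
    have e : (fun h : R => h^-1 *: (f (h *: (0, v) + (x, eta)) - f (x, eta))) =
             (fun h : R => h^-1 *: (f (x, h *: v + eta) - f (x, eta))).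
      apply/funext => h; congr (_ *: (f _ - _)).
      by change ((h *: 0 + x, h *: v + eta) = (x, h *: v + eta)); rewrite scaler0 add0r.
    by rewrite /derive/= e.
  have e2 : (fun eta => 'D_(0, delta_mx 0 j) gc (x, eta)) =
      'D_(delta_mx 0 j) (fun eta => gc (x, eta)).
    by apply/funext => eta; rewrite [LHS]par.
  by rewrite [LHS]par e2.
have step (eta : V) (w1eta : interior (rc_set w1) eta) :
    'D_(delta_mx 0 j) (c x) eta = 'D_(delta_mx 0 j) (fun eta => gc (x, eta)) eta.
  have H : nbhs eta [set eta | c x eta = gc (x, eta)].
    have w1n : nbhs eta (rc_set w1) by exact: w1eta.
    by apply: filterS w1n => eta' w1eta' /=; rewrite gcE.
  exact: near_eq_derive H.
have H : nbhs (T x) [set eta | 'D_(delta_mx 0 j) (c x) eta =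
    'D_(delta_mx 0 j) (fun eta => gc (x, eta)) eta].
  have w1n : nbhs (T x) (interior (rc_set w1)) by apply: nbhs_interior; exact: Tint.
  by apply: filterS w1n; exact: step.
exact: near_eq_derive H.
Qed.

Let hess_phi x : w0 x -> hessian phi (T x) = fiber_hessian (gp \o snd) (x, T x).
Proof.
move=> w0x; apply/matrixP => i j; rewrite [RHS]fiber_hessianE [LHS]hessianE.
rewrite !derive_comp_snd.
have n0 := gpE w0x.
have H : nbhs (T x) [set eta | 'D_(delta_mx 0 j) phi eta = 'D_(delta_mx 0 j) gp eta].
  have n1 : nbhs (T x) (interior [set eta | gp eta = phi eta]) by exact: nbhs_interior.
  apply: filterS n1 => eta neta.
  have H : nbhs eta [set eta | phi eta = gp eta].
    by apply: filterS (neta : nbhs eta [set eta | gp eta = phi eta]).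
  exact: near_eq_derive H.
exact: near_eq_derive H.
Qed.

Let OC2 := C2on_comp_snd (V := V) gpC2.

Let oO : open ((@snd V V) @^-1` Up).
Proof. by apply: open_comp oUp => p _; exact: cvg_snd. Qed.

Let Uc_graph x : w0 x -> Uc (x, T x).
Proof. by move=> w0x; apply: Ucw; split => //=; exact: Tw1. Qed.

Lemma excess_hessianE x : w0 x -> excess_hessian x =
  fiber_hessian gc (x, T x) - fiber_hessian (gp \o snd) (x, T x).
Proof. by move=> w0x; rewrite /excess_hessian (hess_c w0x) (hess_phi w0x). Qed.

Lemma tr_excess_hessian x : w0 x -> (excess_hessian x)^T = excess_hessian x.
Proof.
move=> w0x; rewrite (excess_hessianE w0x) linearB/=.
have h1 := tr_fiber_hessian oUc gcC2 (Uc_graph w0x).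
have h2 := tr_fiber_hessian (p := (x, T x)) oO OC2 (TUp w0x).
exact: (congr2 (fun a b => a - b) h1 h2).
Qed.

Let graph_within (f : V * V -> R) : (forall x, w0 x -> {for (x, T x), continuous f}) ->
  {within w0, continuous (fun x => f (x, T x))}.
Proof.
move=> cf; apply/subspace_continuousP => x w0x.
have /subspace_continuousP/(_ x w0x) cTx := cT.
have h : (fun x => (x, T x)) @ within w0 (nbhs x) --> (x, T x).
  move=> P [[A B] /= [nA nB] AB].
  have nB' : within w0 (nbhs x) (T @^-1` B) by exact: cTx.
  have nA' : within w0 (nbhs x) A by rewrite /within/=; apply: filterS nA.
  by apply: filterS (filterI nA' nB') => y [Ay By]; exact: (AB (y, T y)).
exact: (cvg_comp _ _ h (cf x w0x)).
Qed.

Lemma excess_hessian_continuous i j : {within w0, continuous (fun x => excess_hessian x i j)}.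
Proof.
have h : {within w0, continuous (fun x => fiber_hessian gc (x, T x) i j -
    fiber_hessian (gp \o snd) (x, T x) i j)}.
  move=> x; apply: cvgB.
    apply: (graph_within (f := fun p => fiber_hessian gc p i j)) => y w0y.
    exact: fiber_hessian_continuous gcC2 (Uc_graph w0y).
  apply: (graph_within (f := fun p => fiber_hessian (gp \o snd) p i j)) => y w0y.
  exact: (fiber_hessian_continuous (p := (y, T y)) OC2 (TUp w0y)).
apply: subspace_eq_continuous h => x /set_mem w0x.
by rewrite /from_subspace/= (excess_hessianE w0x) subr_mxE.
Qed.

Let linear_part (x z : V) : R :=
  'D_(0, z) gc (x, T x) - 'D_(0, z) (gp \o snd) (x, T x).

Let taylor_with_linear_part e : 0 < e ->
  exists2 r : R, 0 < r & forall x z, w0 x -> enorm z <= r ->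
    interior (rc_set w1) (T x + z) /\
    `|excess x (T x + z) - linear_part x z - 2^-1 * quad (excess_hessian x) z|
      <= e * dotv z z.
Proof.
move=> e0; have e2 : 0 < e / 2 by rewrite divr_gt0.
have [r1 r10 h1] := graph_taylor2 cw0 cT oUc gcC2 Uc_graph e2.
have [r2 r20 h2] := graph_taylor2 cw0 cT oO OC2 TUp e2.
have [r3 r30 h3] : exists2 r : R, 0 < r & forall x z, w0 x -> enorm z <= r ->
    interior (rc_set w1) (T x + z) /\ gp (T x + z) = phi (T x + z).
  apply: (compact_uniform_near cw0 (Q := fun z x =>
    interior (rc_set w1) (T x + z) /\ gp (T x + z) = phi (T x + z))) => x w0x.
  apply: (near_graph cT (P := [set p | interior (rc_set w1) p.2 /\ gp p.2 = phi p.2])) => //.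
  exists (setT, [set eta | interior (rc_set w1) eta /\ gp eta = phi eta]).
    split => /=; first exact: filterT.
    by apply: filterI; [apply: nbhs_interior; exact: Tint|exact: gpE].
  by move=> [y eta] [].
exists (Num.min r1 (Num.min r2 r3)); first by rewrite !lt_min r10 r20 r30.
move=> x z w0x; rewrite !le_min => /and3P[z1 z2 z3].
have [iz gz] := h3 x z w0x z3; split => //.
have := h1 x z w0x z1; have := h2 x z w0x z2.
have [_ g0] : interior (rc_set w1) (T x + 0) /\ gp (T x + 0) = phi (T x + 0).
  by apply: h3 => //; rewrite enorm0 ltW.
rewrite addr0 in g0.
have c1 : gc (x, T x + z) = c x (T x + z).
  by rewrite gcE//; split => //=; exact: (interior_subset iz).
have c0 : gc (x, T x) = c x (T x) by rewrite gcE//; split => //=; exact: Tw1.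
rewrite c1 c0 (_ : (gp \o snd) (x, T x + z) = phi (T x + z))//.
rewrite (_ : (gp \o snd) (x, T x) = phi (T x))// /excess /linear_part (excess_hessianE w0x) quadB.
by move=> h2z h1z; exact: (ler_dist_sub h1z h2z).
Qed.

(** The targets are interior minimisers of the excess, hence critical. *)
Let linear_part0 x z : w0 x -> linear_part x z = 0.
Proof.
have main z' : w0 x -> 0 <= linear_part x z'.
  move=> w0x; have [r r0 h] := taylor_with_linear_part (@ltr01 R).
  rewrite -oppr_le0; apply/ler_addgt0Pl => e e0; rewrite addr0.
  pose C := `|2^-1 * quad (excess_hessian x) z'| + dotv z' z'.
  have C0 : 0 <= C by rewrite addr_ge0 ?dotvv_ge0.
  pose s := Num.min (e / (C + 1)) (r / (enorm z' + 1)).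
  have C1 : 0 < C + 1 by rewrite ltr_wpDl.
  have n1 : 0 < enorm z' + 1 by rewrite ltr_wpDl ?enorm_ge0.
  have s0 : 0 < s by rewrite lt_min !divr_gt0.
  have sr : enorm (s *: z') <= r.
    rewrite enormZ (ger0_norm (ltW s0)).
    apply: (@le_trans _ _ (r / (enorm z' + 1) * enorm z')).
      by rewrite ler_wpM2r ?enorm_ge0// /s ge_min lexx orbT.
    by rewrite mulrAC -mulrA ger_pMr// ler_pdivrMr// mul1r lerDl.
  have se : s * C <= e.
    apply: (@le_trans _ _ (e / (C + 1) * C)).
      by rewrite ler_wpM2r// /s ge_min lexx.
    by rewrite mulrAC -mulrA ger_pMr// ler_pdivrMr// mul1r lerDl.
  have [iz hz] := h x (s *: z') w0x sr.
  have ge0 : 0 <= excess x (T x + s *: z').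
    apply: le_trans (growth w0x (interior_subset iz)).
    by rewrite mulr_ge0 ?sqr_ge0// divr_ge0// ltW.
  have linZ : linear_part x (s *: z') = s * linear_part x z'.
    have ez : ((0 : V), s *: z') = s *: (0, z').
      by change ((0, s *: z') = (s *: (0 : V), s *: z')); rewrite scaler0.
    rewrite /linear_part ez.
    rewrite (derive_scale_dir (0, z') s (gcC2.1.1 _ (Uc_graph w0x))).
    rewrite (derive_scale_dir (0, z') s (OC2.1.1 (x, T x) (TUp w0x))).
    by rewrite mulrBr.
  have : s * - linear_part x z' <= s * (s * C).
    apply: (first_order_bound ge0); move: hz.
    by rewrite linZ quadZ dotvZl dotvZr mul1r ler_norml => /andP[].
  by rewrite ler_pM2l// => /le_trans; apply.
move=> w0x; apply/eqP; rewrite eq_le main// andbT -oppr_ge0.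
have -> : - linear_part x z = linear_part x (- z); last exact: main.
have e : ((0 : V), - z) = (-1) *: (0, z).
  by change ((0, - z) = ((-1) *: (0 : V), (-1) *: z)); rewrite scaler0 scaleN1r.
rewrite /linear_part e.
rewrite (derive_scale_dir (0, z) (-1) (gcC2.1.1 _ (Uc_graph w0x))).
rewrite (derive_scale_dir (0, z) (-1) (OC2.1.1 (x, T x) (TUp w0x))).
by rewrite -mulrBr mulN1r.
Qed.

Lemma excess_taylor e : 0 < e ->
  exists2 r : R, 0 < r & forall x z, w0 x -> enorm z <= r ->
    interior (rc_set w1) (T x + z) /\
    `|excess x (T x + z) - 2^-1 * quad (excess_hessian x) z| <= e * dotv z z.
Proof.
move=> e0; have [r r0 h] := taylor_with_linear_part e0.
exists r => // x z w0x zr; have [? +] := h x z w0x zr.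
by rewrite (linear_part0 _ w0x) subr0.
Qed.

(** The growth condition survives in the second-order part of the excess. *)
Lemma excess_hessian_coercive x : w0 x -> coercive gamma (excess_hessian x).
Proof.
move=> w0x v; apply/ler_addgt0Pl => e e0.
pose e' := e / (2 * (dotv v v + 1)).
have n1 : 0 < dotv v v + 1 by rewrite ltr_wpDl ?dotvv_ge0.
have e'0 : 0 < e' by rewrite divr_gt0// mulr_gt0.
have [r r0 h] := excess_taylor e'0.
have n2 : 0 < enorm v + 1 by rewrite ltr_wpDl ?enorm_ge0.
pose s := r / (enorm v + 1); have s0 : 0 < s by rewrite divr_gt0.
have sr : enorm (s *: v) <= r.
  rewrite enormZ (ger0_norm (ltW s0)) mulrAC -mulrA ger_pMr// ler_pdivrMr//.
  by rewrite mul1r lerDl.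
have [iz] := h x (s *: v) w0x sr.
have := growth w0x (interior_subset iz).
rewrite addrAC subrr add0r sqr_enorm quadZ dotvZl dotvZr ler_norml.
have ee : 2 * (e' * dotv v v) <= e.
  have eE : e = 2 * (e' * dotv v v) + 2 * e' by rewrite /e'; field; rewrite gt_eqF.
  by rewrite [leRHS]eE lerDl mulr_ge0// ltW.
by move=> h1 /andP[_ h2]; exact: (second_order_bound s0 h1 h2 ee).
Qed.

Lemma excess_hessian_bounded : exists2 m : R, 0 < m & forall x, w0 x -> mxbounded m (excess_hessian x).
Proof.
have /choice[m_ hm] : forall ij : 'I_d * 'I_d, exists m : R,
    forall x, w0 x -> `|excess_hessian x ij.1 ij.2| <= m.
  by move=> [i j]; have [m hm] := within_continuous_bounded cw0 (@excess_hessian_continuous i j); exists m.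
pose m := \big[Num.max/0]_ij m_ ij.
have m0 : 0 <= m by exact: bigmax_ge_id.
exists ((d ^ 2)%:R * m + 1) => [|x w0x v]; first by rewrite ltr_wpDl// mulr_ge0.
apply: le_trans (entries_mxbounded m0 _ v) _.
  by move=> i j; apply: le_trans (hm (i, j) x w0x) _; exact: le_bigmax.
by rewrite ler_wpM2r ?enorm_ge0// lerDl.
Qed.

End cost_expansion.

(** * Perturbing the excess by a test function *)

Section C1_expansion.
Context {R : realType} {d : nat}.
Local Notation V := 'rV[R]_d.
Variables (w0 : set V) (w1 : regular_compact R d) (T : V -> V) (psi : C1 w1).
Hypotheses (cw0 : compact w0) (cT : {within w0, continuous T})
  (Tint : forall x, w0 x -> interior (rc_set w1) (T x)).

Lemma C1_differentiable y : interior (rc_set w1) y -> differentiable psi y.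
Proof. by have := C1_funP psi; rewrite inE => -[_ _ h _]; exact: h. Qed.

Lemma C1_derive y z : interior (rc_set w1) y -> 'D_z psi y = dotv (grad w1 psi y) z.
Proof.
move=> iy; have := C1_funP psi; rewrite inE => -[_ _ _ [G [cG GE]]].
rewrite (grad_unique cG GE (interior_subset iy)) (GE _ iy).
rewrite {1}(row_sum_delta z) derive_sumZ; last exact: C1_differentiable.
by apply: eq_bigr => i _; rewrite mxE mulrC.
Qed.

Lemma grad_coord_continuous y i : interior (rc_set w1) y ->
  {for y, continuous (fun y => grad w1 psi y 0 i)}.
Proof.
move=> iy; have := coord_within_continuous (i := i) (@grad_within_continuous _ _ w1 psi).
move=> /subspace_continuousP/(_ y (interior_subset iy)).
by rewrite within_interior.
Qed.

Lemma grad_taylor e : 0 < e -> exists2 r : R, 0 < r & forall x z,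
  w0 x -> enorm z <= r -> interior (rc_set w1) (T x + z) /\
    `|psi (T x + z) - psi (T x) - dotv (grad w1 psi (T x)) z| <= e * enorm z.
Proof.
move=> e0; pose e' := e / (d%:R + 1).
have e'0 : 0 < e' by rewrite divr_gt0// ltr_wpDl.
have /choice[r_ hr_] : forall i : 'I_d, exists r : R, 0 < r /\ forall x z,
    w0 x -> enorm z <= r ->
    `|grad w1 psi (T x + z) 0 i - grad w1 psi (T x) 0 i| <= e'.
  move=> i; have [x w0x|r r0 h] := graph_uniform_continuous cw0 cT
      (f := fun p : V * V => grad w1 psi p.2 0 i) e'0.
    apply: (@continuous_comp _ _ _ snd (fun y => grad w1 psi y 0 i)).
      exact: cvg_snd.
    by apply: grad_coord_continuous; exact: Tint.
  by exists r.
have [|r1 r10 hr1] := graph_tube cw0 cT (O := (@snd V V) @^-1` interior (rc_set w1))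
  _ Tint.
  by apply: open_comp; [move=> p _; exact: cvg_snd|exact: open_interior].
pose r := \big[Num.min/r1]_i r_ i; exists r.
  by apply: lt_bigmin => // i _; have [] := hr_ i.
move=> x z w0x zr.
have zs (s : R) : 0 <= s <= 1 -> enorm (s *: z) <= r.
  move=> /andP[s0 s1]; rewrite enormZ ger0_norm//; apply: le_trans zr.
  by rewrite ler_piMl// enorm_ge0.
have Is (s : R) : 0 <= s <= 1 -> interior (rc_set w1) (T x + s *: z).
  move=> s01; apply: (hr1 x (s *: z) w0x); apply: le_trans (zs s s01) _.
  exact: bigmin_le_id.
split; first by have := Is 1; rewrite scale1r; apply; rewrite ler01 lexx.
apply: taylor1 => s s01.
  by apply: diff_derivable; apply: C1_differentiable; exact: Is.
rewrite C1_derive; last exact: Is.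
have -> : dotv (grad w1 psi (T x + s *: z)) z - dotv (grad w1 psi (T x)) z =
    dotv (grad w1 psi (T x + s *: z) - grad w1 psi (T x)) z.
  by rewrite dotvDl -(scaleN1r (grad w1 psi (T x))) dotvZl mulN1r.
apply: le_trans (abs_dotv_le _ _) _; rewrite ler_wpM2r ?enorm_ge0//.
apply: le_trans (enorm_le_sum _) _.
apply: (@le_trans _ _ (\sum_(i < d) e')).
  apply: ler_sum => i _; rewrite !mxE; apply: (hr_ i).2 => //.
  by apply: le_trans (zs s s01) _; exact: bigmin_le_cond.
rewrite sumr_ord_const /e' mulrA ler_pdivrMr ?ltr_wpDl// mulrC ler_pM2l//.
by rewrite lerDl.
Qed.

(** [w1] need not be convex, so the bound comes from the first-order expansion
    near the graph and from boundedness of [psi] away from it. *)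
Lemma C1_lipschitz_graph : exists2 L : R, 0 < L & forall x eta,
  w0 x -> rc_set w1 eta -> `|psi eta - psi (T x)| <= L * enorm (eta - T x).
Proof.
have [r r0 h] := grad_taylor (@ltr01 R).
have C0 : 0 <= C1_norm psi by exact: C1_norm_ge0.
set C := C1_norm psi in C0.
have Cr : 0 <= 2 * C / r by rewrite divr_ge0 ?mulr_ge0// ltW.
exists (C + 1 + 2 * C / r) => [|x eta w0x w1eta].
  by rewrite ltr_pwDl// ltr_wpDl.
have w1T := interior_subset (Tint w0x).
have [pT gT] := C1_norm_ge psi w1T; have [pe _] := C1_norm_ge psi w1eta.
have n0 := enorm_ge0 (eta - T x).
have [zr|zr] := leP (enorm (eta - T x)) r.
  have [_] := h x (eta - T x) w0x zr; rewrite subrKC => h1.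
  have h2 := abs_dotv_le (grad w1 psi (T x)) (eta - T x).
  have h3 : enorm (grad w1 psi (T x)) * enorm (eta - T x) <= C * enorm (eta - T x).
    by rewrite ler_wpM2r.
  have h4 := mulr_ge0 Cr n0.
  have h5 := ler_normD (psi eta - psi (T x) - dotv (grad w1 psi (T x)) (eta - T x))
    (dotv (grad w1 psi (T x)) (eta - T x)).
  rewrite subrK in h5; apply: le_trans h5 _; rewrite !mulrDl; lra.
apply: (@le_trans _ _ (2 * C)).
  by apply: le_trans (ler_normB _ _) _; rewrite mulr_natl mulr2n lerD.
apply: (@le_trans _ _ (2 * C / r * enorm (eta - T x))).
  by rewrite mulrAC -mulrA ler_peMr ?mulr_ge0// ler_pdivlMr// mul1r ltW.
by rewrite ler_wpM2r// lerDr addr_ge0.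
Qed.

End C1_expansion.

Lemma perturbed_combine {R : realType} (E q z2 e M t qi p ps ps0 delta : R) :
  - (e * z2) <= E - 2^-1 * q -> - (2^-1 * (t ^+ 2 * qi)) <= 2^-1 * q - t * p ->
  e * z2 <= e * (M * t) ^+ 2 ->
  t ^+ 2 * (e * (M ^+ 2 + M)) <= t ^+ 2 * delta ->
  t * (ps - ps0 - p) <= t * (e * (M * t)) ->
  - (t ^+ 2 * (2^-1 * qi + delta)) <= E - t * (ps - ps0).
Proof. lra. Qed.

Section perturbed_excess.
Context {R : realType} {d : nat}.
Local Notation V := 'rV[R]_d.
Variables (w0 : set V) (w1 : regular_compact R d) (T : V -> V) (psi : C1 w1).
Variables (E : V -> V -> R) (A : V -> 'M[R]_d) (gamma : R).
Hypotheses (cw0 : compact w0) (cT : {within w0, continuous T})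
  (Tint : forall x, w0 x -> interior (rc_set w1) (T x)) (gamma0 : 0 < gamma)
  (growth : forall x eta, w0 x -> rc_set w1 eta ->
    gamma / 2 * enorm (eta - T x) ^+ 2 <= E x eta)
  (taylorE : forall e, 0 < e -> exists2 r : R, 0 < r & forall x z,
    w0 x -> enorm z <= r -> interior (rc_set w1) (T x + z) /\
    `|E x (T x + z) - 2^-1 * quad (A x) z| <= e * dotv z z)
  (symA : forall x, w0 x -> (A x)^T = A x)
  (coerA : forall x, w0 x -> coercive gamma (A x)).

(** By growth, only displacements of order [t] compete with the perturbation;
    on this scale both terms are given by their expansions, and minimising the
    resulting quadratic in the displacement yields [invmx (A x)]. *)
Lemma perturbed_excess_ge delta : 0 < delta -> exists2 t0 : R, 0 < t0 &
  forall t, 0 < t <= t0 -> forall x eta, w0 x -> rc_set w1 eta ->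
    - (t ^+ 2 * (2^-1 * quad (invmx (A x)) (grad w1 psi (T x)) + delta))
      <= E x eta - t * (psi eta - psi (T x)).
Proof.
move=> delta0; have [L L0 hL] := C1_lipschitz_graph psi cw0 cT Tint.
(* For |eta - T x| > M t the growth of E outweighs the Lipschitz bound. *)
pose M := 2 * L / gamma; have M0 : 0 < M by rewrite divr_gt0// mulr_gt0.
have ML : gamma / 2 * M = L by rewrite /M; field; rewrite gt_eqF.
pose e := delta / (M ^+ 2 + M + 1).
have eM0 : 0 < M ^+ 2 + M + 1 by rewrite ltr_wpDl// addr_ge0 ?sqr_ge0// ltW.
have e0 : 0 < e by rewrite divr_gt0.
have eM : e * (M ^+ 2 + M) <= delta.
  have -> : delta = e * (M ^+ 2 + M) + e by rewrite /e; field; rewrite gt_eqF.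
  by rewrite lerDl ltW.
have [r1 r10 h1] := taylorE e0; have [r2 r20 h2] := grad_taylor psi cw0 cT Tint e0.
pose r := Num.min r1 r2; have r0 : 0 < r by rewrite lt_min r10.
have M10 : 0 < M + 1 by rewrite ltr_wpDl// ltW.
exists (r / (M + 1)); first by rewrite divr_gt0.
move=> t /andP[t0 tr] x eta w0x w1eta.
have Mtr : M * t <= r.
  rewrite ler_pdivlMr// in tr; apply: le_trans tr.
  by rewrite mulrC ler_pM2l// lerDl.
have uA := coercive_unitmx gamma0 (coerA w0x).
have A0 v : 0 <= quad (A x) v by exact: coercive_quad_ge0 (ltW gamma0) (coerA w0x).
have q0 : 0 <= quad (invmx (A x)) (grad w1 psi (T x)).
  by rewrite quad_invmx ?symA.
have n0 := enorm_ge0 (eta - T x).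
have [zt|zt] := leP (enorm (eta - T x)) (M * t); last first.
  apply: (@le_trans _ _ 0).
    rewrite oppr_le0 mulr_ge0 ?sqr_ge0// addr_ge0 ?(ltW delta0)//.
    by rewrite mulr_ge0.
  have h3 := growth w0x w1eta; have h4 := hL x eta w0x w1eta.
  have h5 : t * (psi eta - psi (T x)) <= t * (L * enorm (eta - T x)).
    by rewrite ler_pM2l//; apply: le_trans (ler_norm _) h4.
  rewrite subr_ge0; apply: le_trans h5 _; apply: le_trans h3.
  have h6 : t * L <= gamma / 2 * enorm (eta - T x).
    rewrite -ML mulrCA (mulrC t) ler_wpM2l//; first by rewrite divr_ge0// ltW.
    exact: ltW.
  by rewrite expr2 !mulrA ler_wpM2r.
have := le_trans zt Mtr; rewrite le_min => /andP[z1 z2].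
have [_] := h1 x (eta - T x) w0x z1; have [_] := h2 x (eta - T x) w0x z2.
rewrite subrKC; set z := eta - T x in zt n0 *; set p := grad w1 psi (T x) in q0 *.
rewrite !ler_norml => /andP[_ h3] /andP[h4 _].
have := quad_dual (t *: p) z (symA w0x) uA A0; rewrite quadZ dotvZl => h5.
have zz : dotv z z <= (M * t) ^+ 2.
  by rewrite -sqr_enorm ler_pXn2r// ?nnegrE// mulr_ge0 ?(ltW t0) ?(ltW M0).
have h6 : e * dotv z z <= e * (M * t) ^+ 2 by rewrite ler_pM2l.
have h7 : e * enorm z <= e * (M * t) by rewrite ler_pM2l.
have h8 : t ^+ 2 * (e * (M ^+ 2 + M)) <= t ^+ 2 * delta.
  by rewrite ler_pM2l// exprn_gt0.
have h9 : t * (psi eta - psi (T x) - dotv p z) <= t * (e * (M * t)).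
  by rewrite ler_pM2l//; exact: le_trans h3 h7.
exact: (perturbed_combine h4 h5 h6 h8 h9).
Qed.

End perturbed_excess.

(** * Borel measures and charges on finite-dimensional spaces *)

Section borel_measurability.
Context {R : realType}.

Lemma open_borel (V : normedModType R) (U : set V) : open U ->
  measurable (U : set (borel V)).
Proof. exact: sub_sigma_algebra. Qed.

Lemma continuous_borel (V W : normedModType R) (f : V -> W) : continuous f ->
  measurable_fun setT (f : borel V -> borel W).
Proof.
move=> cf; apply: (@measurability _ _ (borel V) (borel W) setT f (@open W)) => // _ [U oU <-].
by rewrite setTI; apply: open_borel; apply: open_comp => // x _; exact: cf.
Qed.

Lemma continuous_borel_real (V : normedModType R) (f : V -> R) : continuous f ->
  measurable_fun setT (f : borel V -> R).
Proof.
move=> cf; apply: (measurability _ (RGenOpens.measurableE R)).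
move=> _ [_ [a [b ->] <-]]; rewrite setTI; apply: open_borel.
by apply: open_comp; [move=> x _; exact: cf|exact: interval_open].
Qed.

Context {d : nat}.
Local Notation V := 'rV[R]_d.

Lemma rational_approx (x : V) (e : R) : 0 < e ->
  exists q : 'rV[rat]_d, ball (map_mx ratr q : V) e x.
Proof.
move=> e0; have /choice[q hq] : forall i, exists q : rat, `|ratr q - x 0 i| < e.
  move=> i; have : x 0 i - e < x 0 i + e by rewrite ltrBlDr -addrA ltrDl addr_gt0.
  move=> /rat_in_itvoo[q]; rewrite in_itv/= => /andP[h1 h2]; exists q.
  by rewrite ltr_distl h1.
exists (\row_i q i); split => // i j; rewrite !mxE ord1.
by rewrite /ball/=; exact: hq.
Qed.

(** Open sets of ['rV[R]_d] are countable unions of rational boxes, so that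
    measurability can be checked coordinatewise. *)
Lemma measurable_rV {dd : measure_display} {X : measurableType dd} (f : X -> V) :
  (forall i, measurable_fun setT (fun x => f x 0 i)) ->
  measurable_fun setT (f : X -> borel V).
Proof.
move=> mf; apply: (@measurability _ _ X (borel V) setT f (@open V)) => // _ [U oU <-]; rewrite setTI.
pose B (qn : 'rV[rat]_d * nat) : set V := ball (map_mx ratr qn.1 : V) (qn.2.+1%:R^-1).
have UE : U = \bigcup_qn (if `[< B qn `<=` U >] then B qn else set0).
  apply/seteqP; split => [x Ux|x [qn _]]; last first.
    by case: ifPn => // /asboolP h; exact: h.
  have : nbhs x U by exact: open_nbhs_nbhs.
  move=> /nbhs_ballP[e /= e0 he].
  have [n hn] : exists n : nat, n.+1%:R^-1 < e / 2.
    have e2 : 0 < e / 2 by rewrite divr_gt0.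
    by have [n _ /(_ n (leqnn n)) h] := near_infty_natSinv_lt (PosNum e2); exists n.
  have n0 : 0 < (n.+1%:R^-1 : R) by rewrite invr_gt0.
  have [q hq] := rational_approx x n0.
  exists (q, n) => //; case: ifPn => // /asboolP[]; move=> y hy; apply: he.
  rewrite [e]splitr; apply: (ball_triangle (y := map_mx ratr q : V)).
    by apply: ball_sym; apply: le_ball hq; exact: ltW.
  by apply: le_ball hy; exact: ltW.
rewrite UE preimage_bigcup; apply: countable_bigcupT_measurable; first exact: countableP.
move=> qn.
case: ifPn => _; last by rewrite preimage_set0.
have -> : f @^-1` B qn = \bigcap_(i in [set: 'I_d])
    ((fun x => f x 0 i) @^-1` ball (ratr (qn.1 0 i) : R) qn.2.+1%:R^-1).
  apply/seteqP; split => x /=.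
    by move=> [_ h] i _ /=; have := h 0 i; rewrite mxE.
  move=> h; split; first by rewrite invr_gt0.
  by move=> i j; rewrite mxE ord1; exact: (h j I).
apply: fin_bigcap_measurable => // i _; rewrite -[X in measurable X]setTI.
by apply: mf => //; apply: measurable_ball.
Qed.

End borel_measurability.

Section pair_measurability.
Context {R : realType} {d : nat}.
Local Notation V := 'rV[R]_d.

(** Measurability into the Borel sets of the product is checked coordinatewise
    through the homeomorphism with the row vectors of length [d + d]. *)
Lemma measurable_pair_rV {dd : measure_display} {X : measurableType dd} (f g : X -> V) :
  measurable_fun setT (f : X -> borel V) -> measurable_fun setT (g : X -> borel V) ->
  measurable_fun setT ((fun x => (f x, g x)) : X -> borel (V * V)%type).
Proof.
move=> mf mg.
have coord (h : X -> V) i : measurable_fun setT (h : X -> borel V) ->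
    measurable_fun setT (fun x => h x 0 i).
  move=> mh; apply: (measurableT_comp (f := fun v : borel V => (v : V) 0 i)) mh.
  by apply: continuous_borel_real; exact: coord_continuous.
pose F x : 'rV[R]_(d + d) := row_mx (f x) (g x).
pose G (w : 'rV[R]_(d + d)) : V * V := (lsubmx w, rsubmx w).
have -> : (fun x => (f x, g x)) = G \o F.
  by apply/funext => x /=; rewrite /G row_mxKl row_mxKr.
apply: (measurableT_comp (f := G : borel 'rV[R]_(d + d) -> borel (V * V)%type)).
  have cl : continuous (fun w : 'rV[R]_(d + d) => lsubmx w : V).
    move=> w A /nbhs_ballP[e /= e0 hA]; apply/nbhs_ballP; exists e => //= w' [_ h].
    by apply: hA; split => // i j; rewrite !mxE; exact: h.
  have cr : continuous (fun w : 'rV[R]_(d + d) => rsubmx w : V).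
    move=> w A /nbhs_ballP[e /= e0 hA]; apply/nbhs_ballP; exists e => //= w' [_ h].
    by apply: hA; split => // i j; rewrite !mxE; exact: h.
  apply: continuous_borel => w P [[A B] /= [nA nB] AB].
  have nA' : nbhs w [set w' | A (lsubmx w')] by exact: cl.
  have nB' : nbhs w [set w' | B (rsubmx w')] by exact: cr.
  by apply: filterS (filterI nA' nB') => w' [Aw Bw]; exact: (AB (_, _)).
apply: measurable_rV => i; rewrite /F.
rewrite (_ : (fun x => _) = match fintype.split i with
    | inl j => fun x => f x 0 j | inr j => fun x => g x 0 j end).
  by case: (fintype.split i) => j; exact: coord.
by apply/funext => x; rewrite mxE; case: (fintype.split i).
Qed.

End pair_measurability.

Section concentrated_measures.
Context {R : realType} {V : normedModType R}.
Implicit Types (mu : {finite_measure set (borel V) -> \bar R}) (K : set V).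

Lemma concentrated_measureC mu K : measurable (K : set (borel V)) ->
  concentrated_on K mu -> mu (~` (K : set (borel V))) = 0%E.
Proof. by move=> mK h; apply: h; [exact: measurableC|rewrite setICl]. Qed.

Lemma concentrated_measureI mu K (A : set (borel V)) :
  measurable (K : set (borel V)) -> concentrated_on K mu -> measurable A ->
  mu A = mu (A `&` K).
Proof.
move=> mK h mA; rewrite -[in LHS](setIT A) -(setUv (K : set (borel V))) setIUr.
rewrite measureU//.
- rewrite [X in (_ + X)%E](_ : _ = 0%E) ?adde0//.
  apply: h; first by apply: measurableI => //; exact: measurableC.
  by rewrite -setIA setICl setI0.
- exact: measurableI.
- by apply: measurableI => //; exact: measurableC.
- by rewrite setIACA setICr setI0.
Qed.

Lemma concentrated_integralT mu K (f : borel V -> \bar R) :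
  measurable (K : set (borel V)) -> concentrated_on K mu ->
  measurable_fun setT f ->
  (\int[mu]_x f x = \int[mu]_(x in K) f x)%E.
Proof.
move=> mK h mf; rewrite -(setUv (K : set (borel V))) integral_setU//.
- rewrite [X in (_ + X)%E]null_set_integral ?adde0//.
  + exact: measurableC.
  + exact: measurable_funTS.
  + exact: concentrated_measureC.
- exact: measurableC.
- exact: measurable_funTS.
- exact/disj_setPCl.
Qed.

End concentrated_measures.

Section charge_integrals.
Context {R : realType} {V : normedModType R}.
Variables (mu : {finite_measure set (borel V) -> \bar R}).

Lemma density_charge_dominates (nu : set (borel V) -> \bar R) (g : borel V -> R) :
  mu.-integrable setT (EFin \o g) ->
  (forall A, measurable A -> nu A = \int[mu]_(x in A) (g x)%:E)%E -> nu `<< mu.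
Proof.
move=> ig nuE A A0 B mB BA; rewrite nuE//; apply: null_set_integral => //.
- by apply: measurable_funTS; exact: measurable_int ig.
- exact: A0.
Qed.

(** Any density agrees almost everywhere with the Radon-Nikodym derivative, for
    which the change of variables holds. *)
Lemma Rintegral_density (nu : {finite_measure set (borel V) -> \bar R})
    (g : borel V -> R) (E : set (borel V)) (f : borel V -> R) :
  mu.-integrable setT (EFin \o g) ->
  (forall A, measurable A -> nu A = \int[mu]_(x in A) (g x)%:E)%E ->
  measurable E -> nu.-integrable E (EFin \o f) ->
  \int[nu]_(x in E) f x = \int[mu]_(x in E) (f x * g x).
Proof.
move=> ig nuE mE intf.
have dom : nu `<< mu by exact: density_charge_dominates ig nuE.
rewrite /Rintegral -(Radon_Nikodym_change_of_variables dom mE intf).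
congr fine; apply: ae_eq_integral => //.
- apply: emeasurable_funM; first exact: measurable_int intf.
  by apply: measurable_funTS; apply: measurable_int; exact: Radon_Nikodym_integrable.
- apply/measurable_EFinP; apply: measurable_funM.
    by apply/measurable_EFinP; exact: measurable_int intf.
  by apply/measurable_EFinP; apply: measurable_funTS; exact: measurable_int ig.
- have : ae_eq mu E (Radon_Nikodym (charge_of_finite_measure nu) mu) (EFin \o g).
    apply: integral_ae_eq => //.
    + apply: (integrableS measurableT) => //.
      by apply: Radon_Nikodym_integrable.
    + by apply: measurable_funTS; exact: measurable_int ig.
    + by move=> A AE mA; rewrite -Radon_Nikodym_integral//; exact: nuE.
  by apply: filterS => x h Ex; rewrite h.
Qed.

(** The Hahn decomposition of [nu] splits the density [g] into the densities of
    the positive and of the negative part of [nu]. *)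
Lemma charge_integral_density (nu : {charge set (borel V) -> \bar R})
    (g : borel V -> R) (K : set V) (f : V -> R) :
  compact K -> {within K, continuous f} -> mu.-integrable setT (EFin \o g) ->
  (forall A, measurable A -> nu A = \int[mu]_(x in A) (g x)%:E)%E ->
  charge_integral nu K f = \int[mu]_(x in K) (f x * g x).
Proof.
move=> cK cf ig nuE; have mK := compact_borel cK.
set P := hahn_pos nu; set N := hahn_neg nu.
have [[mP _] [mN _] PN PN0] := hahn_pos_neg nu.
rewrite -/P -/N in mP mN PN PN0.
have igP (Q : set (borel V)) : measurable Q ->
    mu.-integrable setT (EFin \o (fun x => g x * \1_Q x)).
  move=> mQ; apply: (le_integrable measurableT _ _ ig).
    apply/measurable_EFinP; apply: measurable_funM.
      by apply/measurable_EFinP; exact: measurable_int ig.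
    exact: measurable_indic.
  move=> x _ /=; rewrite lee_fin normrM ler_piMr// indicE.
  by case: (x \in Q); rewrite ?normr1 ?normr0.
have mf := within_continuous_measurable cK cf.
have [C hC] := within_continuous_bounded cK cf.
have fg (Q : set (borel V)) : measurable Q ->
    mu.-integrable K (EFin \o (fun x => f x * (g x * \1_Q x))).
  move=> mQ; have iQ : mu.-integrable K (EFin \o (fun x => g x * \1_Q x)).
    exact: (integrableS measurableT _ _ (igP Q mQ)).
  apply: (le_integrable mK _ _ (integrableZl mK C iQ)).
    apply/measurable_EFinP; apply: measurable_funM => //.
    by apply/measurable_EFinP; exact: measurable_int iQ.
  move=> x Kx /=; rewrite lee_fin !normrM ler_wpM2r//.
  by apply: le_trans (hC x Kx) _; exact: ler_norm.
have setE (Q A : set (borel V)) : measurable Q -> measurable A ->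
    (\int[mu]_(x in A `&` Q) (g x)%:E = \int[mu]_(x in A) (g x * \1_Q x)%:E)%E.
  move=> mQ mA; rewrite integral_mkcondr; apply: eq_integral => x _.
  by rewrite patchE indicE; case: (x \in Q); rewrite ?mulr1 ?mulr0.
rewrite /charge_integral.
rewrite (@Rintegral_density (jordan_pos (hahn_pos_neg nu)) (fun x => g x * \1_P x))//; first last.
- exact: within_continuous_integrable.
- move=> A mA; rewrite -[LHS]/(crestr0 nu mP A) /crestr0 mem_set//.
  by rewrite /crestr nuE ?setE//; exact: measurableI.
- exact: igP.
rewrite (@Rintegral_density (jordan_neg (hahn_pos_neg nu)) (fun x => - (g x * \1_N x)))//; first last.
- exact: within_continuous_integrable.
- move=> A mA; rewrite -[LHS]/(cscale (-1) (crestr0 nu mN) A) cscaleN1.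
  rewrite -[LHS]/(- crestr0 nu mN A)%E /crestr0 mem_set//.
  rewrite /crestr nuE ?setE//; last exact: measurableI.
  rewrite -integralN; last first.
    apply: integrable_add_def => //; apply: (integrableS measurableT mA) => //.
    exact: (igP N mN).
  by apply: eq_integral.
- have := integrableN (igP N mN).
  by congr (mu.-integrable _ _); apply/funext => x.
have -> : \int[mu]_(x in K) (f x * - (g x * \1_N x)) =
          - \int[mu]_(x in K) (f x * (g x * \1_N x)).
  transitivity (\int[mu]_(x in K) ((-1) * (f x * (g x * \1_N x)))).
    by apply: eq_Rintegral => x _; rewrite mulN1r mulrN.
  by rewrite RintegralZl ?mulN1r//; exact: fg.
rewrite opprK -RintegralD; [|exact: mK|exact: fg|exact: fg].
apply: eq_Rintegral => x _; rewrite -mulrDr -mulrDr; congr (_ * _).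
rewrite !indicE -[RHS]mulr1; congr (_ * _).
have [xP|xP] := boolP (x \in P).
  have -> : (x \in N) = false; last by rewrite addr0.
  apply/negbTE; rewrite notin_setE => xN.
  have : (P `&` N) x by split => //; exact: set_mem xP.
  by rewrite PN0.
have -> : (x \in N) = true; last by rewrite add0r.
apply/mem_set; have : (P `|` N) x by rewrite PN.
by case=> // Px; move: xP; rewrite mem_set.
Qed.

End charge_integrals.

Section image_measure.
Context {dx dy : measure_display} {X : measurableType dx} {Y : measurableType dy}
  {R : realType}.
Variables (mu : {finite_measure set X -> \bar R}) (f : X -> Y).
Hypothesis mf : measurable_fun setT f.

(** [pushforward] bundled with the measurability proof, so that the structure
    of finite measure can be attached to it. *)
Definition image_measure of measurable_fun setT f := pushforward mu f.

Local Notation nu := (image_measure mf).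

Let pf : {measure set Y -> \bar R} :=
  measure_function_pushforward__canonical__measure_function_Measure mu mf.

Let nu0 : nu set0 = 0%E. Proof. exact: (measure0 pf). Qed.

Let nu_ge0 A : (0 <= nu A)%E. Proof. exact: (measure_ge0 pf). Qed.

Let nu_sigma_additive : semi_sigma_additive nu.
Proof. exact: (@measure_semi_sigma_additive _ _ _ pf). Qed.

HB.instance Definition _ := isMeasure.Build _ _ _ nu
  nu0 nu_ge0 nu_sigma_additive.

Let nu_fin : fin_num_fun nu.
Proof.
move=> A mA; rewrite /image_measure /pushforward fin_num_measure//.
by rewrite -[X in measurable X]setTI; exact: mf.
Qed.

HB.instance Definition _ := @Measure_isFinite.Build _ _ _ nu nu_fin.

Lemma integral_image (g : Y -> \bar R) : measurable_fun setT g ->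
  mu.-integrable setT (g \o f) ->
  (\int[nu]_y g y = \int[mu]_x g (f x))%E.
Proof. by move=> mg ig; rewrite integral_pushforward. Qed.

End image_measure.

(** * Test functions, dual feasibility and transport along maps *)

Section C1_integrals.
Context {R : realType} {d : nat} (w1 : regular_compact R d).
Local Notation V := 'rV[R]_d.

Lemma measurable_C1 (chi : C1 w1) : measurable_fun setT (chi : borel V -> R).
Proof.
have mK := compact_borel (@rc_compact _ _ w1).
have -> : (chi : borel V -> R) = (chi : borel V -> R) \_ (rc_set w1 : set (borel V)).
  apply/funext => x; rewrite patchE; case: ifPn => // /negP xK.
  have := C1_funP chi; rewrite inE => -[+ _ _ _]; apply.
  by move=> Kx; apply: xK; exact: mem_set.
apply/(measurable_restrictT _ mK); apply: within_continuous_measurable.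
  exact: rc_compact.
exact: C1_within_continuous.
Qed.

Lemma C1_norm_bound (chi : C1 w1) x : `|chi x| <= C1_norm chi.
Proof.
have [Kx|nKx] := pselect (rc_set w1 x); first by have [] := C1_norm_ge chi Kx.
have := C1_funP chi; rewrite inE => -[-> // _ _ _].
by rewrite normr0 C1_norm_ge0.
Qed.

Lemma bounded_integrable {dx : measure_display} {X : measurableType dx}
    (mu : {finite_measure set X -> \bar R}) (f : X -> R) (C : R) (D : set X) :
  measurable D -> measurable_fun D f -> (forall x, D x -> `|f x| <= C) ->
  mu.-integrable D (EFin \o f).
Proof.
move=> mD mf fC; apply: measurable_bounded_integrable => //.
  by rewrite ltey_eq fin_num_measure.
exists C; split; first exact: num_real.
by move=> e Ce x Dx /=; exact: le_trans (fC x Dx) (ltW Ce).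
Qed.

Lemma C1_comp_integrable {dx : measure_display} {X : measurableType dx}
    (mu : {finite_measure set X -> \bar R}) (s : X -> V) (chi : C1 w1) :
  measurable_fun setT (s : X -> borel V) ->
  mu.-integrable setT (EFin \o (fun x => chi (s x))).
Proof.
move=> ms; apply: (@bounded_integrable _ _ _ _ (C1_norm chi)) => //.
  exact: (measurableT_comp (measurable_C1 chi) ms).
by move=> x _; exact: C1_norm_bound.
Qed.

(** A charge that is a measure has density 1 with respect to that measure. *)
Lemma charge_integral_measure (K : set V) (u : {charge set (borel V) -> \bar R})
    (m : {finite_measure set (borel V) -> \bar R}) (f : V -> R) :
  compact K -> {within K, continuous f} ->
  (forall A, measurable A -> u A = m A) ->
  charge_integral u K f = \int[m]_(x in K) f x.
Proof.
move=> cK cf um.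
rewrite (@charge_integral_density _ _ m u (fun=> 1))//.
- by apply: eq_Rintegral => x _; rewrite mulr1.
- by apply: (@bounded_integrable _ _ _ _ 1) => // x _; rewrite normr1.
- by move=> A mA; rewrite integral_cst// mul1e um.
Qed.

Lemma charge_integral_image {dx : measure_display} {X : measurableType dx}
    (mu : {finite_measure set X -> \bar R}) (s : X -> V) (u : M w1) (chi : C1 w1) :
  measurable_fun setT (s : X -> borel V) ->
  (forall A : set (borel V), measurable A -> u A = mu (s @^-1` A)) ->
  charge_integral u w1 chi = \int[mu]_x chi (s x).
Proof.
move=> ms us; pose m := image_measure mu ms.
have mK := compact_borel (@rc_compact _ _ w1).
have mchi := measurable_C1 chi.
rewrite (@charge_integral_measure _ _ m)//; last 2 first.
- exact: rc_compact.
- exact: C1_within_continuous.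
congr fine; rewrite -(concentrated_integralT mK)//.
- by rewrite integral_image//; [exact/measurable_EFinP|exact: C1_comp_integrable].
- move=> A mA AK; have := M_on u mA AK.
  by rewrite us.
- exact/measurable_EFinP.
Qed.

Lemma charge_integral0 (f : V -> R) : {within w1, continuous f} ->
  charge_integral (M0 w1) w1 f = 0.
Proof.
move=> cf; have c0 : compact (rc_set w1) by exact: rc_compact.
rewrite (@charge_integral_measure _ (M0 w1) mzero)//.
by rewrite /Rintegral integral_measure_zero.
Qed.

Lemma PiE (u : M w1) (chi : C1 w1) : Pi u chi = charge_integral u w1 chi.
Proof.
rewrite /= /bracket_fun big1 ?addr0// => i _; apply: charge_integral0.
exact/coord_within_continuous/grad_within_continuous.
Qed.

Lemma bracket0E (nu : 'I_d -> M w1) (chi : C1 w1) :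
  bracket (M0 w1) nu chi =
  \sum_i charge_integral (nu i) w1 (fun x => grad w1 chi x 0 i).
Proof.
rewrite /= /bracket_fun charge_integral0 ?add0r//; exact: C1_within_continuous.
Qed.

End C1_integrals.

Section transport_duality.
Context {R : realType} {d : nat}.
Local Notation V := 'rV[R]_d.
Variables (w0 : set V) (w1 : regular_compact R d) (c : V -> V -> R) (u0 : Mpos w0).
Hypotheses (cw0 : compact w0)
  (cc : {within w0 `*` w1, continuous (fun z => c z.1 z.2)}).

Let cw : compact (w0 `*` w1).
Proof. by apply: compact_setX => //; exact: rc_compact. Qed.

(** [(a, chi)] is feasible for the dual problem. Where no coupling exists the
    right-hand side is infinite. *)
Lemma weak_duality (chi : C1 w1) (a : V -> R) (C : R) (g : C1dual w1) :
  measurable_fun setT (a : borel V -> R) -> (forall x, `|a x| <= C) ->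
  (forall x eta, w0 x -> rc_set w1 eta -> chi eta + a x <= c x eta) ->
  ((g chi + \int[u0]_x a x)%:E <= ot_dual c u0 g)%E.
Proof.
move=> ma aC ac; apply: le_ereal_inf_tmp => _ [u ug <-].
apply: le_ereal_inf_tmp => _ [pi [pi1 pi2] <-].
have mw := compact_borel cw.
have mfst : measurable_fun setT (fst : borel (V * V)%type -> borel V).
  by apply: continuous_borel => p; exact: cvg_fst.
have msnd : measurable_fun setT (snd : borel (V * V)%type -> borel V).
  by apply: continuous_borel => p; exact: cvg_snd.
have -> : g chi = \int[pi]_z chi z.2.
  by rewrite -ug PiE; apply: charge_integral_image => // A mA; rewrite -pi2.
have ia : pi.-integrable setT (EFin \o (fun z => a z.1)).
  apply: (@bounded_integrable _ _ _ _ _ C) => //.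
  exact: (measurableT_comp ma mfst).
have -> : \int[u0]_x a x = \int[pi]_z a z.1.
  congr fine; rewrite -(@integral_image _ _ _ _ _ pi _ mfst (EFin \o a))//.
    by apply: eq_measure_integral => A mA _; exact: (esym (pi1 A mA)).
  exact/measurable_EFinP.
have ichi := C1_comp_integrable pi chi msnd.
have isum : pi.-integrable setT (EFin \o (fun z => chi z.2 + a z.1)).
  apply: (@bounded_integrable _ _ _ _ _ (C1_norm chi + C)) => //.
    apply: measurable_funD; last exact: (measurableT_comp ma mfst).
    exact: (measurableT_comp (measurable_C1 chi) msnd).
  by move=> z _; apply: le_trans (ler_normD _ _) _; rewrite lerD// C1_norm_bound.
rewrite -RintegralD// /Rintegral fineK; last exact: integrable_fin_num isum.
rewrite (concentrated_integralT mw (Mpos_on pi)); last exact: measurable_int isum.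
apply: le_integral => //.
- by apply: (integrableS measurableT) => //; exact: isum.
- exact: within_continuous_integrable.
- by move=> z /set_mem[z1 z2]; rewrite lee_fin; exact: ac.
Qed.

Section transport_map.
Variable S : V -> V.
Hypotheses (mS : measurable_fun setT (S : borel V -> borel V))
  (Sw : forall x, w0 x -> rc_set w1 (S x)).

Let image_on : concentrated_on w1 (image_measure u0 mS).
Proof.
move=> A mA AK; apply: Mpos_on.
  by rewrite -[X in measurable X]setTI; exact: mS.
apply/seteqP; split => x // [/= Ax w0x].
have : (A `&` w1) (S x) by split => //; exact: Sw.
by rewrite AK.
Qed.

Definition image_M : M w1 := M_of_Mpos (MkMpos image_on).

Lemma Pi_image chi : Pi image_M chi = \int[u0]_x chi (S x).
Proof. by rewrite PiE; exact: charge_integral_image. Qed.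

(** The coupling carried by the graph of [S] is admissible. *)
Lemma ot_dual_image :
  (ot_dual c u0 (Pi image_M) <= \int[u0]_(x in w0) (c x (S x))%:E)%E.
Proof.
have mp : measurable_fun setT ((fun x => (x, S x)) : borel V -> borel (V * V)%type).
  by apply: measurable_pair_rV.
have on : concentrated_on (w0 `*` w1) (image_measure u0 mp).
  move=> A mA AK; apply: Mpos_on.
    by rewrite -[X in measurable X]setTI; exact: mp.
  apply/seteqP; split => x // [/= Ax w0x].
  have : (A `&` (w0 `*` w1)) (x, S x) by split => //; split => //=; exact: Sw.
  by rewrite AK.
pose pi := MkMpos on.
apply: ge_ereal_inf; exists (ot_cost c u0 image_M).
  by exists image_M.
apply: ge_ereal_inf; exists (\int[pi]_(z in w0 `*` w1) (c z.1 z.2)%:E)%E.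
  by exists pi.
have mw := compact_borel cw.
pose G : V * V -> \bar R := (EFin \o (fun z => c z.1 z.2)) \_ (w0 `*` w1).
have mG : measurable_fun setT (G : borel (V * V)%type -> \bar R).
  apply/(measurable_restrictT _ mw); apply/measurable_EFinP.
  exact: within_continuous_measurable.
have [C hC] := within_continuous_bounded cw cc.
have GC z : (`|G z| <= (Num.max C 0)%:E)%E.
  rewrite /G patchE; case: ifPn => [/set_mem zw|_].
    by rewrite /= lee_fin le_max hC.
  by rewrite abse0 lee_fin le_max lexx orbT.
have iG : u0.-integrable setT (G \o (fun x => (x, S x))).
  have ic : u0.-integrable setT (EFin \o (fun _ : borel V => Num.max C 0)).
    by apply: (@bounded_integrable _ _ _ _ _ `|Num.max C 0|).
  apply: le_integrable ic => //; first exact: (measurableT_comp mG mp).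
  move=> x _; apply: le_trans (GC _) _; rewrite /= lee_fin; exact: ler_norm.
have -> : (\int[pi]_(z in w0 `*` w1) (c z.1 z.2)%:E = \int[pi]_z G z)%E.
  by rewrite integral_mkcond.
rewrite [leLHS](@integral_image _ _ _ _ _ u0 _ mp G mG iG).
rewrite (concentrated_integralT (compact_borel cw0) (Mpos_on u0)); last first.
  exact: (measurableT_comp mG mp).
rewrite le_eqVlt; apply/orP; left; apply/eqP; apply: eq_integral => x /set_mem w0x.
by rewrite /G patchE mem_set//; split => //=; exact: Sw.
Qed.

End transport_map.

End transport_duality.

(** * Disintegration and fibre means *)

Local Notation ae_filterS mu := (@filterS _ _ (ae_filter_ringOfSetsType mu)).

Lemma quad_entries {R : realType} {d : nat} (M : 'M[R]_d) (v : 'rV[R]_d) :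
  quad M v = \sum_i \sum_j v 0 i * v 0 j * M i j.
Proof.
rewrite quadE /dotv exchange_big/=; apply: eq_bigr => j _.
by rewrite mxE mulr_suml; apply: eq_bigr => i _; ring.
Qed.

Lemma measurable_dotv {R : realType} {d : nat} {dx : measure_display}
    {X : measurableType dx} (D : set X) (u v : X -> 'rV[R]_d) :
  (forall i, measurable_fun D (fun x => u x 0 i)) ->
  (forall i, measurable_fun D (fun x => v x 0 i)) ->
  measurable_fun D (fun x => dotv (u x) (v x)).
Proof.
move=> mu mv; apply: measurable_sum => i; exact: measurable_funM.
Qed.

Lemma measurable_mulmx {R : realType} {d : nat} {dx : measure_display}
    {X : measurableType dx} (D : set X) (u : X -> 'rV[R]_d) (M : X -> 'M[R]_d) j :
  (forall i, measurable_fun D (fun x => u x 0 i)) ->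
  (forall i j, measurable_fun D (fun x => M x i j)) ->
  measurable_fun D (fun x => (u x *m M x) 0 j).
Proof.
move=> mu mM.
have -> : (fun x => (u x *m M x) 0 j) = (fun x => \sum_i u x 0 i * M x i j).
  by apply/funext => x; rewrite mxE.
by apply: measurable_sum => i; exact: measurable_funM.
Qed.

Lemma measurable_quad {R : realType} {d : nat} {dx : measure_display}
    {X : measurableType dx} (D : set X) (M : X -> 'M[R]_d) (v : X -> 'rV[R]_d) :
  (forall i j, measurable_fun D (fun x => M x i j)) ->
  (forall i, measurable_fun D (fun x => v x 0 i)) ->
  measurable_fun D (fun x => quad (M x) (v x)).
Proof.
move=> mM mv; rewrite (_ : (fun x => _) = (fun x => dotv (v x *m M x) (v x))).
  by apply: measurable_dotv => // j; exact: measurable_mulmx.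
by apply/funext => x; exact: quadE.
Qed.

Lemma Rintegral_sum {R : realType} {dx : measure_display} {X : measurableType dx}
    (mu : {measure set X -> \bar R}) (D : set X) (I : finType) (f : I -> X -> R) :
  measurable D -> (forall i, mu.-integrable D (EFin \o f i)) ->
  \int[mu]_(x in D) (\sum_i f i x) = \sum_i \int[mu]_(x in D) f i x.
Proof.
move=> mD fi; rewrite /Rintegral.
under eq_integral do rewrite -sumEFin.
rewrite (@integral_sum _ _ _ _ _ mD _ (fun i x => (f i x)%:E))//.
by rewrite -sum_fine// => i _; exact: integrable_fin_num (fi i).
Qed.

Lemma coord_within_continuous_set {R : realType} {U : normedModType R} {d : nat}
    (K : set U) (G : U -> 'rV[R]_d) i :
  {within K, continuous G} -> {within K, continuous (fun x => G x 0 i)}.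
Proof.
move=> cG x; apply: (@continuous_comp _ _ _ (G : subspace K -> 'rV[R]_d)
  (fun v : 'rV[R]_d => v 0 i)); first exact: cG.
exact: coord_continuous.
Qed.

Section disintegrated_matrix.
Context {R : realType} {d : nat}.
Local Notation V := 'rV[R]_d.
Variables (w0 : set V) (w1 : regular_compact R d) (u0 : Mpos w0) (ubar : Mpos w1).
Variables (T : V -> V) (uhat : R.-pker (borel V) ~> (borel V)).
Hypotheses (cw0 : compact w0) (cT : {within w0, continuous T})
  (dis : is_disintegration u0 ubar T uhat).

Let mw0 := compact_borel cw0.
Let mw1 := compact_borel (@rc_compact _ _ w1).

(** [T] is only known to be continuous on [w0]; cut off outside, it is a Borel
    map of the whole space. *)
Definition Tmod (x : V) : V := if x \in w0 then T x else 0.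

Lemma TmodE x : w0 x -> Tmod x = T x.
Proof. by move=> w0x; rewrite /Tmod mem_set. Qed.

Lemma measurable_Tmod : measurable_fun setT (Tmod : borel V -> borel V).
Proof.
apply: measurable_rV => i.
have -> : (fun x : borel V => Tmod x 0 i) =
    (fun x : borel V => T x 0 i) \_ (w0 : set (borel V)).
  by apply/funext => x; rewrite patchE /Tmod; case: ifP => // _; rewrite mxE.
apply/(measurable_restrictT _ mw0); apply: within_continuous_measurable => //.
exact: coord_within_continuous_set.
Qed.

Let fib := fiber w0 T.

Let graph_measurable :
  measurable ([set p | w0 p.2 /\ T p.2 = p.1] : set (borel V * borel V)).
Proof.
have -> : [set p : borel V * borel V | w0 p.2 /\ T p.2 = p.1] =
    (snd @^-1` (w0 : set (borel V))) `&`
    \bigcap_(i in [set: 'I_d])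
      ((fun p : borel V * borel V => (p.1 : V) 0 i - Tmod p.2 0 i) @^-1` [set 0]).
  apply/seteqP; split => [[eta x] /= [w0x Tx]|[eta x] /= [w0x h]].
    by split => // i _ /=; rewrite TmodE// Tx subrr.
  split => //; apply/rowP => i; have /= := h i I.
  by rewrite TmodE// => /eqP; rewrite subr_eq0 => /eqP.
have mcoord i : measurable_fun setT (fun v : borel V => (v : V) 0 i).
  by apply: continuous_borel_real; exact: coord_continuous.
apply: measurableI.
  by rewrite -[X in measurable X]setTI; exact: measurable_snd.
apply: fin_bigcap_measurable => // i _; rewrite -[X in measurable X]setTI.
suff : measurable_fun setT
    (fun p : borel V * borel V => (p.1 : V) 0 i - Tmod p.2 0 i).
  by apply => //; exact: measurable_set1.
apply: measurable_funB; first exact: (measurableT_comp (mcoord i) measurable_fst).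
exact: (measurableT_comp (mcoord i) (measurableT_comp measurable_Tmod measurable_snd)).
Qed.

Let mfib eta : measurable (fib eta : set (borel V)).
Proof.
have := @measurable_xsection _ _ (borel V) (borel V) _ eta graph_measurable; congr measurable.
apply/seteqP; split => x; rewrite /xsection/= inE/=; by move=> [].
Qed.

(** The fibres are the sections of the closed graph of [T], so this is the
    measurability of a kernel integral in its parameter. *)
Lemma measurable_fiber_integral (f : V -> \bar R) :
  measurable_fun setT (f : borel V -> \bar R) -> (forall x, 0 <= f x)%E ->
  measurable_fun setT ((fun eta => \int[uhat eta]_(y in fib eta) f y)%E : borel V -> \bar R).
Proof.
move=> mf f0.
pose k (p : borel V * borel V) : \bar R :=
  ((f \o snd) \_ ([set p | w0 p.2 /\ T p.2 = p.1])) p.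
have mk : measurable_fun setT k.
  apply/(measurable_restrictT _ graph_measurable); apply: measurable_funTS.
  exact: (measurableT_comp mf measurable_snd).
have k0 p : (0 <= k p)%E by rewrite /k patchE; case: ifPn => _; rewrite ?lexx//=; exact: f0.
have := measurable_fun_integral_sfinite_kernel k uhat k0 mk.
congr (measurable_fun _ _); apply/funext => eta.
rewrite [RHS]integral_mkcond; apply: eq_integral => y _.
rewrite /k !patchE /=.
have -> : ((eta, y) \in [set p : borel V * borel V | w0 p.2 /\ T p.2 = p.1]) = (y \in fib eta).
  by apply/idP/idP; rewrite !inE.
by [].
Qed.

Lemma kernel_bounded_integrable eta (f : V -> R) (C : R) (D : set (borel V)) :
  measurable D -> measurable_fun D (f : borel V -> R) ->
  (forall x, D x -> `|f x| <= C) -> (uhat eta).-integrable D (EFin \o f).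
Proof.
move=> mD mf fC; apply: measurable_bounded_integrable => //.
  apply: (@le_lt_trans _ _ (uhat eta setT)); last by rewrite prob_kernel ltry.
  by apply: le_measure; rewrite ?inE.
exists C; split; first exact: num_real.
by move=> e Ce x Dx /=; exact: le_trans (fC x Dx) (ltW Ce).
Qed.

(** The points whose fibre carries the whole mass of its conditional measure;
    pointwise bounds pass to fibre means exactly there. *)
Definition good_fiber : set V := [set eta | rc_set w1 eta /\ uhat eta (fib eta) = 1%E].

Lemma measurable_good_fiber : measurable (good_fiber : set (borel V)).
Proof.
apply: measurableI => //.
have := @measurable_fiber_integral (cst 1%E) (measurable_cst _) (fun _ => lee01).
move=> /(_ measurableT _ (emeasurable_set1 1%E)); rewrite setTI.
congr measurable; apply/seteqP; split => eta /=; rewrite integral_cst ?mul1e//.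
Qed.

Lemma ae_good_fiber : {ae ubar, forall eta, rc_set w1 eta -> good_fiber eta}.
Proof.
have [conc ae0 _] := dis; move: ae0.
apply: (ae_filterS ubar) => eta h w1eta; split => //.
have h1 : uhat eta (w0 : set (borel V)) = 1%E.
  rewrite -(prob_kernel (s := uhat) eta) -(setUv (w0 : set (borel V))) measureU//=.
  - rewrite [X in (_ + X)%E](_ : _ = 0%E) ?adde0//.
    by apply: (conc eta w1eta); [exact: measurableC|rewrite setICl].
  - exact: measurableC.
  - exact: setICr.
rewrite -h1 -[in RHS](@setDUK _ (fib eta) w0); last by move=> x [].
rewrite measureU//; last by rewrite setDIK.
- by rewrite [X in (_ + X)%E](h w1eta) adde0.
- exact: measurableD.
Qed.

(** The disintegration formula for functions that are constant on the fibres: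
    [ubar] is the image of [u0] under [T]. *)
Lemma transport_map_image (g : V -> \bar R) :
  measurable_fun setT (g : borel V -> \bar R) -> (forall x, 0 <= g x)%E ->
  (\int[u0]_(x in w0) g (T x) = \int[ubar]_(eta in w1) g eta)%E.
Proof.
move=> mg g0; have [_ _ h] := dis.
rewrite (h (fun x => g (T x))); last 2 first.
- apply: (@eq_measurable_fun _ _ (borel V) _ _ (g \o Tmod)).
    by move=> x /set_mem w0x /=; rewrite TmodE.
  by apply: measurable_funTS; exact: (measurableT_comp mg measurable_Tmod).
- by [].
apply: ge0_ae_eq_integral => //.
- apply: (@eq_measurable_fun _ _ (borel V) _ _ (fun eta => \int[uhat eta]_(x in fib eta) g (Tmod x))%E).
    by move=> eta _; apply: eq_integral => x /set_mem[w0x _]; rewrite TmodE.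
  apply: measurable_funTS; apply: measurable_fiber_integral => //.
  exact: (measurableT_comp mg measurable_Tmod).
- exact: measurable_funTS.
- by move=> eta _; exact: integral_ge0.
have := ae_good_fiber.
apply: (ae_filterS ubar) => eta h1 w1eta.
have [_ h2] := h1 w1eta.
transitivity (\int[uhat eta]_(x in fib eta) g eta)%E.
  by apply: eq_integral => x /set_mem[_ <-].
by rewrite integral_cst// h2 mule1.
Qed.

Section mean_matrix.
Variables (P : V -> 'M[R]_d) (C b : R).
Hypotheses (C0 : 0 <= C)
  (mP : forall i j, measurable_fun (w0 : set (borel V)) (fun x : borel V => P x i j))
  (bP : forall x, w0 x -> forall i j, `|P x i j| <= C)
  (sP : forall x, w0 x -> (P x)^T = P x)
  (cP : forall x, w0 x -> coercive b (P x)).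

Definition fiber_mean (eta : V) : 'M[R]_d :=
  \matrix_(i, j) \int[uhat eta]_(y in fib eta) P y i j.

Let fib_w0 eta : fib eta `<=` w0. Proof. by move=> x []. Qed.

Let mPfib i j eta : measurable_fun (fib eta) (fun x : borel V => P x i j).
Proof. exact: measurable_funS (@fib_w0 eta) (mP i j). Qed.

Let iP i j eta : (uhat eta).-integrable (fib eta) (EFin \o (fun x => P x i j)).
Proof.
apply: (@kernel_bounded_integrable _ _ C) => //.
by move=> x /fib_w0 w0x; exact: bP.
Qed.

Lemma measurable_fiber_mean i j :
  measurable_fun setT ((fun eta => fiber_mean eta i j) : borel V -> R).
Proof.
(* P is shifted by C to have a nonnegative integrand. *)
pose a (y : borel V) : \bar R :=
  ((fun y : borel V => (P y i j + C)%:E) \_ (w0 : set (borel V))) y.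
have ma : measurable_fun setT a.
  apply/(measurable_restrictT _ mw0); apply/measurable_EFinP.
  by apply: measurable_funD => //; exact: measurable_cst.
have a0 y : (0 <= a y)%E.
  rewrite /a patchE; case: ifPn => // /set_mem w0y; rewrite lee_fin.
  by have := bP w0y i j; rewrite ler_norml => /andP[h _]; rewrite -lerBlDr sub0r.
have h1 := measurable_fiber_integral ma a0.
have h2 := @measurable_fiber_integral (cst 1%E) (measurable_cst _) (fun _ => lee01).
have -> : (fun eta => fiber_mean eta i j) = (fun eta : borel V =>
    fine (\int[uhat eta]_(y in fib eta) a y)
    - C * fine (\int[uhat eta]_(y in fib eta) cst 1 y)%E).
  apply/funext => eta; rewrite mxE.
  have ic : (uhat eta).-integrable (fib eta) (EFin \o (cst C : borel V -> R)).
    by apply: (@kernel_bounded_integrable _ _ C) => // x _; rewrite ger0_norm.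
  have -> : (\int[uhat eta]_(y in fib eta) a y)%E =
            (\int[uhat eta]_(y in fib eta) (P y i j + C)%:E)%E.
    by apply: eq_integral => y /set_mem /fib_w0 w0y; rewrite /a patchE mem_set.
  have -> : C * fine (\int[uhat eta]_(y in fib eta) cst 1 y)%E =
            \int[uhat eta]_(y in fib eta) C.
    rewrite Rintegral_cst// integral_cst// mul1e//.
  have := @RintegralD _ _ _ (uhat eta) (fib eta) _ _ (mfib eta) (iP i j eta) ic.
  by rewrite /Rintegral/= => ->; rewrite addrK.
apply: measurable_funB.
  by apply: measurableT_comp => //.
apply: measurable_funM; first exact: measurable_cst.
by apply: measurableT_comp => //.
Qed.

Lemma quad_fiber_mean eta v :
  quad (fiber_mean eta) v = \int[uhat eta]_(y in fib eta) quad (P y) v.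
Proof.
have iPv i j : (uhat eta).-integrable (fib eta)
    (EFin \o (fun x => v 0 i * v 0 j * P x i j)).
  by have := integrableZl (mfib eta) (v 0 i * v 0 j) (iP i j eta).
have -> : \int[uhat eta]_(y in fib eta) quad (P y) v =
    \int[uhat eta]_(y in fib eta) \sum_(ij : 'I_d * 'I_d)
       v 0 ij.1 * v 0 ij.2 * P y ij.1 ij.2.
  apply: eq_Rintegral => y _; rewrite quad_entries pair_big/=.
  by apply: eq_bigr => -[].
rewrite quad_entries pair_big/= Rintegral_sum; [|exact: mfib|by move=> [i j]; exact: iPv].
apply: eq_bigr => -[i j] _ /=; rewrite mxE RintegralZl//; exact: iP.
Qed.

Let iquad eta v : (uhat eta).-integrable (fib eta) (EFin \o (fun y => quad (P y) v)).
Proof.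
apply: (@kernel_bounded_integrable _ _ ((d ^ 2)%:R * C * dotv v v)) => //.
  by apply: measurable_quad => // i; exact: measurable_cst.
by move=> x /fib_w0 w0x; apply: abs_quad_le; exact: bP.
Qed.

Lemma tr_fiber_mean eta : (fiber_mean eta)^T = fiber_mean eta.
Proof.
apply/matrixP => i j; rewrite !mxE; apply: eq_Rintegral => y /set_mem /fib_w0 w0y.
by rewrite -[in LHS](sP w0y) mxE.
Qed.

Let Rfib eta (k : R) : good_fiber eta -> \int[uhat eta]_(y in fib eta) k = k.
Proof. by move=> [_ h]; rewrite Rintegral_cst//= h mulr1. Qed.

Lemma fiber_mean_coercive eta : good_fiber eta -> coercive b (fiber_mean eta).
Proof.
move=> g v; rewrite quad_fiber_mean -(Rfib (b * dotv v v) g).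
apply: le_Rintegral => //.
- by apply: (@kernel_bounded_integrable _ _ `|b * dotv v v|).
- by move=> y /fib_w0 w0y; exact: cP.
Qed.

Lemma fiber_mean_bounded eta i j : good_fiber eta -> `|fiber_mean eta i j| <= C.
Proof.
move=> g; rewrite mxE; apply: le_trans (le_normr_Rintegral _ _) _ => //.
rewrite -(Rfib C g); apply: le_Rintegral => //.
- by apply: integrable_norm; exact: iP.
- by apply: (@kernel_bounded_integrable _ _ C) => // x _; rewrite ger0_norm.
- by move=> y /fib_w0 w0y; exact: bP.
Qed.

(** The disintegration formula turns quadratic forms of the [P x] into those
    of their fibre means, as the argument is constant on the fibres. *)
Lemma integral_quad_fiber_mean (p : V -> V) : 0 <= b ->
  (forall i, measurable_fun setT ((fun eta => p eta 0 i) : borel V -> R)) ->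
  (\int[u0]_(x in w0) (quad (P x) (p (T x)))%:E =
   \int[ubar]_(eta in w1) (quad (fiber_mean eta) (p eta))%:E)%E.
Proof.
move=> b0 mp; have [_ _ h] := dis.
rewrite (h (fun x => (quad (P x) (p (T x)))%:E)); last 2 first.
- apply/measurable_EFinP; apply: measurable_quad => // i.
  apply: (@eq_measurable_fun _ _ (borel V) _ _ (fun x => p (Tmod x) 0 i)).
    by move=> x /set_mem w0x /=; rewrite TmodE.
  by apply: measurable_funTS; exact: (measurableT_comp (mp i) measurable_Tmod).
- by move=> x w0x; rewrite lee_fin; exact: coercive_quad_ge0 b0 (cP w0x).
apply: eq_integral => eta _; rewrite quad_fiber_mean /Rintegral fineK; last first.
  exact: integrable_fin_num (iquad eta (p eta)).
by apply: eq_integral => x /set_mem[_ <-].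
Qed.

End mean_matrix.

End disintegrated_matrix.

(** * Measurability of inverses and limits of integrals *)

Section measurable_inverse_matrix.
Context {R : realType} {dx : measure_display} {X : measurableType dx}.

(** Inversion is continuous except at 0, where it takes the value 0. *)
Lemma measurable_invr : measurable_fun setT (@GRing.inv R).
Proof.
have -> : @GRing.inv R = (fun x => if x == 0 then 0 else x^-1).
  by apply/funext => x; case: eqVneq => // ->; rewrite invr0.
apply: measurable_fun_if => //.
- by apply: measurable_fun_eqr => //; exact: measurable_cst.
- rewrite setTI (_ : _ @^-1` _ = [set~ 0]); last first.
    by apply/seteqP; split => x /=; [move=> /eqP|move=> /eqP/negbTE].
  apply: open_continuous_measurable_fun.
    by apply: closed_openC; apply: accessible_closed_set1; exact: hausdorff_accessible.
  by move=> x /set_mem /eqP x0; exact: inv_continuous.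
Qed.

Lemma measurable_det n (D : set X) (M : X -> 'M[R]_n) :
  (forall i j, measurable_fun D (fun x => M x i j)) ->
  measurable_fun D (fun x => \det (M x)).
Proof.
move=> mM; apply: measurable_sum => s; apply: measurable_funM.
  exact: measurable_cst.
by apply: measurable_prod => i _; exact: mM.
Qed.

(** Cramer's rule; off the unit matrices [invmx] is the identity. *)
Lemma measurable_invmx n (D : set X) (M : X -> 'M[R]_n) i j :
  measurable D -> (forall i j, measurable_fun D (fun x => M x i j)) ->
  measurable_fun D (fun x => invmx (M x) i j).
Proof.
move=> mD mM; have mdet := measurable_det mM.
have -> : (fun x => invmx (M x) i j) = (fun x => if \det (M x) == 0 then M x i j
    else (\det (M x))^-1 * ((-1) ^+ (j + i) * \det (row' j (col' i (M x))))).
  apply/funext => x; rewrite /invmx unitmxE unitfE; case: eqP => //= _.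
  by rewrite !mxE /cofactor.
apply: measurable_fun_if => //.
- by apply: measurable_fun_eqr => //; exact: measurable_cst.
- apply: measurable_funS (mM i j) => //.
- apply: (@measurable_funS _ _ _ _ D) => //.
  apply: measurable_funM; first exact: (measurableT_comp measurable_invr mdet).
  apply: measurable_funM; first exact: measurable_cst.
  apply: measurable_det => k l; have := mM (lift j k) (lift i l).
  by congr measurable_fun; apply/funext => x; rewrite !mxE.
Qed.

End measurable_inverse_matrix.

Section limn_einf_bounds.
Context {R : realType}.

Lemma limn_einf_ge (u : nat -> \bar R) (a : \bar R) N :
  (forall n, (N <= n)%N -> (a <= u n)%E) -> (a <= limn_einf u)%E.
Proof.
move=> h; rewrite limn_einf_lim; apply: lime_ge; first exact: is_cvg_einfs.
exists N => // n /= Nn; apply: le_ereal_inf_tmp => _ [k /= nk <-].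
by apply: h; exact: leq_trans Nn nk.
Qed.

Lemma limn_einf_le_cvg (u v : nat -> \bar R) (l : \bar R) :
  (forall n, (u n <= v n)%E) -> v @ \oo --> l -> (limn_einf u <= l)%E.
Proof.
move=> uv vl; have <- : limn_einf v = l.
  by have [] := cvg_limn_einf_sup vl.
rewrite !limn_einf_lim; apply: lee_lim; [exact: is_cvg_einfs|exact: is_cvg_einfs|].
apply: nearW => n; apply: le_ereal_inf_tmp => _ [k /= nk <-].
by apply: ge_ereal_inf; exists (u k) => //; exists k.
Qed.

End limn_einf_bounds.

Lemma mxbounded_entry {R : realType} {d : nat} (m : R) (A : 'M[R]_d) i j :
  mxbounded m A -> `|A i j| <= m.
Proof.
move=> /(_ (delta_mx 0 i)).
have -> : enorm (delta_mx 0 i : 'rV[R]_d) = 1.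
  rewrite /enorm (_ : dotv _ _ = 1) ?sqrtr1// /dotv (bigD1 i)//= big1 ?addr0.
    by rewrite !mxE !eqxx mulr1.
  by move=> k ki; rewrite !mxE (negbTE ki) andbF mulr0.
rewrite mulr1 -rowE; apply: le_trans.
by have := coord_le_enorm (row i A) j; rewrite mxE.
Qed.

Lemma C1dual_linear {R : realType} {d : nat} (w1 : regular_compact R d)
    (h : C1dual w1) (a : R) (u v : C1 w1) : h (a *: u + v) = a * h u + h v.
Proof. by have := C1dual_funP h; rewrite inE => -[l _]; exact: l. Qed.

Section gradient_measurability.
Context {R : realType} {d : nat} (w1 : regular_compact R d).
Local Notation V := 'rV[R]_d.

(** [grad w1 psi] extended by 0, which makes it a bounded Borel field. *)
Definition gradm (psi : C1 w1) (x : V) : V :=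
  if x \in (rc_set w1 : set V) then grad w1 psi x else 0.

Lemma gradmE psi x : rc_set w1 x -> gradm psi x = grad w1 psi x.
Proof. by move=> w1x; rewrite /gradm mem_set. Qed.

Lemma measurable_gradm psi i :
  measurable_fun setT ((fun x => gradm psi x 0 i) : borel V -> R).
Proof.
have mw1 := compact_borel (@rc_compact _ _ w1).
have -> : (fun x : borel V => gradm psi x 0 i) =
    (fun x : borel V => grad w1 psi x 0 i) \_ (rc_set w1 : set (borel V)).
  by apply/funext => x; rewrite patchE /gradm; case: ifP => // _; rewrite mxE.
apply/(measurable_restrictT _ mw1); apply: within_continuous_measurable.
  exact: rc_compact.
exact/coord_within_continuous/grad_within_continuous.
Qed.

Lemma enorm_gradm_le psi x : enorm (gradm psi x) <= C1_norm psi.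
Proof.
rewrite /gradm; case: ifPn => [/set_mem w1x|_]; last by rewrite enorm0 C1_norm_ge0.
by have [] := C1_norm_ge psi w1x.
Qed.

End gradient_measurability.

Lemma dominated_Rcvg {R : realType} {dx : measure_display} {X : measurableType dx}
    (mu : {measure set X -> \bar R}) (D : set X) (f_ : nat -> X -> R) (f g : X -> R) :
  measurable D -> (forall n, measurable_fun D (f_ n)) ->
  (forall x, D x -> f_ n x @[n --> \oo] --> f x) ->
  mu.-integrable D (EFin \o g) -> (forall n x, D x -> `|f_ n x| <= g x) ->
  \int[mu]_(x in D) f_ n x @[n --> \oo] --> \int[mu]_(x in D) f x.
Proof.
move=> mD mf fcvg ig fg.
have mf' n : measurable_fun D (EFin \o f_ n) by exact/measurable_EFinP.
have cf' x : D x -> (EFin \o f_ n) x @[n --> \oo] --> (f x)%:E.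
  by move=> Dx; apply: cvg_EFin; [exact: nearW|exact: fcvg].
have fg' n x : D x -> (`|(EFin \o f_ n) x| <= (EFin \o g) x)%E.
  by move=> Dx; rewrite /= lee_fin fg.
have mfl : measurable_fun D (EFin \o f) by exact: emeasurable_fun_cvg mf' cf'.
have [||ifl _ ] := @dominated_convergence _ _ _ mu D mD (fun n => EFin \o f_ n)
  (EFin \o f) (EFin \o g) mf' mfl _ ig.
- exact: aeW.
- by apply: aeW => x n; exact: fg'.
rewrite -[X in _ --> X](fineK (integrable_fin_num mD ifl)).
exact: fine_cvg.
Qed.

Lemma majorant_arith {R : realType} (N s q n : R) : N <= s * n ->
  N + 2^-1 * (s * q) <= s / 2 * (q + 2 * n).
Proof. lra. Qed.

(** Transfer of bounds with error [s * X] to second difference quotients, for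
    possibly infinite values [Y]. *)
Lemma difference_quotient_ge {R : realType} (Y : \bar R) (D0 a s X : R) : 0 < s ->
  ((D0 + a + s * X)%:E <= Y)%E ->
  ((2 * X)%:E <= (Y - D0%:E - a%:E) * ((s / 2)^-1)%:E)%E.
Proof.
move=> s0; have s2 : 0 < (s / 2)^-1 by rewrite invr_gt0 divr_gt0.
case: Y => [y| |] //.
  rewrite -!EFinB -EFinM !lee_fin => h.
  rewrite ler_pdivlMr ?divr_gt0//; lra.
by move=> _; rewrite !addye// gt0_mulye ?lte_fin// leey.
Qed.

Lemma difference_quotient_le {R : realType} (Y : \bar R) (D0 a s X : R) : 0 < s ->
  (Y <= (D0 + a + s * X)%:E)%E ->
  ((Y - D0%:E - a%:E) * ((s / 2)^-1)%:E <= (2 * X)%:E)%E.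
Proof.
move=> s0; have s2 : 0 < (s / 2)^-1 by rewrite invr_gt0 divr_gt0.
case: Y => [y| |] //.
  rewrite -!EFinB -EFinM !lee_fin => h.
  rewrite ler_pdivrMr ?divr_gt0//; lra.
by move=> _; rewrite !addNye gt0_mulNye ?lte_fin// leNye.
Qed.

(** * Lower and upper bounds for the second subderivative *)

Section optimal_transport_expansion.
Context {R : realType} {d : nat}.
Local Notation V := 'rV[R]_d.
Variables (w0 : set V) (w1 : regular_compact R d) (c : V -> V -> R)
  (u0 : Mpos w0) (ubar : Mpos w1) (phi : C1 w1) (T : V -> V) (gamma m : R)
  (uhat : R.-pker (borel V) ~> (borel V)) (A : V -> 'M[R]_d).
Hypotheses (cw0 : compact w0)
  (cc : {within w0 `*` w1, continuous (fun z => c z.1 z.2)})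
  (cT : {within w0, continuous T})
  (Tint : forall x, w0 x -> interior (rc_set w1) (T x))
  (gamma0 : 0 < gamma) (m0 : 0 < m)
  (growth : forall x eta, w0 x -> rc_set w1 eta ->
    gamma / 2 * enorm (eta - T x) ^+ 2 <= excess c phi T x eta)
  (taylorE : forall e, 0 < e -> exists2 r : R, 0 < r & forall x z,
    w0 x -> enorm z <= r -> interior (rc_set w1) (T x + z) /\
    `|excess c phi T x (T x + z) - 2^-1 * quad (A x) z| <= e * dotv z z)
  (symA : forall x, w0 x -> (A x)^T = A x)
  (coerA : forall x, w0 x -> coercive gamma (A x))
  (bndA : forall x, w0 x -> mxbounded m (A x))
  (contA : forall i j, {within w0, continuous (fun x => A x i j)})
  (dis : is_disintegration u0 ubar T uhat).

Let Tw x (w0x : w0 x) : rc_set w1 (T x) := interior_subset (Tint w0x).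
Let mw0 := compact_borel cw0.
Let mw1 := compact_borel (@rc_compact _ _ w1).
Let unitA x (w0x : w0 x) : A x \in unitmx := coercive_unitmx gamma0 (coerA w0x).

Let P x := invmx (A x).
Let B := fiber_mean w0 T uhat P.
Let ub := Pi (M_of_Mpos ubar).
Let Tm := Tmod w0 T.
Let mTm : measurable_fun setT (Tm : borel V -> borel V) := measurable_Tmod cw0 cT.

Let mP i j : measurable_fun (w0 : set (borel V)) (fun x : borel V => P x i j).
Proof.
apply: measurable_invmx => // k l; exact: within_continuous_measurable.
Qed.

Let bP x : w0 x -> forall i j, `|P x i j| <= gamma^-1.
Proof.
move=> w0x i j; apply: mxbounded_entry.
exact: invmx_mxbounded gamma0 (symA w0x) (coerA w0x).
Qed.

Let sP x : w0 x -> (P x)^T = P x.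
Proof. by move=> w0x; rewrite trmx_invmx ?symA. Qed.

Let b0 : 0 < gamma / m ^+ 2. Proof. by rewrite divr_gt0// exprn_gt0. Qed.

Let cP x : w0 x -> coercive (gamma / m ^+ 2) (P x).
Proof.
by move=> w0x; exact: invmx_coercive gamma0 m0 (symA w0x) (coerA w0x) (bndA w0x).
Qed.

Let g0 : 0 <= gamma^-1. Proof. by rewrite invr_ge0 ltW. Qed.

Lemma transported_measure (D : set (borel V)) : measurable D -> ubar D = u0 (Tm @^-1` D).
Proof.
move=> mD.
have mD1 : measurable_fun setT ((fun x => (\1_D x)%:E) : borel V -> \bar R).
  by apply/measurable_EFinP; exact: measurable_indic.
have D10 (x : V) : (0 <= (\1_D x : R)%:E)%E by rewrite lee_fin.
have := transport_map_image cw0 cT dis mD1 D10.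
- rewrite [in RHS]integral_indic// => h.
  rewrite (concentrated_measureI mw1 (Mpos_on ubar) mD).
  rewrite -h; transitivity (\int[u0]_(x in w0) (\1_(Tm @^-1` D) x)%:E)%E.
    by apply: eq_integral => x /set_mem w0x; rewrite -(TmodE T w0x).
  have mTD : measurable (Tm @^-1` D : set (borel V)).
    by rewrite -[X in measurable X]setTI; exact: mTm.
  by rewrite integral_indic// (concentrated_measureI mw0 (Mpos_on u0) mTD).
Qed.

Lemma ubE (chi : C1 w1) : ub chi = \int[u0]_x chi (Tm x).
Proof. by rewrite /ub PiE; apply: charge_integral_image => //; exact: transported_measure. Qed.

Let setTw0 (f : borel V -> R) : measurable_fun setT f ->
  \int[u0]_x f x = \int[u0]_(x in w0) f x.
Proof.
move=> mf; congr fine; apply: concentrated_integralT => //; first exact: Mpos_on.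
exact/measurable_EFinP.
Qed.

Let mC1T (chi : C1 w1) : measurable_fun setT (fun x : borel V => chi (Tm x)).
Proof. exact: (measurableT_comp (measurable_C1 chi) mTm). Qed.

Lemma ubE_w0 (chi : C1 w1) : ub chi = \int[u0]_(x in w0) chi (T x).
Proof.
rewrite ubE setTw0//; apply: eq_Rintegral => x /set_mem w0x.
by rewrite /Tm TmodE.
Qed.

Let iC1T (chi : C1 w1) : u0.-integrable w0 (EFin \o (fun x => chi (T x))).
Proof.
apply: (@bounded_integrable _ _ _ _ _ (C1_norm chi)) => //.
  apply: (@eq_measurable_fun _ _ (borel V) _ _ (fun x => chi (Tm x))).
    by move=> x /set_mem w0x; rewrite /Tm TmodE.
  exact: measurable_funTS.
by move=> x _; exact: C1_norm_bound.
Qed.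

Let cw : compact (w0 `*` w1).
Proof. by apply: compact_setX => //; exact: rc_compact. Qed.

Let mcS (S : V -> V) : measurable_fun setT (S : borel V -> borel V) ->
  (forall x, w0 x -> rc_set w1 (S x)) ->
  measurable_fun (w0 : set (borel V)) (fun x : borel V => c x (S x)).
Proof.
move=> mS Sw.
have mp : measurable_fun setT ((fun x => (x, S x)) : borel V -> borel (V * V)%type).
  by apply: measurable_pair_rV.
have mw : measurable (w0 `*` w1 : set (borel (V * V)%type)) by exact: compact_borel.
pose G : V * V -> R := (fun z => c z.1 z.2) \_ (w0 `*` w1).
have mG : measurable_fun setT (G : borel (V * V)%type -> R).
  by apply/(measurable_restrictT _ mw); exact: within_continuous_measurable.
apply: (@eq_measurable_fun _ _ (borel V) _ _ (fun x => G (x, S x))).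
  move=> x /set_mem w0x; rewrite /G patchE mem_set//.
  by split => //=; exact: Sw.
by apply: measurable_funTS; exact: (measurableT_comp mG mp).
Qed.

Let icS (S : V -> V) : measurable_fun setT (S : borel V -> borel V) ->
  (forall x, w0 x -> rc_set w1 (S x)) ->
  u0.-integrable w0 (EFin \o (fun x => c x (S x))).
Proof.
move=> mS Sw; have [C hC] := within_continuous_bounded cw cc.
apply: (@bounded_integrable _ _ _ _ _ C) => //; first exact: mcS.
by move=> x w0x; apply: (hC (x, S x)); split => //=; exact: Sw.
Qed.

Let Tmw1 x : w0 x -> rc_set w1 (Tm x).
Proof. by move=> w0x; rewrite /Tm TmodE//; exact: Tw. Qed.

Let icT : u0.-integrable w0 (EFin \o (fun x => c x (T x))).
Proof.
apply: (@eq_integrable _ _ _ u0 w0 mw0 (EFin \o (fun x => c x (Tm x)))); last exact: icS.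
by move=> x /set_mem w0x; rewrite /= /Tm TmodE.
Qed.

Definition optimal_cost : R := \int[u0]_(x in w0) c x (T x).

Let weak_duality_w0 (chi : C1 w1) (a : V -> R) (C : R) (g : C1dual w1) :
  measurable_fun (w0 : set (borel V)) (a : borel V -> R) ->
  (forall x, w0 x -> `|a x| <= C) ->
  (forall x eta, w0 x -> rc_set w1 eta -> chi eta + a x <= c x eta) ->
  ((g chi + \int[u0]_(x in w0) a x)%:E <= ot_dual c u0 g)%E.
Proof.
move=> ma aC ac.
have mpa : measurable_fun setT ((a : borel V -> R) \_ (w0 : set (borel V))).
  exact/(measurable_restrictT _ mw0).
have -> : \int[u0]_(x in w0) a x = \int[u0]_x ((a : borel V -> R) \_ (w0 : set (borel V))) x.
  by rewrite setTw0//; apply: eq_Rintegral => x xw0; rewrite patchE xw0.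
apply: (@weak_duality _ _ _ _ _ _ cw0 cc chi _ (Num.max C 0)) => //.
- move=> x; rewrite patchE; case: ifPn => [/set_mem w0x|_].
    by rewrite le_max aC.
  by rewrite normr0 le_max lexx orbT.
- by move=> x eta w0x w1eta; rewrite patchE mem_set//; exact: ac.
Qed.

Lemma ub_image : ub = Pi (image_M u0 mTm Tmw1).
Proof.
by apply/val_inj/funext => chi; rewrite [LHS]ubE [RHS]Pi_image.
Qed.

(** Optimality of [T]: the growth condition makes [phi] and its slack an optimal
    dual pair, complementary to the graph of [T]. *)
Lemma ot_dual_ub : ot_dual c u0 ub = optimal_cost%:E.
Proof.
apply/eqP; rewrite eq_le; apply/andP; split.
  rewrite ub_image; apply: (le_trans (@ot_dual_image _ _ _ _ _ _ cw0 cc _ _ _)).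
  rewrite /optimal_cost /Rintegral fineK; last exact: integrable_fin_num icT.
  rewrite le_eqVlt; apply/orP; left; apply/eqP; apply: eq_integral.
  by move=> x /set_mem w0x; rewrite /Tm TmodE.
have [C hC] : exists C : R, forall x, w0 x -> `|c x (T x) - phi (T x)| <= C.
  have [C hC] := within_continuous_bounded cw cc.
  exists (C + C1_norm phi) => x w0x; apply: le_trans (ler_normB _ _) _.
  apply: lerD; last exact: C1_norm_bound.
  by apply: (hC (x, T x)); split => //=; exact: Tw.
have := @weak_duality_w0 phi (fun x => c x (T x) - phi (T x)) C ub.
rewrite RintegralB// -ubE_w0 subrKC; apply => //.
  apply: measurable_funB; apply/measurable_EFinP; first exact: measurable_int icT.
  exact: measurable_int (iC1T phi).
move=> x eta w0x w1eta; have := growth w0x w1eta; rewrite /excess => h.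
have : 0 <= gamma / 2 * enorm (eta - T x) ^+ 2.
  by rewrite mulr_ge0 ?sqr_ge0// divr_ge0// ltW.
by move: h; lra.
Qed.

(** The quadratic form conjugate to [quad_integral] of the inverse matrices: the
    finite-energy functionals of the problem are those bounded by it. *)
Definition gradient_energy (psi : C1 w1) : R :=
  \int[ubar]_(eta in w1) quad (B eta) (grad w1 psi eta).

Let quadP_le x v : w0 x -> `|quad (P x) v| <= (d ^ 2)%:R * gamma^-1 * dotv v v.
Proof. by move=> w0x; apply: abs_quad_le; exact: bP. Qed.

Let mquadP (psi : C1 w1) : measurable_fun (w0 : set (borel V))
  (fun x : borel V => quad (P x) (grad w1 psi (T x))).
Proof.
apply: measurable_quad => // i.
apply: (@eq_measurable_fun _ _ (borel V) _ _ (fun x => gradm psi (Tm x) 0 i)).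
  by move=> x /set_mem w0x; rewrite /Tm TmodE// gradmE//; exact: Tw.
by apply: measurable_funTS; exact: (measurableT_comp (measurable_gradm psi i) mTm).
Qed.

Let quadP_bound (psi : C1 w1) x : w0 x ->
  `|quad (P x) (grad w1 psi (T x))| <= (d ^ 2)%:R * gamma^-1 * C1_norm psi ^+ 2.
Proof.
move=> w0x; apply: le_trans (quadP_le _ w0x) _.
rewrite ler_wpM2l ?mulr_ge0// -sqr_enorm ler_pXn2r// ?nnegrE ?enorm_ge0 ?C1_norm_ge0//.
by have [] := C1_norm_ge psi (Tw w0x).
Qed.

Lemma gradient_energyE psi : gradient_energy psi =
  \int[u0]_(x in w0) quad (P x) (grad w1 psi (T x)).
Proof.
have h := integral_quad_fiber_mean cw0 cT dis mP bP cP (ltW b0) (measurable_gradm psi).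
apply: (congr1 fine).
transitivity (\int[ubar]_(eta in w1) (quad (B eta) (gradm psi eta))%:E)%E.
  by apply: eq_integral => eta /set_mem w1eta; rewrite gradmE.
rewrite -h; apply: eq_integral => x /set_mem w0x; rewrite gradmE//; exact: Tw.
Qed.

(** Weak duality for the potential [phi + t psi], perturbed in the direction
    of a test function: the infimal slack is of order [t ^ 2] and its leading
    coefficient is the Legendre transform of the quadratic form of [A x]. *)
Lemma ot_dual_lower psi delta : 0 < delta -> exists2 t0 : R, 0 < t0 &
  forall t (h : C1dual w1), 0 < t <= t0 ->
  ((optimal_cost + t * h phi + t ^+ 2 * (h psi - 2^-1 * gradient_energy psi
     - delta * fine (u0 w0)))%:E <= ot_dual c u0 (ub + t *: h)%R)%E.
Proof.
move=> delta0.
have [t0 t00 ht] := perturbed_excess_ge psi cw0 cT Tint gamma0 growth taylorE symA coerA delta0.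
exists t0 => // t h tt.
(* By the bound on the perturbed excess, a is feasible with phi + t psi. *)
pose a x := c x (T x) - (phi + t *: psi : C1 w1) (T x)
  - t ^+ 2 * (2^-1 * quad (P x) (grad w1 psi (T x)) + delta).
have iq : u0.-integrable w0 (EFin \o (fun x => quad (P x) (grad w1 psi (T x)))).
  exact: (@bounded_integrable _ _ _ _ _ _ _ _ (mquadP psi) (quadP_bound psi)).
have id : u0.-integrable w0 (EFin \o (fun _ : V => delta)).
  by apply: (@bounded_integrable _ _ _ _ _ `|delta|).
have iq2 : u0.-integrable w0 (EFin \o (fun x => 2^-1 * quad (P x) (grad w1 psi (T x)))).
  by have := integrableZl mw0 2^-1 iq.
have iqd : u0.-integrable w0 (EFin \o (fun x => 2^-1 * quad (P x) (grad w1 psi (T x)) + delta)).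
  by have := integrableD mw0 iq2 id.
have itqd : u0.-integrable w0 (EFin \o (fun x => t ^+ 2 * (2^-1 * quad (P x) (grad w1 psi (T x)) + delta))).
  by have := integrableZl mw0 (t ^+ 2) iqd.
have icp : u0.-integrable w0 (EFin \o (fun x => c x (T x) - (phi + t *: psi : C1 w1) (T x))).
  by have := integrableB mw0 icT (iC1T (phi + t *: psi)).
have ia : \int[u0]_(x in w0) a x = optimal_cost - ub (phi + t *: psi)
    - t ^+ 2 * (2^-1 * gradient_energy psi + delta * fine (u0 w0)).
  rewrite /a RintegralB//; congr (_ - _); first by rewrite RintegralB// -ubE_w0.
  rewrite RintegralZl//; congr (_ * _); rewrite RintegralD//; congr (_ + _).
    by rewrite gradient_energyE; apply: RintegralZl; [exact: mw0|exact: iq].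
  by rewrite Rintegral_cst.
have ma : measurable_fun (w0 : set (borel V)) (a : borel V -> R).
  by apply/measurable_EFinP; have /measurable_int := integrableB mw0 icp itqd.
have [C hC] : exists C : R, forall x, w0 x -> `|a x| <= C.
  have [C hC] := within_continuous_bounded cw cc.
  exists (C + C1_norm (phi + t *: psi) + t ^+ 2 * (2^-1 * ((d ^ 2)%:R * gamma^-1 *
    C1_norm psi ^+ 2) + delta)) => x w0x.
  apply: le_trans (ler_normB _ _) _; apply: lerD.
    apply: le_trans (ler_normB _ _) _; apply: lerD; last exact: C1_norm_bound.
    by apply: (hC (x, T x)); split => //=; exact: Tw.
  rewrite normrM ger0_norm ?sqr_ge0// ler_wpM2l ?sqr_ge0//.
  apply: le_trans (ler_normD _ _) _; rewrite (ger0_norm (ltW delta0)) lerD2r.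
  rewrite normrM ger0_norm ?invr_ge0// ler_wpM2l ?invr_ge0//.
  exact: quadP_bound.
have := @weak_duality_w0 (phi + t *: psi) a C (ub + t *: h) ma hC.
rewrite ia.
have gE : (ub + t *: h) (phi + t *: psi) =
    ub (phi + t *: psi) + (t * h phi + t ^+ 2 * h psi).
  have hlin : h (phi + t *: psi) = h phi + t * h psi.
    by rewrite [phi + _]addrC C1dual_linear addrC.
  by change (ub (phi + t *: psi) + t * h (phi + t *: psi) =
    ub (phi + t *: psi) + (t * h phi + t ^+ 2 * h psi)); rewrite hlin; ring.
rewrite gE.
have -> : ub (phi + t *: psi) + (t * h phi + t ^+ 2 * h psi) +
  (optimal_cost - ub (phi + t *: psi) - t ^+ 2 * (2^-1 * gradient_energy psi + delta * fine (u0 w0)))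
  = optimal_cost + t * h phi + t ^+ 2 * (h psi - 2^-1 * gradient_energy psi
     - delta * fine (u0 w0)) by ring.
apply=> x eta w0x w1eta.
have := ht t tt x eta w0x w1eta; rewrite /a /excess -/(P x).
have pE y : (phi + t *: psi : C1 w1) y = phi y + t * psi y by [].
rewrite !pE; move: (quad _ _) => q; lra.
Qed.

(** The lower bound on the cost divided by [t ^ 2 / 2]; the terms that are linear
    in [h psi] pass to the limit by weak-star convergence. *)
Lemma second_subderivative_ge (psi : C1 w1) (h : C1dual w1) :
  ((2 * h psi - gradient_energy psi)%:E <= second_subderivative c u0 ub phi h)%E.
Proof.
apply: le_ereal_inf_tmp => _ [[t h_] /= [tpos t0 hcv] <-].
apply/lee_addgt0Pr => e e0; rewrite -leeBlDr// -EFinB.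
have M0 : 0 <= fine (u0 w0) by exact: fine_ge0.
pose delta := e / (4 * (fine (u0 w0) + 1)).
have M1 : 0 < fine (u0 w0) + 1 by rewrite ltr_wpDl.
have delta0 : 0 < delta by rewrite divr_gt0// mulr_gt0.
have deltaM : 4 * (delta * fine (u0 w0)) <= e.
  have eE : e = 4 * (delta * fine (u0 w0)) + 4 * delta.
    by rewrite /delta; field; rewrite gt_eqF.
  by rewrite [leRHS]eE lerDl mulr_ge0// ltW.
have [s s0 hs] := ot_dual_lower psi delta0.
have e4 : 0 < e / 4 by rewrite divr_gt0.
have := hcv psi; move=> /cvgrPdist_le/(_ _ e4)[N1 _ hN1].
move: t0 => /cvgrPdist_le/(_ _ s0)[N2 _ hN2].
apply: (@limn_einf_ge _ _ _ (maxn N1 N2)) => k; rewrite geq_max => /andP[k1 k2].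
have := hN1 k k1; rewrite ler_norml => /andP[_ h1].
have tk : 0 < t k <= s.
  rewrite tpos /=; have := hN2 k k2.
  by rewrite /= sub0r normrN ger0_norm// ltW.
rewrite ot_dual_ub.
have t2 : 0 < t k ^+ 2 by rewrite exprn_gt0.
apply: le_trans (difference_quotient_ge t2 (hs (t k) (h_ k) tk)).
rewrite lee_fin; move: h1 deltaM.
by move: (gradient_energy psi) (h_ k psi) (h psi) (delta * _) => *; lra.
Qed.

Section recovery_sequence.
Variables (nu : 'I_d -> M w1) (rho : V -> V).
Hypotheses
  (mrho : forall i, measurable_fun setT ((fun eta => rho eta 0 i) : borel V -> R))
  (nuE : forall chi : C1 w1, bracket (M0 w1) nu chi =
    \int[ubar]_(eta in w1) dotv (grad w1 chi eta) (rho eta))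
  (Qfin : (quad_integral ubar (fun eta => invmx (B eta)) rho < +oo)%E).

Let mB i j : measurable_fun setT ((fun eta => B eta i j) : borel V -> R).
Proof. exact: (measurable_fiber_mean uhat cw0 cT g0 mP bP). Qed.

Let mH i j : measurable_fun setT ((fun eta => invmx (B eta) i j) : borel V -> R).
Proof. by apply: measurable_invmx. Qed.

(** The multiplier of the constraint in the following problem: the displacement
    [v] below has the prescribed fibre means [rho] and minimises the energy of
    [A] among all such fields. *)
Let w (eta : V) : V := rho eta *m invmx (B eta).

Let mw i : measurable_fun setT ((fun eta => w eta 0 i) : borel V -> R).
Proof. exact: measurable_mulmx. Qed.

Let v (x : V) : V := if x \in w0 then w (Tm x) *m P x else 0.

Let mwTm i : measurable_fun setT ((fun x => w (Tm x) 0 i) : borel V -> R).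
Proof. exact: (measurableT_comp (mw i) mTm). Qed.

Let mv i : measurable_fun setT ((fun x => v x 0 i) : borel V -> R).
Proof.
have -> : (fun x : borel V => v x 0 i) =
    (fun x : borel V => (w (Tm x) *m P x) 0 i) \_ (w0 : set (borel V)).
  by apply/funext => x; rewrite patchE /v; case: ifP => // _; rewrite mxE.
apply/(measurable_restrictT _ mw0); apply: measurable_mulmx => // j.
exact: measurable_funTS.
Qed.

Let vE x : w0 x -> v x = w (T x) *m P x.
Proof. by move=> w0x; rewrite /v mem_set// /Tm TmodE. Qed.

Let quadAv x : w0 x -> quad (A x) (v x) = quad (P x) (w (T x)).
Proof. by move=> w0x; rewrite vE// /P -quad_invmx ?symA ?unitA. Qed.

Let ae_good : {ae ubar, forall eta, rc_set w1 eta -> good_fiber w0 w1 T uhat eta}.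
Proof. exact: (ae_good_fiber cw0 cT dis). Qed.

Let trB eta : (B eta)^T = B eta.
Proof. exact: tr_fiber_mean sP eta. Qed.

Let coerB eta : good_fiber w0 w1 T uhat eta -> coercive (gamma / m ^+ 2) (B eta).
Proof. exact: (fiber_mean_coercive cw0 cT mP bP cP). Qed.

Let unitB eta : good_fiber w0 w1 T uhat eta -> B eta \in unitmx.
Proof. by move=> g; exact: coercive_unitmx b0 (coerB g). Qed.

Let wB eta : good_fiber w0 w1 T uhat eta -> w eta *m B eta = rho eta.
Proof. by move=> g; rewrite /w mulmxKV//; exact: unitB. Qed.

Let quadBw eta : good_fiber w0 w1 T uhat eta ->
  quad (B eta) (w eta) = quad (invmx (B eta)) (rho eta).
Proof. by move=> g; rewrite quad_invmx// unitB. Qed.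

Let energyE : (\int[u0]_(x in w0) (quad (A x) (v x))%:E =
  quad_integral ubar (fun eta => invmx (B eta)) rho)%E.
Proof.
transitivity (\int[u0]_(x in w0) (quad (P x) (w (T x)))%:E)%E.
  by apply: eq_integral => x /set_mem w0x; rewrite quadAv.
rewrite (integral_quad_fiber_mean cw0 cT dis mP bP cP (ltW b0) mw).
apply: ae_eq_integral => //.
- apply/measurable_EFinP; apply: measurable_funTS.
  by apply: measurable_quad.
- apply/measurable_EFinP; apply: measurable_funTS.
  by apply: measurable_quad.
- have := ae_good; apply: (ae_filterS ubar).
  by move=> eta g w1eta; rewrite -/B quadBw//; exact: g.
Qed.

Let A0 x z : w0 x -> 0 <= quad (A x) z.
Proof. by move=> w0x; exact: coercive_quad_ge0 (ltW gamma0) (coerA w0x). Qed.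

Let mquadAv : measurable_fun (w0 : set (borel V)) (fun x : borel V => quad (A x) (v x)).
Proof.
apply: measurable_quad => [i j|i]; last exact: measurable_funTS.
exact: within_continuous_measurable.
Qed.

Let iquadAv : u0.-integrable w0 (EFin \o (fun x => quad (A x) (v x))).
Proof.
apply/integrableP; split; first exact/measurable_EFinP.
have -> : (\int[u0]_(x in w0) `|(EFin \o (fun x => quad (A x) (v x))) x| =
    \int[u0]_(x in w0) (quad (A x) (v x))%:E)%E.
  by apply: eq_integral => x /set_mem w0x /=; rewrite ger0_norm//; exact: A0.
by rewrite energyE.
Qed.

Let mdotv : measurable_fun setT ((fun x => dotv (v x) (v x)) : borel V -> R).
Proof. exact: measurable_dotv. Qed.

Let dotv_v x : w0 x -> dotv (v x) (v x) <= gamma^-1 * quad (A x) (v x).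
Proof. by move=> w0x; rewrite ler_pdivlMl//; exact: coerA. Qed.

Let idotv : u0.-integrable w0 (EFin \o (fun x => dotv (v x) (v x))).
Proof.
apply: (le_integrable mw0 _ _ (integrableZl mw0 gamma^-1 iquadAv)).
  by apply/measurable_EFinP; exact: measurable_funTS.
move=> x w0x; rewrite /= lee_fin ger0_norm ?dotvv_ge0//.
by apply: le_trans (dotv_v w0x) _; exact: ler_norm.
Qed.

Let quadB_ge0 eta z : 0 <= quad (B eta) z.
Proof.
rewrite (quad_fiber_mean uhat cw0 cT mP bP); apply: Rintegral_ge0 => y [w0y _].
exact: coercive_quad_ge0 (ltW b0) (cP w0y).
Qed.

Let P0 x z : w0 x -> 0 <= quad (P x) z.
Proof. by move=> w0x; exact: coercive_quad_ge0 (ltW b0) (cP w0x). Qed.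

Let mcompT (p : V -> V) :
  (forall i, measurable_fun setT ((fun eta => p eta 0 i) : borel V -> R)) ->
  measurable_fun (w0 : set (borel V)) (fun x : borel V => quad (P x) (p (T x))).
Proof.
move=> mp; apply: measurable_quad => // i.
apply: (@eq_measurable_fun _ _ (borel V) _ _ (fun x => p (Tm x) 0 i)).
  by move=> x /set_mem w0x; rewrite /Tm TmodE.
by apply: measurable_funTS; exact: (measurableT_comp (mp i) mTm).
Qed.

Let push_quad (p : V -> V) :
  (forall i, measurable_fun setT ((fun eta => p eta 0 i) : borel V -> R)) ->
  u0.-integrable w0 (EFin \o (fun x => quad (P x) (p (T x)))) ->
  ubar.-integrable w1 (EFin \o (fun eta => quad (B eta) (p eta))) /\
  \int[u0]_(x in w0) quad (P x) (p (T x)) = \int[ubar]_(eta in w1) quad (B eta) (p eta).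
Proof.
move=> mp ip; have E := integral_quad_fiber_mean cw0 cT dis mP bP cP (ltW b0) mp.
split; last by rewrite /Rintegral E.
apply/integrableP; split.
  by apply/measurable_EFinP; apply: measurable_funTS; exact: measurable_quad.
have -> : (\int[ubar]_(x in w1) `|(EFin \o (fun eta => quad (B eta) (p eta))) x| =
    \int[ubar]_(x in w1) (quad (B x) (p x))%:E)%E.
  by apply: eq_integral => x _ /=; rewrite ger0_norm.
rewrite -E; have := integrable_fin_num mw0 ip.
by rewrite fin_numElt => /andP[].
Qed.

Let polar (M : 'M[R]_d) y z : M^T = M ->
  dotv (y *m M) z = 2^-1 * (quad M (y + z) - quad M y - quad M z).
Proof. by move=> sM; rewrite quad_sum//; lra. Qed.

(** The fibre means of [v] are [rho]: tested against a gradient, polarisation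
    reduces this to the image of quadratic forms under [T]. *)
Let velocity_mean (chi : C1 w1) :
  \int[u0]_(x in w0) dotv (v x) (grad w1 chi (T x)) = bracket (M0 w1) nu chi.
Proof.
pose p := gradm chi; pose wp eta := w eta + p eta.
have mp i := measurable_gradm chi i.
have mwp i : measurable_fun setT ((fun eta => wp eta 0 i) : borel V -> R).
  have -> : (fun eta : borel V => wp eta 0 i) = (fun eta => w eta 0 i + p eta 0 i).
    by apply/funext => eta; rewrite mxE.
  exact: measurable_funD.
have iw : u0.-integrable w0 (EFin \o (fun x => quad (P x) (w (T x)))).
  apply: (@eq_integrable _ _ _ u0 w0 mw0 _ _ _ iquadAv).
  by move=> x /set_mem w0x; rewrite /= quadAv.
have ip : u0.-integrable w0 (EFin \o (fun x => quad (P x) (p (T x)))).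
  apply: (@bounded_integrable _ _ _ _ _ ((d ^ 2)%:R * gamma^-1 * C1_norm chi ^+ 2)) => //.
    exact: mcompT.
  by move=> x w0x; rewrite /p gradmE; [exact: quadP_bound|exact: Tw].
have iwp : u0.-integrable w0 (EFin \o (fun x => quad (P x) (wp (T x)))).
  apply: (le_integrable mw0 _ _ (integrableZl mw0 2 (integrableD mw0 iw ip))).
    by apply/measurable_EFinP; exact: mcompT.
  move=> x w0x /=; rewrite lee_fin !ger0_norm ?mulr_ge0 ?addr_ge0 ?P0//.
  have := P0 (w (T x) + (-1) *: p (T x)) w0x.
  rewrite /wp !quad_sum ?sP// quadZ dotvZr; lra.
have [jw Ew] := push_quad mw iw.
have [jp Ep] := push_quad mp ip.
have [jwp Ewp] := push_quad mwp iwp.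
have -> : \int[u0]_(x in w0) dotv (v x) (grad w1 chi (T x)) =
   \int[u0]_(x in w0) (2^-1 * (quad (P x) (wp (T x)) - quad (P x) (w (T x))
     - quad (P x) (p (T x)))).
  apply: eq_Rintegral => x /set_mem w0x; rewrite vE// polar ?sP//.
  by rewrite /wp /p gradmE//; exact: Tw.
have i1 := integrableB mw0 iwp iw; have i2 := integrableB mw0 i1 ip.
rewrite RintegralZl; [|exact: mw0|exact: i2].
rewrite RintegralB; [|exact: mw0|exact: i1|exact: ip].
rewrite RintegralB; [|exact: mw0|exact: iwp|exact: iw].
rewrite Ew Ep Ewp.
have k1 := integrableB mw1 jwp jw; have k2 := integrableB mw1 k1 jp.
rewrite -RintegralB; [|exact: mw1|exact: jwp|exact: jw].
rewrite -RintegralB; [|exact: mw1|exact: k1|exact: jp].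
rewrite -RintegralZl; [|exact: mw1|exact: k2].
rewrite nuE; congr fine; apply: ae_eq_integral => //.
- by have /measurable_int := integrableZl mw1 2^-1 k2.
- apply/measurable_EFinP; apply: (@eq_measurable_fun _ _ (borel V) _ _
    (fun eta => \sum_i p eta 0 i * rho eta 0 i)).
    by move=> eta /set_mem w1eta; rewrite /p gradmE.
  apply: measurable_funTS; apply: measurable_sum => i; exact: measurable_funM.
- have := ae_good; apply: (ae_filterS ubar).
  move=> eta g w1eta; rewrite -polar// wB; last exact: g.
  by rewrite dotvC /p gradmE.
Qed.

Let iC1S (chi : C1 w1) (S : V -> V) : measurable_fun setT (S : borel V -> borel V) ->
  u0.-integrable w0 (EFin \o (fun x => chi (S x))).
Proof.
move=> mS; apply: (@bounded_integrable _ _ _ _ _ (C1_norm chi)) => //.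
  by apply: measurable_funTS; exact: (measurableT_comp (measurable_C1 chi) mS).
by move=> x _; exact: C1_norm_bound.
Qed.

(** The velocity is truncated so that all displaced points stay in the range
    of the expansions. *)
Let vt (k : nat) (x : V) : V := if dotv (v x) (v x) <= k.+1%:R ^+ 2 then v x else 0.

Let mvt k i : measurable_fun setT ((fun x => vt k x 0 i) : borel V -> R).
Proof.
have -> : (fun x : borel V => vt k x 0 i) = (fun x : borel V =>
    if dotv (v x) (v x) <= k.+1%:R ^+ 2 then v x 0 i else 0).
  by apply/funext => x; rewrite /vt; case: ifP => //; rewrite mxE.
apply: measurable_fun_ifT => //; apply: measurable_fun_ler => //.
Qed.

Let vt_le k x : dotv (vt k x) (vt k x) <= dotv (v x) (v x).
Proof. by rewrite /vt; case: ifP => //; rewrite dot0v dotvv_ge0. Qed.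

Let enorm_vt k x : enorm (vt k x) <= k.+1%:R.
Proof.
rewrite -(@ler_pXn2r _ 2)// ?nnegrE ?enorm_ge0 ?ler0n// sqr_enorm.
by rewrite /vt; case: ifP => //; rewrite dot0v sqr_ge0.
Qed.

Let quadA_vt k x : w0 x -> 0 <= quad (A x) (vt k x) <= quad (A x) (v x).
Proof.
move=> w0x; rewrite A0//= /vt; case: ifP => // _.
by rewrite [leLHS]quadE mul0mx dot0v A0.
Qed.

Let near_vt x : exists N : nat, forall k, (N <= k)%N -> vt k x = v x.
Proof.
exists (Num.bound (dotv (v x) (v x))) => k Nk; rewrite /vt ifT//.
apply: le_trans (ltW (archi_boundP (dotvv_ge0 _))) _.
apply: (@le_trans _ _ k.+1%:R); first by rewrite ler_nat leqW.
by rewrite expr2 ler_peMr ?ler1n// ler0n.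
Qed.

Section truncated_displacement.
Variable r : R.
Hypotheses (r0 : 0 < r) (hr : forall x z, w0 x -> enorm z <= r ->
    interior (rc_set w1) (T x + z) /\
    `|excess c phi T x (T x + z) - 2^-1 * quad (A x) z| <= 1 * dotv z z).

(* |vt k| <= k + 1, so t k * |vt k| <= r / (k + 1). *)
Let t (k : nat) : R := r * (k.+1%:R^-1 * k.+1%:R^-1).

Let t0 k : 0 < t k. Proof. by rewrite mulr_gt0// mulr_gt0 ?invr_gt0. Qed.

Let tV0 k : 0 <= (t k)^-1. Proof. by rewrite invr_ge0 ltW. Qed.

Let t_cvg0 : t k @[k --> \oo] --> (0 : R).
Proof.
have h := @cvg_harmonic R.
have H := cvgM (@cvg_cst _ r _ \oo _) (cvgM h h).
rewrite [X in _ --> X](_ : _ = 0) in H; first exact: H.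
by rewrite !mulr0.
Qed.

Let S k x : V := Tm x + t k *: vt k x.

Let mS k : measurable_fun setT (S k : borel V -> borel V).
Proof.
apply: measurable_rV => i.
have -> : (fun x : borel V => S k x 0 i) = (fun x => Tm x 0 i + t k * vt k x 0 i).
  by apply/funext => x; rewrite !mxE.
apply: measurable_funD; last by apply: measurable_funM => //; exact: measurable_cst.
apply: (measurableT_comp (f := fun u : borel V => (u : V) 0 i)) mTm.
by apply: continuous_borel_real; exact: coord_continuous.
Qed.

Let small k x : enorm (t k *: vt k x) <= r.
Proof.
rewrite enormZ ger0_norm ?(ltW (t0 k))//.
apply: (@le_trans _ _ (t k * k.+1%:R)); first by rewrite ler_pM2l.
rewrite /t -!mulrA mulVf ?pnatr_eq0// mulr1 ger_pMr// invf_le1 ?ltr0n//.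
by rewrite ler1n.
Qed.

Let SE k x : w0 x -> S k x = T x + t k *: vt k x.
Proof. by move=> w0x; rewrite /S /Tm TmodE. Qed.

Let Sw k x : w0 x -> rc_set w1 (S k x).
Proof.
move=> w0x; rewrite SE//; apply: interior_subset.
by have [] := hr w0x (small k x).
Qed.

Let u k := Pi (image_M u0 (mS k) (Sw k)).

Let h_ k : C1dual w1 := (t k)^-1 *: (u k - ub).

Let hE k : ub + t k *: h_ k = u k.
Proof. by rewrite /h_ scalerA mulfV ?gt_eqF// scale1r addrC subrK. Qed.

Let uE k chi : u k chi = \int[u0]_(x in w0) chi (S k x).
Proof.
rewrite [LHS]Pi_image setTw0//; exact: (measurableT_comp (measurable_C1 chi) (mS k)).
Qed.

Let hchi k chi : t k * h_ k chi = u k chi - ub chi.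
Proof.
change (t k * ((t k)^-1 * (u k chi - ub chi)) = u k chi - ub chi).
by rewrite mulVKf ?gt_eqF.
Qed.

(** The Lipschitz bound along the graph and [n <= 1 + n ^ 2] give the integrable
    majorant. *)
Let h_weak : weak_star_cvg h_ (bracket (M0 w1) nu).
Proof.
move=> chi; rewrite -velocity_mean.
have -> : (fun k => h_ k chi) = (fun k =>
    \int[u0]_(x in w0) ((t k)^-1 * (chi (S k x) - chi (T x)))).
  apply/funext => k; rewrite RintegralZl; first last.
  - by have := integrableB mw0 (iC1S chi (mS k)) (iC1T chi).
  - exact: mw0.
  rewrite RintegralB; [|exact: mw0|exact: (iC1S chi (mS k))|exact: iC1T].
  by rewrite -uE -ubE_w0.
have [L L0 hL] := C1_lipschitz_graph chi cw0 cT Tint.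
have i1 : u0.-integrable w0 (EFin \o (fun _ : V => 1 : R)).
  by apply: (@bounded_integrable _ _ _ _ _ 1) => // x _; rewrite normr1.
apply: (@dominated_Rcvg R _ (borel V) u0 w0
  (fun k x => (t k)^-1 * (chi (S k x) - chi (T x)))
  (fun x => dotv (v x) (grad w1 chi (T x))) (fun x => L * (1 + dotv (v x) (v x)))).
- exact: mw0.
- move=> k; apply/measurable_EFinP; have /measurable_int := integrableZl mw0 (t k)^-1
    (integrableB mw0 (iC1S chi (mS k)) (iC1T chi)).
  by [].
- move=> x w0x; apply/cvgrPdist_le => e e0.
  have n1 : 0 < enorm (v x) + 1 by rewrite ltr_wpDl ?enorm_ge0.
  have e'0 : 0 < e / (enorm (v x) + 1) by rewrite divr_gt0.
  have [s s0 hs] := grad_taylor chi cw0 cT Tint e'0.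
  have [N1 hN1] := near_vt x.
  have s1 : 0 < s / (enorm (v x) + 1) by rewrite divr_gt0.
  move: t_cvg0 => /cvgrPdist_le/(_ _ s1)[N2 _ hN2].
  exists (maxn N1 N2) => // k /=; rewrite geq_max => /andP[k1 k2].
  rewrite SE// hN1//.
  have tk : t k <= s / (enorm (v x) + 1).
    by have := hN2 k k2; rewrite /= sub0r normrN ger0_norm// ltW.
  have sz : enorm (t k *: v x) <= s.
    rewrite enormZ ger0_norm ?(ltW (t0 k))//.
    rewrite ler_pdivlMr// in tk; apply: le_trans tk; rewrite ler_pM2l// lerDl.
    by [].
  have [_] := hs x (t k *: v x) w0x sz.
  rewrite dotvZr enormZ (ger0_norm (ltW (t0 k))) => h.
  rewrite dotvC distrC.
  have -> : (t k)^-1 * (chi (T x + t k *: v x) - chi (T x)) - dotv (grad w1 chi (T x)) (v x)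
     = (t k)^-1 * (chi (T x + t k *: v x) - chi (T x) - t k * dotv (grad w1 chi (T x)) (v x)).
    by rewrite [RHS]mulrBr mulKf ?gt_eqF.
  rewrite normrM (ger0_norm (tV0 k)) ler_pdivrMl//.
  apply: le_trans h _; rewrite mulrCA ler_pM2l// mulrAC -mulrA ger_pMr//.
  by rewrite ler_pdivrMr// mul1r lerDl.
- have := integrableZl mw0 L (integrableD mw0 i1 idotv).
  by [].
- move=> k x w0x; rewrite normrM (ger0_norm (tV0 k)) ler_pdivrMl//.
  apply: le_trans (hL x (S k x) w0x (Sw k w0x)) _; rewrite SE// addrAC subrr add0r.
  rewrite mulrCA ler_pM2l// enormZ ger0_norm ?(ltW (t0 k))// ler_pM2l//.
  apply: (@le_trans _ _ (1 + dotv (vt k x) (vt k x))); last by rewrite lerD2l.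
  by rewrite -sqr_enorm; have := sqr_ge0 (enorm (vt k x) - 2^-1); lra.
Qed.

Let g k x : R := (t k ^+ 2 / 2)^-1 * excess c phi T x (S k x).

Let t2 k : 0 < t k ^+ 2. Proof. by rewrite exprn_gt0. Qed.

Let t22 k : 0 < t k ^+ 2 / 2. Proof. by rewrite divr_gt0. Qed.

Let t22V0 k : 0 <= (t k ^+ 2 / 2)^-1. Proof. by rewrite invr_ge0 ltW. Qed.

Let iexcess k : u0.-integrable w0 (EFin \o (fun x => excess c phi T x (S k x))).
Proof.
have := integrableB mw0 (integrableB mw0 (icS (mS k) (Sw k)) (iC1S phi (mS k)))
  (integrableB mw0 icT (iC1T phi)).
by [].
Qed.

Let excess_integral k : \int[u0]_(x in w0) c x (S k x) =
  optimal_cost + t k * h_ k phi + \int[u0]_(x in w0) excess c phi T x (S k x).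
Proof.
have i1 := integrableB mw0 (icS (mS k) (Sw k)) (iC1S phi (mS k)).
have i2 := integrableB mw0 icT (iC1T phi).
rewrite /excess RintegralB; [|exact: mw0|exact: i1|exact: i2].
rewrite RintegralB; [|exact: mw0|exact: (icS (mS k) (Sw k))|exact: (iC1S phi (mS k))].
rewrite RintegralB; [|exact: mw0|exact: icT|exact: (iC1T phi)].
rewrite hchi uE ubE_w0 /optimal_cost.
by move: (\int[u0]_(x in w0) c x (S k x)) (\int[u0]_(x in w0) c x (T x))
  (\int[u0]_(x in w0) phi (S k x)) (\int[u0]_(x in w0) phi (T x)) => *; lra.
Qed.

Let quotient_le k :
  ((ot_dual c u0 (ub + t k *: h_ k)%R - ot_dual c u0 ub - (t k * h_ k phi)%:E)
     * ((t k ^+ 2 / 2)^-1)%:E <= (\int[u0]_(x in w0) g k x)%:E)%E.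
Proof.
rewrite hE ot_dual_ub.
have -> : \int[u0]_(x in w0) g k x =
    2 * ((t k ^+ 2)^-1 * \int[u0]_(x in w0) excess c phi T x (S k x)).
  rewrite /g RintegralZl; [|exact: mw0|exact: iexcess].
  by rewrite invf_div mulrA.
apply: difference_quotient_le => //.
rewrite (mulVKf (lt0r_neq0 (t2 k))) -(excess_integral k).
apply: le_trans (@ot_dual_image _ _ _ _ _ _ cw0 cc _ (mS k) (Sw k)) _.
by rewrite /Rintegral fineK// (integrable_fin_num mw0 (icS (mS k) (Sw k))).
Qed.

(** The quotients converge pointwise by the expansion of the excess, which also
    dominates them because truncation does not increase the energy. *)
Let quotient_cvg : \int[u0]_(x in w0) g k x @[k --> \oo] -->
  \int[u0]_(x in w0) quad (A x) (v x).
Proof.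
apply: (@dominated_Rcvg R _ (borel V) u0 w0 g (fun x => quad (A x) (v x))
  (fun x => quad (A x) (v x) + 2 * dotv (v x) (v x))).
- exact: mw0.
- by move=> k; apply/measurable_EFinP; have /measurable_int :=
    integrableZl mw0 ((t k ^+ 2 / 2)^-1) (iexcess k).
- move=> x w0x; apply/cvgrPdist_le => e e0.
  have n1 : 0 < 2 * (dotv (v x) (v x) + 1) by rewrite mulr_gt0// ltr_wpDl ?dotvv_ge0.
  have n2 : 0 < enorm (v x) + 1 by rewrite ltr_wpDl ?enorm_ge0.
  have e'0 : 0 < e / (2 * (dotv (v x) (v x) + 1)) by rewrite divr_gt0.
  have [s s0 hs] := taylorE e'0.
  have [N1 hN1] := near_vt x.
  have s1 : 0 < s / (enorm (v x) + 1) by rewrite divr_gt0.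
  move: t_cvg0 => /cvgrPdist_le/(_ _ s1)[N2 _ hN2].
  exists (maxn N1 N2) => // k /=; rewrite geq_max => /andP[k1 k2].
  rewrite /g SE// hN1//.
  have tk : t k <= s / (enorm (v x) + 1).
    by have := hN2 k k2; rewrite /= sub0r normrN ger0_norm// ltW.
  have sz : enorm (t k *: v x) <= s.
    rewrite enormZ ger0_norm ?(ltW (t0 k))//.
    rewrite ler_pdivlMr// in tk; apply: le_trans tk; rewrite ler_pM2l// lerDl.
    by [].
  have [_] := hs x (t k *: v x) w0x sz.
  rewrite quadZ dotvZl dotvZr (mulrA (t k)) -expr2 => h.
  rewrite distrC.
  have -> : (t k ^+ 2 / 2)^-1 * excess c phi T x (T x + t k *: v x) - quad (A x) (v x)
     = (t k ^+ 2 / 2)^-1 * (excess c phi T x (T x + t k *: v x)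
         - 2^-1 * (t k ^+ 2 * quad (A x) (v x))).
    by field; rewrite gt_eqF.
  rewrite normrM (ger0_norm (t22V0 k)) ler_pdivrMl//.
  apply: le_trans h _.
  have eE : e = e / (2 * (dotv (v x) (v x) + 1)) * (2 * dotv (v x) (v x)) +
      2 * (e / (2 * (dotv (v x) (v x) + 1))).
    by field; rewrite gt_eqF// ltr_wpDl ?dotvv_ge0.
  set e' := e / _ in e'0 eE *; rewrite eE mulrDr.
  have h1 : 0 <= t k ^+ 2 / 2 * (2 * e') 
    by apply: mulr_ge0; [exact: (ltW (t22 k))|apply: mulr_ge0 => //; exact: (ltW e'0)].
  move: h1; move: (dotv _ _) (t k ^+ 2) => *; lra.
- have := integrableD mw0 iquadAv (integrableZl mw0 2 idotv).
  by [].
- move=> k x w0x; rewrite /g normrM (ger0_norm (t22V0 k)) ler_pdivrMl//.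
  have [_] := hr w0x (small k x); rewrite -SE// mul1r quadZ dotvZl dotvZr (mulrA (t k)) -expr2 => h.
  have /andP[q0 q1] := quadA_vt k w0x.
  apply: (@le_trans _ _ (t k ^+ 2 / 2 * (quad (A x) (vt k x) + 2 * dotv (vt k x) (vt k x)))).
    have := ler_normD (excess c phi T x (S k x) - 2^-1 * (t k ^+ 2 * quad (A x) (vt k x)))
      (2^-1 * (t k ^+ 2 * quad (A x) (vt k x))).
    rewrite subrK => h1; apply: le_trans h1 _.
    have h2 : 0 <= 2^-1 * (t k ^+ 2 * quad (A x) (vt k x)).
      by apply: mulr_ge0 => //; apply: mulr_ge0 => //; exact: (ltW (t2 k)).
    rewrite (ger0_norm h2).
    exact: majorant_arith h.
  rewrite ler_wpM2l ?(ltW (t22 k))//; apply: lerD => //.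
  by apply: ler_wpM2l => //; exact: vt_le.
Qed.

Lemma second_subderivative_le_of_range :
  (second_subderivative c u0 ub phi (bracket (M0 w1) nu)
     <= quad_integral ubar (fun eta => invmx (B eta)) rho)%E.
Proof.
apply: ge_ereal_inf; exists (limn_einf (fun k =>
  (ot_dual c u0 (ub + t k *: h_ k)%R - ot_dual c u0 ub - (t k * h_ k phi)%:E)
     * ((t k ^+ 2 / 2)^-1)%:E)%E).
  by exists (t, h_) => //=; split.
apply: (limn_einf_le_cvg quotient_le).
rewrite -energyE -(fineK (integrable_fin_num mw0 iquadAv)).
by apply: cvg_EFin; [exact: nearW|exact: quotient_cvg].
Qed.

End truncated_displacement.

(** Transporting [u0] along [T + t v] is admissible, and the second-order part
    of its cost is the energy of [v], which equals the integral of [rho]. *)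
Lemma second_subderivative_le :
  (second_subderivative c u0 ub phi (bracket (M0 w1) nu)
     <= quad_integral ubar (fun eta => invmx (B eta)) rho)%E.
Proof.
have [r r0 hr] := taylorE (@ltr01 R).
exact: second_subderivative_le_of_range r0 hr.
Qed.

End recovery_sequence.
End optimal_transport_expansion.

(** * Fast minimising sequences *)

Section almost_minimizers.
Context {R : realType} {E : lmodType R}.
Variables (q l : E -> R) (bf : E -> E -> R) (D : R).
Hypotheses (q_ge0 : forall x, 0 <= q x)
  (qE : forall x s y, q (x + s *: y) = q x + 2 * s * bf x y + s ^+ 2 * q y)
  (lE : forall x s y, l (x + s *: y) = l x + s * l y)
  (bound : forall x, 2 * l x - q x <= D).

Let q00 : q 0 = 0.
Proof.
have := qE 0 1 0; have := qE 0 (-1) 0; rewrite !scaler0 addr0.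
by move: (q 0) (bf 0 0) => a b; lra.
Qed.

Let bfE x : bf x x = q x.
Proof.
have := qE x (-1) x; rewrite scaleN1r subrr q00.
by move: (q x) (bf x x) => a b; lra.
Qed.

Let D0 : 0 <= D.
Proof.
have := lE 0 1 0; rewrite scaler0 addr0 => h; have := bound 0; rewrite q00.
by move: h; move: (l 0) => a; lra.
Qed.

(** Minimisers of [q / 2 - l] up to [p ^ 2], with [p] halved at every step, are
    Cauchy by the parallelogram identity. Variations of size [p] and [- p] show
    that they solve the Euler-Lagrange equation [bf x = l] up to [O(p)]; tested
    with [x] itself, it bounds [q x] by the bound [D] on [2 l - q]. *)
Lemma almost_minimizers : exists x : nat -> E,
  [/\ forall n, q (x n.+1 - x n) <= 8 * ((2 ^ n.+1)%:R^-1) ^+ 2,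
      forall n y, `|bf (x n) y - l y| <= (2 ^ n.+1)%:R^-1 * (1 + q y / 2) &
      forall n, q (x n) <= D + (2 ^ n.+1)%:R^-1 * (2 * D + 4)].
Proof.
pose J x := 2^-1 * q x - l x.
pose p n : R := (2 ^ n.+1)%:R^-1.
have p0 n : 0 < p n by rewrite invr_gt0 ltr0n expn_gt0.
have p1 n : p n <= 2^-1.
  by rewrite /p lef_pV2 ?posrE ?ltr0n ?expn_gt0// ler_nat expnS leq_pmulr// expn_gt0.
have pS n : p n.+1 <= p n.
  by rewrite /p lef_pV2 ?posrE ?ltr0n ?expn_gt0// ler_nat leq_exp2l.
have hi : has_inf (range J).
  split; first by exists (J 0), 0.
  by exists (- (D / 2)) => _ [x _ <-]; rewrite /J; have := bound x; lra.
have /choice[x hx] : forall n, exists x, J x <= inf (range J) + p n ^+ 2.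
  move=> n; have p2 : 0 < p n ^+ 2 by rewrite exprn_gt0.
  by have [_ [x _ <-] h] := inf_adherent p2 hi; exists x; exact: ltW.
have Jm y : inf (range J) <= J y by apply: ge_inf; [exact: hi.2|exists y].
exists x; split.
- move=> n; set y := x n.+1; set z := x n.
  have hy : J y <= inf (range J) + p n ^+ 2.
    apply: le_trans (hx n.+1) _; rewrite lerD2l ler_pXn2r// nnegrE ltW//.
  have hz : J z <= inf (range J) + p n ^+ 2 by exact: hx.
  have := Jm (z + 2^-1 *: (y - z)); move: hy hz.
  have yE : y = z + 1 *: (y - z) by rewrite scale1r subrKC.
  rewrite /J {1 2}yE !qE !lE -/(p n).
  move: (inf _) (q z) (l z) (l (y - z)) (q (y - z)) (bf _ _) (p n ^+ 2) => *; lra.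
- move=> n y; have hz := hx n; have pn := p0 n.
  have h s : 0 <= p n ^+ 2 + s * (bf (x n) y - l y) + 2^-1 * (s ^+ 2 * q y).
    have := Jm (x n + s *: y); move: hz; rewrite /J qE lE.
    move: (inf _) (q y) (l y) (l (x n)) (q (x n)) (bf _ _) (p n ^+ 2) (s ^+ 2) => *; lra.
  rewrite -/(p n) ler_norml; apply/andP; split.
    rewrite -(ler_pM2l pn); have := h (p n).
    by move: (bf _ _ - _) (q y) (p n) => *; lra.
  rewrite -(ler_pM2l pn); have := h (- p n).
  by move: (bf _ _ - _) (q y) (p n) => *; lra.
move=> n; have hz := hx n; have pn := p0 n.
have h s : 0 <= p n ^+ 2 + s * (bf (x n) (x n) - l (x n)) + 2^-1 * (s ^+ 2 * q (x n)).
  have := Jm (x n + s *: x n); move: hz; rewrite /J qE lE.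
  move: (inf _) (l (x n)) (q (x n)) (bf _ _) (p n ^+ 2) (s ^+ 2) => *; lra.
have h1 : q (x n) - l (x n) <= p n * (1 + q (x n) / 2).
  rewrite -(ler_pM2l pn); have := h (- p n); rewrite bfE.
  by move: (l _) (q _) (p n) => *; lra.
have := bound (x n); have := p1 n; have := q_ge0 (x n); move: h1; rewrite -/(p n).
move: (p n) (p0 n) D0 (l _) (q _) => a a0 d0 L Q h1 Q0 a1 h2.
have h3 : Q <= 2 * D + 2 by have := ler_wpM2r Q0 a1; lra.
have := ler_wpM2l (ltW a0) h3; lra.
Qed.

End almost_minimizers.

Section summable_integrals.
Context {R : realType} {dx : measure_display} {X : measurableType dx}.
Variables (mu : {measure set X -> \bar R}) (D : set X) (u : nat -> X -> R) (K : R).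
Hypotheses (mD : measurable D) (mfu : forall n, measurable_fun setT (u n))
  (u0 : forall n x, 0 <= u n x) (K0 : 0 <= K)
  (uK : forall n, (\int[mu]_(x in D) (u n x)%:E <= (K / (2 ^ n.+1)%:R)%:E)%E).

Lemma measurable_nneseries :
  measurable_fun setT (fun x => \sum_(n <oo) (u n x)%:E)%E.
Proof.
apply: ge0_emeasurable_sum => [n x _ _|n _]; first by rewrite lee_fin.
exact/measurable_EFinP.
Qed.

(** The masses [K / 2 ^ n.+1] add up to [K]. *)
Lemma integrable_nneseries :
  mu.-integrable D (fun x => \sum_(n <oo) (u n x)%:E)%E.
Proof.
apply/integrableP; split; first by apply: measurable_funTS; exact: measurable_nneseries.
rewrite (_ : (\int[mu]_(x in D) _ = \int[mu]_(x in D) \sum_(n <oo) (u n x)%:E)%E); last first.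
  apply: eq_integral => x _; rewrite gee0_abs// nneseries_ge0// => n _ _.
  by rewrite lee_fin.
have mu' n : measurable_fun D (EFin \o u n).
  by apply: measurable_funTS; exact/measurable_EFinP.
rewrite (integral_nneseries mu mD mu'); last by move=> n x _; rewrite lee_fin.
apply: le_lt_trans (ltry K).
apply: le_trans (epsilon_trick0 xpredT K0).
apply: lee_nneseries => [n _ _|n _]; last exact: uK.
by apply: integral_ge0 => x _; rewrite lee_fin.
Qed.

End summable_integrals.

(** Turns summability of integrals of increments, through
    [integrable_nneseries], into convergence almost everywhere. *)
Lemma summable_increments_cvg {R : realType} (a D : nat -> R) :
  (forall n, `|a n.+1 - a n| <= D n) -> (\sum_(n <oo) (D n)%:E < +oo)%E ->
  cvgn a.
Proof.
move=> aD fin.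
have D0 n : 0 <= D n by exact: le_trans (normr_ge0 _) (aD n).
have cs : cvgn (series (telescope a)).
  apply: normed_cvg; apply: nondecreasing_is_cvgn.
    by apply: nondecreasing_series => n _ _; exact: normr_ge0.
  exists (fine (\sum_(n <oo) (D n)%:E)%E) => _ [n _ <-].
  rewrite -lee_fin fineK; last first.
    by rewrite ge0_fin_numE// nneseries_ge0// => k _ _; rewrite lee_fin.
  apply: (@le_trans _ _ (\sum_(0 <= i < n) (D i)%:E)%E).
    by rewrite /series/= sumEFin lee_fin; apply: ler_sum => i _; exact: aD.
  by apply: nneseries_lim_ge => k _ _; rewrite lee_fin.
have -> : a = (fun n => a 0%N + series (telescope a) n).
  by apply/funext => n; rewrite -eq_sum_telescope.
by apply: is_cvgD => //; exact: is_cvg_cst.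
Qed.


(** * Functionals of finite energy are given by densities *)

Lemma enorm_increments {R : realType} {d : nat} (v : nat -> 'rV[R]_d) n :
  enorm (v n) <= enorm (v 0%N) +
    \sum_(0 <= k < n) \sum_i `|v k.+1 0 i - v k 0 i|.
Proof.
elim: n => [|n IH]; first by rewrite big_geq// addr0.
rewrite big_nat_recr//= addrA -[v n.+1](subrKC (v n)).
apply: le_trans (enormD _ _) _; apply: lerD => //.
apply: le_trans (enorm_le_sum _) _; apply: ler_sum => i _.
by rewrite subrKC mxE [X in _ + X]mxE.
Qed.

Section bracket_of_density.
Context {R : realType} {d : nat} (w1 : regular_compact R d) (ubar : Mpos w1).
Local Notation V := 'rV[R]_d.

Lemma bracket_density (nu : 'I_d -> M w1) (rho : V -> V) (chi : C1 w1) :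
  (forall i, ubar.-integrable setT (EFin \o (fun x : borel V => rho x 0 i))) ->
  (forall i (A : set (borel V)), measurable A ->
     nu i A = \int[ubar]_(x in A) (rho x 0 i)%:E)%E ->
  bracket (M0 w1) nu chi = \int[ubar]_(x in w1) dotv (grad w1 chi x) (rho x).
Proof.
move=> irho nuE; have cK := @rc_compact _ _ w1; have mK := compact_borel cK.
have cg i : {within w1, continuous (fun x => grad w1 chi x 0 i)}.
  exact/coord_within_continuous/grad_within_continuous.
rewrite bracket0E /dotv Rintegral_sum//.
  apply: eq_bigr => i _.
  apply: (charge_integral_density (g := fun x => rho x 0 i)) => //.
  exact: nuE.
move=> i; have irw : ubar.-integrable (w1 : set (borel V)) (EFin \o (fun x => rho x 0 i)).
  by apply: integrableS (irho i).
have := integrableZl mK (C1_norm chi) (integrable_abse irw).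
apply: le_integrable => //.
  apply/measurable_EFinP; apply: measurable_funM; last first.
    by apply/measurable_EFinP; exact: measurable_int irw.
  exact: within_continuous_measurable.
move=> x w1x /=; rewrite lee_fin !normrM normr_id (ger0_norm (C1_norm_ge0 chi)).
rewrite ler_wpM2r//; have [_] := C1_norm_ge chi w1x.
by apply: le_trans; exact: coord_le_enorm.
Qed.

End bracket_of_density.

Lemma cvg_sum_fin {R : realType} (I : finType) (f : I -> nat -> R) (a : I -> R) :
  (forall i, f i n @[n --> \oo] --> a i) ->
  \sum_i f i n @[n --> \oo] --> \sum_i a i.
Proof. by move=> fa; apply: cvg_big => //; exact: add_continuous. Qed.

Lemma young_le {R : realType} (p t a q : R) : 0 < p -> t ^+ 2 <= a * q ->
  t <= p + p^-1 * a * q.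
Proof.
move=> p0 h; rewrite -(ler_pM2l p0) mulrDr -mulrA mulVKf ?gt_eqF//.
have := sqr_ge0 (2 * p - t); have := sqr_ge0 t; move: h; move: (a * q) => X *; lra.
Qed.

Section gradient_riesz.
Context {R : realType} {d : nat}.
Local Notation V := 'rV[R]_d.
Variables (w1 : regular_compact R d) (ubar : Mpos w1) (B : V -> 'M[R]_d)
  (b C D : R) (h : C1dual w1).
Hypotheses (b0 : 0 < b) (C0 : 0 <= C)
  (mB : forall i j, measurable_fun setT (fun x : borel V => B x i j))
  (symB : forall x, (B x)^T = B x) (coerB : forall x, coercive b (B x))
  (bndB : forall x i j, `|B x i j| <= C).

Let mw1 : measurable (rc_set w1 : set (borel V)) :=
  compact_borel (@rc_compact _ _ w1).

Let energy (psi : C1 w1) : R := \int[ubar]_(x in w1) quad (B x) (gradm psi x).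

Let bform (psi chi : C1 w1) : R :=
  \int[ubar]_(x in w1) dotv (gradm psi x *m B x) (gradm chi x).

Hypothesis hD : forall psi, 2 * h psi - energy psi <= D.

Let K := (d ^ 2)%:R * C.

Let K0 : 0 <= K. Proof. by rewrite mulr_ge0. Qed.

Let bK x : mxbounded K (B x).
Proof. by apply: entries_mxbounded => // i j; exact: bndB. Qed.

Let B0 x v : 0 <= quad (B x) v := coercive_quad_ge0 v (ltW b0) (coerB x).

Let dotB_le x u v : `|dotv (u *m B x) v| <= K * enorm u * enorm v.
Proof.
by apply: le_trans (abs_dotv_le _ _) _; rewrite ler_wpM2r ?enorm_ge0//; exact: bK.
Qed.

Let idot (u : V -> V) (chi : C1 w1) (N : R) :
  (forall i, measurable_fun setT (fun x : borel V => u x 0 i)) ->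
  (forall x, enorm (u x) <= N) ->
  ubar.-integrable w1 (EFin \o (fun x => dotv (u x *m B x) (gradm chi x))).
Proof.
move=> mu uN; apply: (@bounded_integrable _ _ _ _ _ (K * N * C1_norm chi)) => //.
  apply: measurable_funTS; apply: measurable_dotv => i; last exact: measurable_gradm.
  by apply: measurable_mulmx.
move=> x _; apply: le_trans (dotB_le _ _ _) _.
apply: ler_pM; rewrite ?mulr_ge0 ?enorm_ge0//; last exact: enorm_gradm_le.
by rewrite ler_wpM2l.
Qed.

Let iB (psi chi : C1 w1) :
  ubar.-integrable w1 (EFin \o (fun x => dotv (gradm psi x *m B x) (gradm chi x))).
Proof.
apply: idot (enorm_gradm_le psi); exact: measurable_gradm.
Qed.

Let gradmL (psi chi : C1 w1) s x :
  gradm (psi + s *: chi) x = gradm psi x + s *: gradm chi x.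
Proof.
have [w1x|nw1x] := pselect (rc_set w1 x).
  have e : psi + s *: chi = s *: chi + psi by exact: addrC.
  by rewrite !gradmE// e (grad_lin _ _ _ w1x) addrC.
have n0 (f : C1 w1) : gradm f x = 0 by rewrite /gradm (memNset nw1x).
by rewrite (n0 psi) (n0 chi) (n0 (psi + s *: chi)) scaler0 addr0.
Qed.

Let iq (psi : C1 w1) : ubar.-integrable w1 (EFin \o (fun x => quad (B x) (gradm psi x))).
Proof.
apply: (@eq_integrable _ _ _ ubar w1 mw1 _ _ _ (iB psi psi)).
by move=> x _ /=; rewrite quadE.
Qed.

Let energy_ge0 psi : 0 <= energy psi.
Proof. by apply: Rintegral_ge0 => x _; exact: B0. Qed.

Let energyE psi s chi :
  energy (psi + s *: chi) = energy psi + 2 * s * bform psi chi + s ^+ 2 * energy chi.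
Proof.
have i1 : ubar.-integrable w1 (EFin \o (fun x => 2 * s * dotv (gradm psi x *m B x) (gradm chi x))).
  exact: (integrableZl mw1 (2 * s) (iB psi chi)).
have i2 : ubar.-integrable w1 (EFin \o (fun x => s ^+ 2 * quad (B x) (gradm chi x))).
  exact: (integrableZl mw1 (s ^+ 2) (iq chi)).
have i3 := integrableD mw1 (iq psi) i1.
have e1 : 2 * s * bform psi chi =
    \int[ubar]_(x in w1) (2 * s * dotv (gradm psi x *m B x) (gradm chi x)).
  by apply: esym; apply: RintegralZl; [exact: mw1|exact: iB].
have e2 : s ^+ 2 * energy chi = \int[ubar]_(x in w1) (s ^+ 2 * quad (B x) (gradm chi x)).
  by apply: esym; apply: RintegralZl; [exact: mw1|exact: iq].
rewrite e1 e2 /energy -RintegralD; [|exact: mw1|exact: iq|exact: i1].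
rewrite -RintegralD; [|exact: mw1|exact: i3|exact: i2].
apply: eq_Rintegral => x _; rewrite gradmL quad_sum// quadZ dotvZr.
by rewrite mulrA.
Qed.

Let hE psi s chi : h (psi + s *: chi) = h psi + s * h chi.
Proof. by rewrite [psi + _]addrC C1dual_linear addrC. Qed.

Let seqP := almost_minimizers energy_ge0 energyE hE hD.
Let psi_ : nat -> C1 w1 := sval (cid seqP).
Let p (n : nat) : R := (2 ^ n.+1)%:R^-1.
Let p0 n : 0 < p n. Proof. by rewrite invr_gt0 ltr0n expn_gt0. Qed.
Let psi_cauchy n : energy (psi_ n.+1 - psi_ n) <= 8 * p n ^+ 2.
Proof. by have [] := svalP (cid seqP). Qed.
Let psi_weak n chi : `|bform (psi_ n) chi - h chi| <= p n * (1 + energy chi / 2).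
Proof. by have [_ + _] := svalP (cid seqP); exact. Qed.
Let psi_energy n : energy (psi_ n) <= D + p n * (2 * D + 4).
Proof. by have [] := svalP (cid seqP). Qed.

Let p_cvg : p @ \oo --> (0 : R).
Proof.
have h1 : geometric 2^-1 2^-1 @ \oo --> (0 : R).
  by apply: cvg_geometric; rewrite ger0_norm// invf_lt1// ltr1n.
suff -> : p = geometric 2^-1 2^-1 by [].
by apply/funext => n; rewrite /p /geometric/= natrX exprS invfM exprVn.
Qed.

Let g n := gradm (psi_ n).

Let mg n i : measurable_fun setT (fun x : borel V => g n x 0 i).
Proof. exact: measurable_gradm. Qed.

(* A sum of absolute values, hence measurable and a bound for each coordinate. *)
Let dl n (x : borel V) : R := \sum_i `|g n.+1 x 0 i - g n x 0 i|.

Let mdl n : measurable_fun setT (dl n).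
Proof.
apply: measurable_sum => i; apply: measurableT_comp => //.
exact: measurable_funB.
Qed.

Let dl0 n x : 0 <= dl n x. Proof. exact: sumr_ge0. Qed.

Let gB n x : gradm (psi_ n.+1 - psi_ n) x = g n.+1 x - g n x.
Proof. by rewrite -[- psi_ n]scaleN1r gradmL scaleN1r. Qed.

Let K1 : R := fine (ubar w1) + d%:R ^+ 2 * (b^-1 * 8).

Let K10 : 0 <= K1.
Proof.
by rewrite addr_ge0 ?fine_ge0// mulr_ge0 ?sqr_ge0// mulr_ge0 ?invr_ge0 ?(ltW b0).
Qed.

(** Young's inequality with weight [p n], as the squares of the increments have
    integrals of order [p n ^ 2]. *)
Let dl_int n : (\int[ubar]_(x in w1) (dl n x)%:E <= (K1 / (2 ^ n.+1)%:R)%:E)%E.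
Proof.
pose q x := quad (B x) (gradm (psi_ n.+1 - psi_ n) x).
have iqn : ubar.-integrable w1 (EFin \o q) := iq _.
have ic : ubar.-integrable w1 (EFin \o (fun=> p n)).
  by apply: (@bounded_integrable _ _ _ _ _ `|p n|).
have iqz : ubar.-integrable w1 (EFin \o (fun x => (p n)^-1 * (d%:R ^+ 2 * b^-1) * q x)).
  exact: (integrableZl mw1 _ iqn).
have isum : ubar.-integrable w1
    (EFin \o (fun x => p n + (p n)^-1 * (d%:R ^+ 2 * b^-1) * q x)).
  exact: (integrableD mw1 ic iqz).
apply: (@le_trans _ _ (\int[ubar]_(x in w1)
    (p n + (p n)^-1 * (d%:R ^+ 2 * b^-1) * q x)%:E)%E).
  apply: ge0_le_integral => //.
  - by move=> x _; rewrite lee_fin.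
  - by apply: measurable_funTS; exact/measurable_EFinP.
  - exact: measurable_int isum.
  move=> x _; rewrite lee_fin.
  have h1 : dl n x <= d%:R * enorm (g n.+1 x - g n x).
    rewrite -sumr_ord_const; apply: ler_sum => i _.
    have := coord_le_enorm (g n.+1 x - g n x) i.
    by rewrite mxE [X in _ + X]mxE.
  apply: le_trans h1 _.
  have h2 : enorm (g n.+1 x - g n x) ^+ 2 <= b^-1 * q x.
    by rewrite ler_pdivlMl// sqr_enorm -gB; exact: coerB.
  have h3 := ler_wpM2l (sqr_ge0 (d%:R : R)) h2.
  apply: (young_le (p0 n)); rewrite exprMn; apply: le_trans h3 _.
  by rewrite mulrA.
rewrite -[leLHS]fineK; last exact: (integrable_fin_num mw1 isum).
rewrite lee_fin -/(Rintegral ubar _ _).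
have -> : \int[ubar]_(x in w1) (p n + (p n)^-1 * (d%:R ^+ 2 * b^-1) * q x) =
    p n * fine (ubar w1) + (p n)^-1 * (d%:R ^+ 2 * b^-1) * energy (psi_ n.+1 - psi_ n).
  rewrite RintegralD; [|exact: mw1|exact: ic|exact: iqz].
  rewrite RintegralZl; [|exact: mw1|exact: iqn].
  by rewrite Rintegral_cst.
rewrite /K1; have h1 := psi_cauchy n; have h2 : 0 <= (p n)^-1 * (d%:R ^+ 2 * b^-1).
  by rewrite mulr_ge0 ?invr_ge0 ?(ltW (p0 n))// mulr_ge0 ?sqr_ge0// invr_ge0 ltW.
rewrite mulrDl lerD//; first by rewrite mulrC.
apply: le_trans (ler_wpM2l h2 h1) _.
rewrite le_eqVlt; apply/orP; left; apply/eqP.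
by rewrite -!/(p n); field; rewrite !gt_eqF.
Qed.


Let S (x : borel V) : \bar R := (\sum_(n <oo) (dl n x)%:E)%E.

Let mS : measurable_fun setT S := measurable_nneseries mdl dl0.

Let S0 x : (0 <= S x)%E.
Proof. by apply: nneseries_ge0 => n _ _; rewrite lee_fin. Qed.

Let ae_S : {ae ubar, forall x, rc_set w1 x -> (S x < +oo)%E}.
Proof.
have := integrable_ae mw1 (integrable_nneseries mw1 mdl dl0 K10 dl_int).
apply: (ae_filterS ubar) => x h1 w1x.
by rewrite -ge0_fin_numE; [exact: h1|exact: S0].
Qed.

(* Where the increments are not summable the gradients are replaced by 0. *)
Let gc n (x : V) : V := if (S x < +oo)%E then g n x else 0.

Let mgc n i : measurable_fun setT (fun x : borel V => gc n x 0 i).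
Proof.
have -> : (fun x : borel V => gc n x 0 i) =
    (fun x : borel V => if (S x < +oo)%E then g n x 0 i else 0).
  by apply/funext => x; rewrite /gc; case: ifP => // _; rewrite mxE.
apply: measurable_fun_ifT; [|exact: mg|exact: measurable_cst].
by apply: measurable_fun_lte; [exact: mS|exact: measurable_cst].
Qed.

Let G (x : V) : V := \row_i lim (gc n x 0 i @[n --> \oo]).

Let gc_cvg x i : gc n x 0 i @[n --> \oo] --> G x 0 i.
Proof.
rewrite /G mxE; have [Sx|nSx] := boolP (S x < +oo)%E.
  apply: (@summable_increments_cvg R (fun n => gc n x 0 i) (fun n => dl n x)) => // n.
  rewrite /gc Sx /dl (bigD1 i)//= lerDl.
  by apply: sumr_ge0 => j _.
have -> : (fun n => gc n x 0 i) = (fun=> 0).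
  by apply/funext => n; rewrite /gc (negbTE nSx) mxE.
by apply: is_cvg_cst.
Qed.

Let mG i : measurable_fun setT (fun x : borel V => G x 0 i).
Proof.
by apply: (measurable_fun_cvg (fun n => mgc n i)) => x _; exact: gc_cvg.
Qed.

Let gc_le n x : enorm (gc n x) <= C1_norm (psi_ 0%N) + fine (S x).
Proof.
rewrite /gc; have [Sx|nSx] := boolP (S x < +oo)%E; last first.
  by rewrite enorm0 addr_ge0 ?C1_norm_ge0// fine_ge0.
apply: le_trans (enorm_increments (fun n => g n x) n) _.
apply: lerD; first exact: enorm_gradm_le.
rewrite -lee_fin fineK ?ge0_fin_numE//.
rewrite -(sumEFin _ _ (fun k => dl k x)).
by apply: nneseries_lim_ge => k _ _; rewrite lee_fin.
Qed.

Let iS : ubar.-integrable w1 (EFin \o (fun x => fine (S x))).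
Proof.
have iS1 := integrable_nneseries mw1 mdl dl0 K10 dl_int.
apply: (le_integrable mw1 _ _ iS1).
  apply/measurable_EFinP; apply: measurable_funTS.
  exact: (measurableT_comp (fine_measurable measurableT) mS).
move=> x _; rewrite /= -/(S x) (gee0_abs (S0 x)) (ger0_norm (fine_ge0 (S0 x))).
by move: (S x) (S0 x) => [r| |] //= _; rewrite leey.
Qed.

Let ae_gc n : {ae ubar, forall x, rc_set w1 x -> gc n x = g n x}.
Proof.
move: ae_S; apply: (ae_filterS ubar) => x h1 w1x.
by rewrite /gc h1.
Qed.

Let quad_cvg x : quad (B x) (gc n x) @[n --> \oo] --> quad (B x) (G x).
Proof.
rewrite quad_entries (_ : (fun n => _) =
  (fun n => \sum_i \sum_j gc n x 0 i * gc n x 0 j * B x i j)); last first.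
  by apply/funext => n; rewrite quad_entries.
apply: cvg_sum_fin => i; apply: cvg_sum_fin => j.
by apply: cvgMl; apply: cvgM.
Qed.

(** Fatou's lemma along the sequence. *)
Let G_energy : (\int[ubar]_(x in w1) (quad (B x) (G x))%:E <= D%:E)%E.
Proof.
have mq n : measurable_fun (rc_set w1 : set (borel V))
    (fun x : borel V => (quad (B x) (gc n x))%:E).
  by apply/measurable_EFinP; apply: measurable_funTS; apply: measurable_quad.
have q0 n (x : borel V) : rc_set w1 x -> (0 <= (quad (B x) (gc n x))%:E)%E.
  by move=> _; rewrite lee_fin; exact: B0.
have := fatou ubar mw1 mq q0.
rewrite (_ : (\int[ubar]_(x in w1) _ = \int[ubar]_(x in w1) (quad (B x) (G x))%:E)%E); last first.
  apply: eq_integral => x _.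
  have H : (fun n => (quad (B x) (gc n x))%:E) @ \oo --> (quad (B x) (G x))%:E.
    by apply: cvg_EFin; [exact: nearW|exact: quad_cvg].
  by have [] := cvg_limn_einf_sup H.
move/le_trans; apply.
apply: (@limn_einf_le_cvg _ _ (fun n => (D + p n * (2 * D + 4))%:E)).
  move=> n; apply: (@le_trans _ _ (energy (psi_ n))%:E); last first.
    by rewrite lee_fin; exact: psi_energy.
  rewrite /energy /Rintegral fineK; last exact: (integrable_fin_num mw1 (iq (psi_ n))).
  rewrite le_eqVlt; apply/orP; left; apply/eqP; apply: ae_eq_integral => //.
    exact: measurable_int (iq (psi_ n)).
  move: (ae_gc n); apply: (ae_filterS ubar) => x h1 w1x.
  by rewrite h1.
apply: cvg_EFin; first exact: nearW.
rewrite -[X in _ --> X]addr0; apply: cvgD; first exact: cvg_cst.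
rewrite -(mul0r (2 * D + 4)); apply: cvgMl; exact: p_cvg.
Qed.

(** The limit solves the Euler-Lagrange equation; the first gradient plus the sum
    of all increments dominates the sequence. *)
Let G_weak chi : h chi = \int[ubar]_(x in w1) dotv (G x *m B x) (gradm chi x).
Proof.
have c1 : \int[ubar]_(x in w1) dotv (gc n x *m B x) (gradm chi x) @[n --> \oo] -->
    \int[ubar]_(x in w1) dotv (G x *m B x) (gradm chi x).
  apply: (@dominated_Rcvg R _ (borel V) ubar w1 _ _
    (fun x => K * C1_norm chi * (C1_norm (psi_ 0%N) + fine (S x)))).
  - exact: mw1.
  - move=> n; apply: measurable_funTS; apply: measurable_dotv => i.
      by apply: measurable_mulmx.
    exact: measurable_gradm.
  - move=> x _; apply: cvg_sum_fin => i; apply: cvgMl.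
    rewrite mxE (_ : (fun n => _) = (fun n => \sum_j gc n x 0 j * B x j i)); last first.
      by apply/funext => n; rewrite mxE.
    by apply: cvg_sum_fin => j; apply: cvgMl.
  - have ic : ubar.-integrable w1 (EFin \o (fun=> C1_norm (psi_ 0%N))).
      by apply: (@bounded_integrable _ _ _ _ _ `|C1_norm (psi_ 0%N)|).
    by have := integrableZl mw1 (K * C1_norm chi) (integrableD mw1 ic iS).
  move=> n x _; apply: le_trans (dotB_le _ _ _) _.
  rewrite mulrAC; apply: ler_pM; rewrite ?mulr_ge0 ?enorm_ge0//.
  by apply: ler_wpM2l => //; exact: enorm_gradm_le.
have c2 : bform (psi_ n) chi @[n --> \oo] --> h chi.
  apply/cvgrPdist_le => e e0.
  have n1 : 0 < 1 + energy chi / 2 by rewrite ltr_pwDl// divr_ge0.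
  have e1 : 0 < e / (1 + energy chi / 2) by rewrite divr_gt0.
  move: p_cvg => /cvgrPdist_le/(_ _ e1); apply: filterS => n.
  rewrite sub0r normrN (ger0_norm (ltW (p0 n))) ler_pdivlMr// => pn.
  by rewrite distrC; apply: le_trans (psi_weak n chi) pn.
apply: (cvg_unique _ c2); first exact: norm_hausdorff.
suff -> : (fun n => bform (psi_ n) chi) =
  (fun n => \int[ubar]_(x in w1) dotv (gc n x *m B x) (gradm chi x)) by [].
apply/funext => n; congr fine; apply: ae_eq_integral => //.
- exact: measurable_int (iB _ _).
- apply/measurable_EFinP; apply: measurable_funTS; apply: measurable_dotv => i.
    by apply: measurable_mulmx.
  exact: measurable_gradm.
move: (ae_gc n); apply: (ae_filterS ubar) => x h1 w1x.
by rewrite h1.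
Qed.

Let rho (x : V) : V := G x *m B x.

Let mrho i : measurable_fun setT (fun x : borel V => rho x 0 i).
Proof. exact: measurable_mulmx. Qed.

Let rho_quad x : quad (invmx (B x)) (rho x) = quad (B x) (G x).
Proof.
have uB := coercive_unitmx b0 (coerB x).
by rewrite quad_invmx// /rho mulmxK.
Qed.

Let rho_sqr x i : rho x 0 i ^+ 2 <= K ^+ 2 * b^-1 * quad (B x) (G x).
Proof.
have h1 : rho x 0 i ^+ 2 <= enorm (rho x) ^+ 2.
  by rewrite -real_normK ?num_real// ler_pXn2r ?nnegrE ?enorm_ge0//; exact: coord_le_enorm.
have h2 : enorm (rho x) ^+ 2 <= (K * enorm (G x)) ^+ 2.
  by rewrite ler_pXn2r ?nnegrE ?mulr_ge0 ?enorm_ge0//; exact: bK.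
apply: le_trans h1 _; apply: le_trans h2 _.
rewrite exprMn -mulrA ler_wpM2l ?sqr_ge0// ler_pdivlMl// sqr_enorm.
exact: coerB.
Qed.

Let rho_L2 i : (fun x : borel V => rho x 0 i) \in Lfun ubar 2%:E.
Proof.
rewrite inE; apply/andP; split; rewrite inE/=; first exact: mrho.
rewrite /finite_norm unlock /=; apply: poweR_lty.
have m2 : measurable_fun setT (fun x : borel V => rho x 0 i ^+ 2).
  by apply: measurable_funX; exact: mrho.
rewrite (_ : (\int[ubar]_x _ = \int[ubar]_x (rho x 0 i ^+ 2)%:E)%E); last first.
  by apply: eq_integral => x _; rewrite powR_mulrn// real_normK// num_real.
rewrite (@concentrated_integralT _ _ _ w1)//; [|exact: Mpos_on|exact/measurable_EFinP].
have mq : measurable_fun (rc_set w1 : set (borel V)) (fun x : borel V => (quad (B x) (G x))%:E).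
  by apply/measurable_EFinP; apply: measurable_funTS; apply: measurable_quad.
have k0 : 0 <= K ^+ 2 * b^-1 by rewrite mulr_ge0 ?sqr_ge0// invr_ge0 ltW.
apply: (@le_lt_trans _ _ (\int[ubar]_(x in w1) ((K ^+ 2 * b^-1)%:E * (quad (B x) (G x))%:E))%E).
  apply: ge0_le_integral => //.
  - by move=> x _; rewrite lee_fin sqr_ge0.
  - by apply: measurable_funTS; exact/measurable_EFinP.
  - by apply: emeasurable_funM => //; exact: measurable_cst.
  - by move=> x _; rewrite -EFinM lee_fin; exact: rho_sqr.
rewrite ge0_integralZl//; last by move=> x _; rewrite lee_fin; exact: B0.
apply: (@le_lt_trans _ _ ((K ^+ 2 * b^-1)%:E * D%:E)%E); last by rewrite -EFinM ltry.
by apply: lee_wpmul2l; [rewrite lee_fin|exact: G_energy].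
Qed.

(** A functional that is bounded by the energy of gradients is represented by a
    density whose dual energy obeys the same bound. No Hilbert space completion
    is formed: the limit field is found almost everywhere. *)
Lemma gradient_riesz : exists rho : L2vec ubar,
  h = bracket (M0 w1) (density_measure rho) /\
  (quad_integral ubar (fun x => invmx (B x)) rho <= D%:E)%E.
Proof.
exists (MkL2vec rho_L2); split.
  apply/val_inj/funext => chi /=.
  have e := @bracket_density _ _ _ ubar (density_measure (MkL2vec rho_L2)) rho chi.
  rewrite /= in e; rewrite e; last 2 first.
  - by move=> i; exact: (L2vec_integrable (MkL2vec rho_L2) i).
  - by [].
  rewrite G_weak; apply: eq_Rintegral => x /set_mem w1x.
  by rewrite dotvC gradmE.
rewrite /quad_integral /=; under eq_integral do rewrite rho_quad.
exact: G_energy.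
Qed.

End gradient_riesz.

Lemma invmx_psd {R : realType} {d : nat} (A : 'M[R]_d) : A^T = A ->
  (forall v, 0 <= quad A v) -> forall v, 0 <= quad (invmx A) v.
Proof.
move=> sA A0 v; have [uA|nuA] := boolP (A \in unitmx); first by rewrite quad_invmx.
by rewrite /invmx (negbTE nuA).
Qed.

Section matrix_fields.
Context {R : realType} {d : nat}.
Local Notation V := 'rV[R]_d.
Variables (w1 : regular_compact R d) (ubar : Mpos w1) (B : V -> 'M[R]_d)
  (b C : R) (good : set V).
Hypotheses (b0 : 0 < b) (C0 : 0 <= C)
  (mB : forall i j, measurable_fun setT (fun x : borel V => B x i j))
  (mgood : measurable (good : set (borel V)))
  (ae_good : {ae ubar, forall x, rc_set w1 x -> good x})
  (symB : forall x, good x -> (B x)^T = B x)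
  (coerB : forall x, good x -> coercive b (B x))
  (bndB : forall x, good x -> forall i j, `|B x i j| <= C).

Let mw1 : measurable (rc_set w1 : set (borel V)) :=
  compact_borel (@rc_compact _ _ w1).

(* Almost everywhere equal to B, with the properties of B everywhere. *)
Let B1 (x : V) : 'M[R]_d := if x \in good then B x else b%:M.

Let B1E x : good x -> B1 x = B x.
Proof. by move=> gx; rewrite /B1 mem_set. Qed.

Let mB1 i j : measurable_fun setT (fun x : borel V => B1 x i j).
Proof.
have -> : (fun x : borel V => B1 x i j) =
    (fun x => if x \in (good : set (borel V)) then B x i j else (b%:M : 'M[R]_d) i j).
  by apply/funext => x; rewrite /B1; case: ifP.
apply: measurable_fun_ifT; [|exact: mB|exact: measurable_cst].
apply: (measurable_fun_bool true); rewrite setTI.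
rewrite (_ : _ @^-1` _ = (good : set (borel V)))//.
by apply/seteqP; split => x /=; [exact: set_mem|exact: mem_set].
Qed.

Let symB1 x : (B1 x)^T = B1 x.
Proof.
rewrite /B1; case: ifPn => [/set_mem gx|_]; first exact: symB.
exact: tr_scalar_mx.
Qed.

Let coerB1 x : coercive b (B1 x).
Proof.
rewrite /B1; case: ifPn => [/set_mem gx|_ v]; first exact: coerB.
by rewrite quadE mul_mx_scalar dotvZl.
Qed.

Let bndB1 x i j : `|B1 x i j| <= C + b.
Proof.
rewrite /B1; case: ifPn => [/set_mem gx|_].
  by apply: le_trans (bndB gx i j) _; rewrite lerDl ltW.
rewrite mxE; case: (i == j); rewrite /= ?mulr1n ?mulr0n ?normr0.
  by rewrite ger0_norm ?lerDr// ltW.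
by rewrite addr_ge0// ltW.
Qed.

(** On a null set the matrices may be replaced by [b%:M], which changes neither
    the energies nor the dual form. *)
Lemma gradient_riesz_ae (h : C1dual w1) (D : R) :
  (forall psi : C1 w1,
     2 * h psi - \int[ubar]_(x in w1) quad (B x) (grad w1 psi x) <= D) ->
  exists rho : L2vec ubar, h = bracket (M0 w1) (density_measure rho) /\
    (quad_integral ubar (fun x => invmx (B x)) rho <= D%:E)%E.
Proof.
move=> hD.
have [psi|rho [hE Q]] := @gradient_riesz R d w1 ubar B1 b (C + b) D h b0
  (addr_ge0 C0 (ltW b0)) mB1 symB1 coerB1 bndB1.
  rewrite (_ : \int[ubar]_(x in w1) _ = \int[ubar]_(x in w1) quad (B x) (grad w1 psi x)).
    exact: hD.
  congr fine; apply: ae_eq_integral => //.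
  - apply/measurable_EFinP; apply: measurable_funTS; apply: measurable_quad => //.
    exact: measurable_gradm.
  - apply/measurable_EFinP.
    apply: (@eq_measurable_fun _ _ (borel V) _ _ (fun x => quad (B x) (gradm psi x))).
      by move=> x /set_mem w1x; rewrite gradmE.
    apply: measurable_funTS; apply: measurable_quad => //; exact: measurable_gradm.
  - move: ae_good; apply: (ae_filterS ubar) => x gx w1x.
    by rewrite gradmE// B1E//; exact: gx.
exists rho; split => //; apply: le_trans Q; rewrite le_eqVlt; apply/orP; left.
have mrho i : measurable_fun setT (fun x : borel V => rho x 0 i).
  by apply/measurable_EFinP; have /measurable_int := L2vec_integrable rho i.
apply/eqP; apply: ae_eq_integral => //.
- apply/measurable_EFinP; apply: measurable_funTS; apply: measurable_quad => // i j.
  exact: measurable_invmx.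
- apply/measurable_EFinP; apply: measurable_funTS; apply: measurable_quad => // i j.
  exact: measurable_invmx.
- move: ae_good; apply: (ae_filterS ubar) => x gx w1x.
  by rewrite B1E//; exact: gx.
Qed.

(** Inverses of bounded coercive matrices are coercive, so the dual form is
    definite. *)
Lemma quad_integral_eq0 (rho : V -> V) :
  (forall x v, 0 <= quad (invmx (B x)) v) ->
  (forall i, measurable_fun setT (fun x : borel V => rho x 0 i)) ->
  quad_integral ubar (fun x => invmx (B x)) rho = 0%E ->
  {ae ubar, forall x, rc_set w1 x -> rho x = 0}.
Proof.
move=> q0 mrho Q0.
have mq : measurable_fun (rc_set w1 : set (borel V))
    (fun x : borel V => (quad (invmx (B x)) (rho x))%:E).
  apply/measurable_EFinP; apply: measurable_funTS; apply: measurable_quad => // i j.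
  exact: measurable_invmx.
have /(ae_eq_integral_abs ubar mw1 mq) H :
    (\int[ubar]_(x in w1) `|(quad (invmx (B x)) (rho x))%:E| = 0)%E.
  rewrite -[RHS]Q0; apply: eq_integral => x _.
  by rewrite gee0_abs// lee_fin.
have := @filterI _ _ (ae_filter_ringOfSetsType ubar) _ _ H ae_good.
apply: (ae_filterS ubar) => x [H1 gx] w1x.
have sB := symB (gx w1x); have cB := coerB (gx w1x).
have K0 : 0 < (d ^ 2)%:R * C + 1 by rewrite ltr_wpDl// mulr_ge0.
have bB : mxbounded ((d ^ 2)%:R * C + 1) (B x).
  move=> v; apply: le_trans (entries_mxbounded C0 (bndB (gx w1x)) v) _.
  by rewrite ler_wpM2r ?enorm_ge0// lerDl.
have := invmx_coercive b0 K0 sB cB bB (rho x).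
have e0 : quad (invmx (B x)) (rho x) = 0 by apply: EFin_inj; exact: H1 w1x.
rewrite e0.
rewrite pmulr_rle0 ?divr_gt0 ?exprn_gt0// -sqr_enorm => h.
apply: enorm_eq0; apply/eqP; rewrite -sqrf_eq0.
by rewrite eq_le h sqr_ge0.
Qed.

End matrix_fields.

Section densities.
Context {R : realType} {d : nat}.
Local Notation V := 'rV[R]_d.
Variables (w1 : regular_compact R d) (ubar : Mpos w1).

Let mw1 : measurable (rc_set w1 : set (borel V)) :=
  compact_borel (@rc_compact _ _ w1).

Lemma ae_concentrated (P : V -> Prop) :
  {ae ubar, forall x, rc_set w1 x -> P x} <-> {ae ubar, forall x, P x}.
Proof.
split; last first.
  by apply: (ae_filterS ubar) => x.
have H : {ae ubar, forall x, rc_set w1 x}.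
  exists (~` (rc_set w1 : set (borel V))); split => //; first exact: measurableC.
  exact: concentrated_measureC mw1 (Mpos_on ubar).
move=> h; have := @filterI _ _ (ae_filter_ringOfSetsType ubar) _ _ H h.
by apply: (ae_filterS ubar) => x [w1x]; exact.
Qed.

Section absolutely_continuous.
Variable nu : 'I_d -> M w1.
Hypothesis ac : forall i, nu i `<< ubar.

Lemma vector_densityE i : EFin \o (fun x : borel V => vector_density ubar nu x 0 i) =
  Radon_Nikodym (nu i) ubar.
Proof.
apply/funext => x /=; rewrite mxE fineK//; apply: Radon_Nikodym_fin_num; exact: ac.
Qed.

Lemma vector_density_integrable i :
  ubar.-integrable setT (EFin \o (fun x : borel V => vector_density ubar nu x 0 i)).
Proof. by rewrite vector_densityE; apply: Radon_Nikodym_integrable; exact: ac. Qed.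

Lemma vector_density_integral i (A : set (borel V)) : measurable A ->
  nu i A = (\int[ubar]_(x in A) (vector_density ubar nu x 0 i)%:E)%E.
Proof.
move=> mA; rewrite (Radon_Nikodym_integral (ac i) mA) -vector_densityE.
by [].
Qed.

Lemma measurable_vector_density i :
  measurable_fun setT (fun x : borel V => vector_density ubar nu x 0 i).
Proof. by apply/measurable_EFinP; exact: measurable_int (vector_density_integrable i). Qed.

End absolutely_continuous.

Lemma density_measure_ac (rho : L2vec ubar) i : density_measure rho i `<< ubar.
Proof.
by apply: (density_charge_dominates (g := fun x => rho x 0 i)) => //;
  exact: L2vec_integrable.
Qed.

(** Densities are unique almost everywhere. *)
Lemma vector_density_density_measure (rho : L2vec ubar) :
  {ae ubar, forall x, vector_density ubar (density_measure rho) x = rho x}.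
Proof.
have ac := density_measure_ac rho.
have H i : {ae ubar, forall x, setT x ->
    (vector_density ubar (density_measure rho) x 0 i)%:E = (rho x 0 i)%:E}.
  apply: (integral_ae_eq measurableT (vector_density_integrable ac i)).
    exact: measurable_int (L2vec_integrable rho i).
  by move=> E _ mE; rewrite -vector_density_integral.
have := @filter_forall _ _ _ (almost_everywhere ubar) (ae_filter_ringOfSetsType ubar) H.
apply: (ae_filterS ubar) => x H1.
by apply/rowP => i; apply: EFin_inj; exact: H1 i I.
Qed.

End densities.

(** * Equivalence of the second-order conditions *)

Section equivalence.
Context {R : realType} {d : nat}.
Local Notation V := 'rV[R]_d.
Variables (w1 : regular_compact R d) (ubar : Mpos w1) (alpha : R)
  (F2 : {biscalar (C1dual w1)}) (D2 : C1dual w1 -> \bar R) (H : V -> 'M[R]_d).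
Hypotheses (alpha0 : 0 < alpha)
  (mH : forall i j, measurable_fun setT (fun x : borel V => H x i j))
  (H0 : forall x v, 0 <= quad (H x) v)
  (Hdef : forall rho : V -> V,
    (forall i, measurable_fun setT (fun x : borel V => rho x 0 i)) ->
    quad_integral ubar H rho = 0%E -> {ae ubar, forall x, rho x = 0})
  (upper : forall (nu : 'I_d -> M w1) (rho : V -> V),
    (forall i, measurable_fun setT (fun x : borel V => rho x 0 i)) ->
    (forall chi : C1 w1, bracket (M0 w1) nu chi =
       \int[ubar]_(eta in w1) dotv (grad w1 chi eta) (rho eta)) ->
    (quad_integral ubar H rho < +oo)%E ->
    (D2 (bracket (M0 w1) nu) <= quad_integral ubar H rho)%E)
  (lower : forall h, (D2 h < +oo)%E -> exists rho : L2vec ubar,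
    h = bracket (M0 w1) (density_measure rho) /\
    (quad_integral ubar H rho <= D2 h)%E).

Let a2 : 0 < alpha / 2. Proof. by rewrite divr_gt0. Qed.

Let infinite_gt0 (x a : R) : 0 < a -> (0 < x%:E + a%:E * +oo)%E.
Proof. by move=> a0; rewrite gt0_muley ?lte_fin// addey ?lt0y. Qed.

Let Q0 (rho : V -> V) : (0 <= quad_integral ubar H rho)%E.
Proof. by apply: integral_ge0 => x _; rewrite lee_fin. Qed.

Let half (Q : \bar R) : (alpha%:E * ((2^-1)%:E * Q) = (alpha / 2)%:E * Q)%E.
Proof. by rewrite muleA -EFinM. Qed.

Let mw1 : measurable (rc_set w1 : set (borel V)) :=
  compact_borel (@rc_compact _ _ w1).

Let F20 : F2 0 0 = 0.
Proof. exact: linear0l. Qed.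

(** The equivalence for any [D2] that satisfies the upper bound and the
    representation property with respect to a definite [H]. *)
Lemma second_order_equivalence :
  [<-> forall h : C1dual w1, h <> 0 ->
         (0 < (F2 h h)%:E + (alpha / 2)%:E * D2 h)%E;
       forall nu : 'I_d -> M w1, bracket (M0 w1) nu <> 0 ->
         (0 < (F2 (bracket (M0 w1) nu) (bracket (M0 w1) nu))%:E
              + (alpha / 2)%:E * D2 (bracket (M0 w1) nu))%E;
       forall nu : 'I_d -> M w1, nonzero_measure nu ->
         (0 < (F2 (bracket (M0 w1) nu) (bracket (M0 w1) nu))%:E
              + alpha%:E * gstar ubar H nu)%E;
       forall rho : L2vec ubar, nonzero_L2 rho ->
         (0 < (F2 (bracket (M0 w1) (density_measure rho))
                  (bracket (M0 w1) (density_measure rho)))%:E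
              + (alpha / 2)%:E * quad_integral ubar H rho)%E].
Proof.
tfae.
- by move=> ha nu; exact: ha.
- move=> hb nu nu0; rewrite /gstar; case: asboolP => [ac|_]; last exact: infinite_gt0.
  rewrite half; set rho := vector_density ubar nu.
  have mrho := measurable_vector_density ac.
  have [Qoo|Qfin] := eqVneq (quad_integral ubar H rho) +oo%E.
    by rewrite Qoo; exact: infinite_gt0.
  have nuE chi : bracket (M0 w1) nu chi =
      \int[ubar]_(eta in w1) dotv (grad w1 chi eta) (rho eta).
    apply: (bracket_density chi (vector_density_integrable ac)).
    exact: vector_density_integral.
  (* A nonzero measure may induce the zero functional, which the premise excludes. *)
  have [b0|b0] := pselect (bracket (M0 w1) nu = 0); last first.
    apply: lt_le_trans (hb nu b0) _; apply: leeD2l.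
    apply: lee_wpmul2l; first by rewrite lee_fin ltW.
    by apply: upper => //; rewrite ltey.
  rewrite b0 F20 add0e mule_gt0 ?lte_fin// lt_def Q0 andbT.
  apply/eqP => Qz; apply: nu0 => i A mA.
  rewrite (vector_density_integral ac i mA).
  rewrite (_ : 0%E = (\int[ubar]_(x in A) 0%E)%E); last by rewrite integral0.
  apply: ae_eq_integral => //.
    by apply: measurable_funTS; exact/measurable_EFinP.
  move: (Hdef mrho Qz); apply: (ae_filterS ubar).
  by move=> x rx0 _; rewrite rx0 mxE.
- move=> hc rho rho0.
  have ac := density_measure_ac rho.
  have nu0 : nonzero_measure (density_measure rho).
    move=> nuz; apply: rho0.
    have Hi i : {ae ubar, forall x, setT x -> (rho x 0 i)%:E = 0%E}.
      apply: (integral_ae_eq measurableT (L2vec_integrable rho i)).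
        exact: measurable_cst.
      by move=> E _ mE; rewrite integral0; exact: nuz.
    have := @filter_forall _ _ _ (almost_everywhere ubar) (ae_filter_ringOfSetsType ubar) Hi.
    apply: (ae_filterS ubar) => x H1.
    by apply/rowP => i; rewrite [RHS]mxE; apply: EFin_inj; exact: H1 i I.
  have := hc _ nu0; rewrite /gstar asboolT// half.
  suff -> : quad_integral ubar H (vector_density ubar (density_measure rho)) =
      quad_integral ubar H rho by [].
  apply: ae_eq_integral => //.
  + apply/measurable_EFinP; apply: measurable_funTS; apply: measurable_quad => // i.
    exact: measurable_vector_density.
  + apply/measurable_EFinP; apply: measurable_funTS; apply: measurable_quad => // i.
    by apply/measurable_EFinP; have /measurable_int := L2vec_integrable rho i.
  + move: (vector_density_density_measure rho).
    by apply: (ae_filterS ubar) => x -> _.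
- move=> hd h h0.
  have [D2oo|D2fin] := eqVneq (D2 h) +oo%E; first by rewrite D2oo; exact: infinite_gt0.
  have [|rho [hE hQ]] := @lower h; first by rewrite ltey.
  have rho0 : nonzero_L2 rho.
    move=> rz; apply: h0; rewrite hE; apply/val_inj/funext => chi /=.
    have e := @bracket_density _ _ _ ubar (density_measure rho) rho chi
      (L2vec_integrable rho) (fun _ _ _ => erefl).
    rewrite /= in e; rewrite e.
    rewrite /Rintegral (_ : (\int[ubar]_(x in w1) _ = \int[ubar]_(x in w1) 0%E)%E).
      by rewrite integral0.
    apply: ae_eq_integral => //.
      apply/measurable_EFinP; apply: measurable_dotv => i.
        apply: within_continuous_measurable; first exact: rc_compact.
        exact/coord_within_continuous/grad_within_continuous.
      apply: measurable_funTS.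
      by apply/measurable_EFinP; have /measurable_int := L2vec_integrable rho i.
    move: rz; apply: (ae_filterS ubar) => x -> _.
    by rewrite dotvC dot0v.
  apply: lt_le_trans (hd rho rho0) _; rewrite -hE; apply: leeD2l.
  by apply: lee_wpmul2l => //; rewrite lee_fin ltW.
Qed.

End equivalence.

(** A neighbourhood of [T x] pulls back to a neighbourhood of [x] in [w0], which
    [u0] charges. *)
Lemma transport_map_support {R : realType} {d : nat} (w0 : set 'rV[R]_d)
    (w1 : regular_compact R d) (u0 : Mpos w0) (ubar : Mpos w1)
    (T : 'rV[R]_d -> 'rV[R]_d)
    (uhat : R.-pker (borel 'rV[R]_d) ~> (borel 'rV[R]_d)) :
  compact w0 -> {within w0, continuous T} -> is_disintegration u0 ubar T uhat ->
  msupport u0 = w0 -> forall x, w0 x -> msupport ubar (T x).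
Proof.
move=> cw0 cT dis supp0 x w0x U oU UTx.
have mw0 := compact_borel cw0.
have /subspace_continuousP/(_ x w0x) cTx := cT.
have : within w0 (nbhs x) (T @^-1` U) by apply: cTx; exact: open_nbhs_nbhs.
rewrite /within/= nbhsE => -[W [oW Wx] WU].
have mW := open_borel oW; have mU := open_borel oU.
have uW : (0 < u0 W)%E.
  have H : msupport u0 x by rewrite supp0.
  exact: (H W oW Wx).
rewrite (transported_measure cw0 cT dis mU); apply: lt_le_trans uW _.
have mTU : measurable (Tmod w0 T @^-1` U : set (borel 'rV[R]_d)).
  by rewrite -[X in measurable X]setTI; exact: (measurable_Tmod cw0 cT).
rewrite (concentrated_measureI mw0 (Mpos_on u0) mW).
apply: le_measure; rewrite ?inE//; first exact: measurableI.
by move=> y [Wy w0y]; rewrite /= TmodE//; exact: WU.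
Qed.

(** On the fibre over [eta] the evaluation point [eta] is [T y]. *)
Lemma HmatrixE {R : realType} {d : nat} (w0 : set 'rV[R]_d)
    (w1 : regular_compact R d) (c : 'rV[R]_d -> 'rV[R]_d -> R) (phi : C1 w1)
    (T : 'rV[R]_d -> 'rV[R]_d)
    (uhat : R.-pker (borel 'rV[R]_d) ~> (borel 'rV[R]_d)) :
  Hmatrix w0 c T uhat phi =
  (fun eta => invmx (fiber_mean w0 T uhat (fun x => invmx (excess_hessian c phi T x)) eta)).
Proof.
apply/funext => eta; apply: (congr1 invmx); apply: eq_mx => i j.
apply: eq_Rintegral => y /set_mem[_ Ty].
by apply: (congr1 (fun M : 'M[R]_d => invmx M i j)); rewrite /excess_hessian Ty.
Qed.

Lemma near_enorm {R : realType} {d : nat} (x : 'rV[R]_d) (eps : R) : 0 < eps ->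
  \forall y \near x, enorm (y - x) <= eps.
Proof.
move=> eps0; have d0 : 0 < d%:R + 1 :> R by rewrite ltr_wpDl.
apply/nbhs_ballP; exists (eps / (d%:R + 1)); first by rewrite /= divr_gt0.
move=> y; rewrite -ball_normE /= distrC => h.
apply: le_trans (enorm_le_normv _) _.
apply: (@le_trans _ _ ((d%:R + 1) * `|y - x|)).
  by rewrite ler_wpM2r// lerDl.
by rewrite mulrC -ler_pdivlMr// ltW.
Qed.

Theorem lemma5p3 (R : realType) (d : nat)
  (w0 : set 'rV[R]_d) (w1 : regular_compact R d)
  (c : 'rV[R]_d -> 'rV[R]_d -> R)
  (u0 : Mpos w0) (ubar : Mpos w1) (alpha : R)
  (F : C1dual w1 -> R) (F1 : C1 w1) (F2 : {biscalar (C1dual w1)})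
  (T : 'rV[R]_d -> 'rV[R]_d) (gamma : R)
  (uhat : R.-pker (borel 'rV[R]_d) ~> (borel 'rV[R]_d)) :
  let ub := Pi (M_of_Mpos ubar) in
  let phi := - (2 / alpha) *: F1 in
  let H := Hmatrix w0 c T uhat phi in
  let D2 := second_subderivative c u0 ub phi in
  (* standing assumptions *)
  0 < alpha ->
  compact w0 ->
  uniformly_locally_quasiconvex (interior (rc_set w1)) ->
  {within w0 `*` w1, continuous (fun z => c z.1 z.2)} ->
  (0 < u0 w0)%E ->
  msupport u0 = w0 ->
  ubar w1 = u0 w0 ->
  (* (A) *)
  bounded_bilinear F2 ->
  second_order_expansion c u0 F ub F1 F2 ->
  weak_star_seq_continuous (fun h => F2 h h) ->
  (* (B) *)
  twice_continuously_differentiable_on (w0 `*` w1) (fun z => c z.1 z.2) ->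
  msupport ubar `<=` interior (rc_set w1) ->
  kantorovich_potential c u0 (M_of_Mpos ubar) phi ->
  (exists2 eps : R, 0 < eps &
    let N := [set x + y | x in msupport ubar & y in [set y | enorm y <= eps]] in
    N `<=` interior (rc_set w1) /\
    twice_continuously_differentiable_on N phi) ->
  (forall x, w0 x -> rc_set w1 (T x)) ->
  0 < gamma ->
  (forall x eta, w0 x -> rc_set w1 eta ->
    c x (T x) - phi (T x) + gamma / 2 * enorm (eta - T x) ^+ 2
      <= c x eta - phi eta) ->
  is_disintegration u0 ubar T uhat ->
  [<-> (* (a) *)
       forall h : C1dual w1, h <> 0 ->
         (0 < (F2 h h)%:E + (alpha / 2)%:E * D2 h)%E;
       (* (b); nonzero is meant in C^1(w1)^*, as divergence-free measures
          induce the zero functional *)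
       forall nu : 'I_d -> M w1, bracket (M0 w1) nu <> 0 ->
         (0 < (F2 (bracket (M0 w1) nu) (bracket (M0 w1) nu))%:E
              + (alpha / 2)%:E * D2 (bracket (M0 w1) nu))%E;
       (* (c) *)
       forall nu : 'I_d -> M w1, nonzero_measure nu ->
         (0 < (F2 (bracket (M0 w1) nu) (bracket (M0 w1) nu))%:E
              + alpha%:E * gstar ubar H nu)%E;
       (* (d) *)
       forall rho : L2vec ubar, nonzero_L2 rho ->
         (0 < (F2 (bracket (M0 w1) (density_measure rho))
                  (bracket (M0 w1) (density_measure rho)))%:E
              + (alpha / 2)%:E * quad_integral ubar H rho)%E].
Proof.
move=> ub phi H D2 alpha0 cw0 _ cc _ supp0 _ _ _ _ [Uc [gc [oUc Ucw gcE gc1 gc2]]]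
  suppint _ [eps eps0 [_ [Up [gp [oUp NUp gpE gp1 gp2]]]]] Tw1 gamma0 grow dis.
have gcC2 : C2on Uc gc by split.
have gpC2 : C2on Up gp by split.
have growth x eta : w0 x -> rc_set w1 eta ->
    gamma / 2 * enorm (eta - T x) ^+ 2 <= excess c phi T x eta.
  by move=> w0x w1eta; rewrite /excess lerBrDl; exact: grow.
have cT := transport_map_continuous Ucw gcE gcC2 Tw1 gamma0 growth.
have Tsupp := transport_map_support cw0 cT dis supp0.
have Tint x (w0x : w0 x) : interior (rc_set w1) (T x) := suppint _ (Tsupp x w0x).
have Tnear x eta : w0 x -> enorm (eta - T x) <= eps ->
    [set x + y | x in msupport ubar & y in [set y | enorm y <= eps]] eta.
  move=> w0x h; exists (T x); first exact: Tsupp.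
  by exists (eta - T x) => //; rewrite subrKC.
have TUp x : w0 x -> Up (T x).
  by move=> w0x; apply: NUp; apply: (Tnear x) => //; rewrite subrr enorm0 ltW.
have gpn x : w0 x -> \forall eta \near T x, gp eta = phi eta.
  move=> w0x; apply: filterS (near_enorm (T x) eps0) => eta h.
  by apply: gpE; exact: Tnear h.
pose A := excess_hessian c phi T.
have taylorE := excess_taylor cw0 oUc Ucw gcE gcC2 oUp TUp gpC2 gpn Tint gamma0 growth.
have coerA := excess_hessian_coercive cw0 oUc Ucw gcE gcC2 oUp TUp gpC2 gpn Tint gamma0 growth.
have symA := tr_excess_hessian oUc Ucw gcE gcC2 oUp TUp gpC2 gpn Tint.
have contA i j := @excess_hessian_continuous _ _ _ _ _ _ _ _ _ _ Ucw gcE gcC2 _ _ TUp gpC2 gpn Tint gamma0 growth i j.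
have [m m0 bndA] := excess_hessian_bounded cw0 Ucw gcE gcC2 TUp gpC2 gpn Tint gamma0 growth.
pose P x := invmx (A x).
have mP i j : measurable_fun (w0 : set (borel 'rV[R]_d))
    (fun x : borel 'rV[R]_d => P x i j).
  apply: measurable_invmx; first exact: compact_borel.
  by move=> k l; apply: within_continuous_measurable => //; exact: contA.
have bP x : w0 x -> forall i j, `|P x i j| <= gamma^-1.
  move=> w0x i j; apply: mxbounded_entry.
  exact: invmx_mxbounded gamma0 (symA x w0x) (coerA x w0x).
have sP x : w0 x -> (P x)^T = P x.
  by move=> w0x; apply: trmx_invmx; exact: symA.
have cP x : w0 x -> coercive (gamma / m ^+ 2) (P x).
  move=> w0x.
  exact: invmx_coercive gamma0 m0 (symA x w0x) (coerA x w0x) (bndA x w0x).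
have b0 : 0 < gamma / m ^+ 2 by rewrite divr_gt0// exprn_gt0.
have g0 : 0 <= gamma^-1 by rewrite invr_ge0 ltW.
pose B := fiber_mean w0 T uhat P.
have HE : H = (fun eta => invmx (B eta)) by exact: HmatrixE.
have mB i j : measurable_fun setT (fun eta : borel 'rV[R]_d => B eta i j).
  exact: (measurable_fiber_mean uhat cw0 cT g0 mP bP).
have sB eta : (B eta)^T = B eta by exact: tr_fiber_mean.
have B0 eta v : 0 <= quad (B eta) v.
  rewrite /B (quad_fiber_mean uhat cw0 cT mP bP); apply: Rintegral_ge0 => x [w0x _].
  exact: coercive_quad_ge0 (ltW b0) (cP x w0x).
have H0 eta v : 0 <= quad (invmx (B eta)) v := invmx_psd (sB eta) (B0 eta) v.
have mgood := measurable_good_fiber w1 uhat cw0 cT.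
have aegood := ae_good_fiber cw0 cT dis.
have cB eta : good_fiber w0 w1 T uhat eta -> coercive (gamma / m ^+ 2) (B eta).
  exact: (fiber_mean_coercive cw0 cT mP bP cP).
have bB eta : good_fiber w0 w1 T uhat eta -> forall i j, `|B eta i j| <= gamma^-1.
  by move=> geta i j; exact: (fiber_mean_bounded cw0 cT g0 mP bP i j geta).
have mH i j : measurable_fun setT (fun eta : borel 'rV[R]_d => invmx (B eta) i j).
  exact: measurable_invmx.
have Hdef (rho : 'rV[R]_d -> 'rV[R]_d) :
    (forall i, measurable_fun setT (fun x : borel 'rV[R]_d => rho x 0 i)) ->
    quad_integral ubar (fun eta => invmx (B eta)) rho = 0%E ->
    {ae ubar, forall x, rho x = 0}.
  move=> mrho Q0; apply/(ae_concentrated ubar).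
  exact: (@quad_integral_eq0 _ _ w1 ubar B _ _ _ b0 g0 mB aegood
    (fun eta _ => sB eta) cB bB rho H0 mrho Q0).
have upper (nu : 'I_d -> M w1) (rho : 'rV[R]_d -> 'rV[R]_d) :=
  @second_subderivative_le _ _ w0 w1 c u0 ubar phi T gamma m uhat A cw0 cc cT
    Tint gamma0 m0 growth taylorE symA coerA bndA contA dis nu rho.
have lower (h : C1dual w1) : (D2 h < +oo)%E -> exists rho : L2vec ubar,
    h = bracket (M0 w1) (density_measure rho) /\
    (quad_integral ubar (fun eta => invmx (B eta)) rho <= D2 h)%E.
  move=> hfin.
  have low psi := @second_subderivative_ge _ _ w0 w1 c u0 ubar phi T gamma m uhat A cw0
    cc cT Tint gamma0 m0 growth taylorE symA coerA bndA contA dis psi h.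
  have D2fin : D2 h \is a fin_num.
    by rewrite fin_numElt hfin andbT; exact: (lt_le_trans (ltNyr _) (low 0)).
  have lowR psi : 2 * h psi - \int[ubar]_(x in w1) quad (B x) (grad w1 psi x)
      <= fine (D2 h).
    by rewrite -lee_fin (fineK D2fin); exact: low.
  have [rho [hE Q]] := @gradient_riesz_ae _ _ w1 ubar B _ _ _ b0 g0 mB mgood aegood
    (fun eta _ => sB eta) cB bB h _ lowR.
  by exists rho; split; [exact: hE|rewrite (fineK D2fin) in Q].
have main := @second_order_equivalence _ _ w1 ubar alpha F2 D2
  (fun eta => invmx (B eta)) alpha0 mH H0 Hdef upper lower.
by clearbody H D2; subst H; exact: main.
Qed.
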